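(* Let $N\ge2$, $R\ge0$, and let $\Sigma=\mathbb{R}^N$ if $R=0$ and $\Sigma=\{x\in\mathbb{R}^N:|x|>R\}$ if $R>0$. Put $I:=[R,\infty)$ and let $f:[0,\infty)\times I\times\mathbb{R}\to\mathbb{R}$, $(t,r,u)\mapsto f(t,r,u)$, satisfy the following. (i) $f$ is continuous in $t$ and $r$, and locally uniformly Lipschitz in $u$, that is, for every bounded interval $J\subset I$ and every $K>0$ there is $C=C(K,J)>0$ such that $|f(t,r,u)-f(t,r,v)|\le C|u-v|$ for all $r\in J$, $t>0$, $u,v\in[-K,K]$. (ii) $\sup_{r\ge R,\,t>0,\,s\in\mathbb{R}}|f_u(t,r,s)|=:C_0<\infty$. Let $V:[0,\infty)\to\mathbb{R}$ be a continuous function such that $$\min_{(\rho,\infty)}V>\max_{\mathcal J}|V|+4\frac{\lambda_1}{|\mathcal J|^2}+2C_0$$ for some $\rho>R$ and some interval $\mathcal J\subset[R,\rho)$. Let $u\in C^{2,1}(\Sigma\times(0,\infty))\cap C(\overline\Sigma\times[0,\infty))$ be a classical solution of $$u_t-\Delta u+V(|x|)u=f(t,|x|,u)\ \text{ in }\Sigma\times(0,\infty),\qquad u=0\ \text{ on }\partial\Sigma\times(0,\infty),\qquad u(x,0)=u_0(x)\ \text{ for } x\in\Sigma,$$ such that: (a) $u_0\in C_0(\overline\Sigma)$ and there is $e\in\mathbb{S}^{N-1}$ with $u_0(x)\ge u_0(\sigma_e(x))$ for all $x\in\Sigma(e)$ and $u_0\not\equiv u_0\circ\sigma_e$; (b)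 $\lim_{|x|\to\infty}\sup_{t>0}|u(x,t)|=0$; (c) $\|u\|_{L^\infty(\Sigma\times(0,\infty))}<\infty$. Then $u$ is asymptotically foliated Schwarz symmetric, that is, there is $p\in\mathbb{S}^{N-1}$ such that every $z\in\omega(u)$ is foliated Schwarz symmetric with respect to $p$.
   Context: $\mathbb{S}^{N-1}=\{x\in\mathbb{R}^N:|x|=1\}$. For $e\in\mathbb{S}^{N-1}$: $\Sigma(e):=\{x\in\Sigma:x\cdot e>0\}$ and $\sigma_e(x):=x-2(x\cdot e)e$. $\lambda_1$ is the principal eigenvalue of the Dirichlet Laplacian on the unit ball $B_1(0)\subset\mathbb{R}^N$, and $|\mathcal J|$ is the length of the interval $\mathcal J$. By (i), $f_u(t,r,u)$ exists for almost every $u$; the supremum of $|f_u|$ is taken where $f_u$ exists. If $R=0$, $\partial\Sigma=\emptyset$ and there is no boundary condition. $C_0(\overline\Sigma)$ is the space of continuous functions on $\overline\Sigma$ which decay to zero at infinity and vanish on $\partial\Sigma$, with the supremum norm. The omega-limit set is $\omega(u):=\{z\in C_0(\overline\Sigma): z(x)=\lim_{n\to\infty}u(x,t_n)\text{ for } x\in\Sigma\text{ and some } t_n\to\infty\}$. A function $z\in C(\Sigma)$ is foliated Schwarz symmetric with respect to $p\in\mathbb{S}^{N-1}$ if $z$ is axially symmetric with respect to the axis $\mathbb{R}p$ and nonincreasing in the polar angle $\theta=\arccos\left(\frac{x}{|x|}\cdot p\right)\in[0,\pi]$. *)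

(* Defs.v *)
From HB Require Import structures.
From mathcomp Require Import all_boot all_order all_algebra.
From mathcomp Require Import all_classical all_reals all_analysis.

Set Implicit Arguments.
Unset Strict Implicit.
Unset Printing Implicit Defensive.

Import Order.TTheory GRing.Theory Num.Theory.
Import numFieldNormedType.Exports.

Local Open Scope classical_set_scope.
Local Open Scope ring_scope.

(* Points of R^N are row vectors.  The library norm on 'rV[R]_N is the
   sup-norm: it is used only through the topology it induces, and |x| is
   [enorm x]. *)

Definition dot (R : realType) (N : nat) (x y : 'rV[R]_N) : R :=
  \sum_(i < N) x 0 i * y 0 i.

Definition enorm (R : realType) (N : nat) (x : 'rV[R]_N) : R :=
  Num.sqrt (dot x x).

Definition usphere (R : realType) (N : nat) : set 'rV[R]_N :=
  [set x | enorm x = 1].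
Arguments usphere R N : clear implicits.

Definition uball (R : realType) (N : nat) : set 'rV[R]_N :=
  [set x | enorm x < 1].
Arguments uball R N : clear implicits.

Definition Sigma (R : realType) (N : nat) (rad : R) : set 'rV[R]_N :=
  if rad == 0 then setT else [set x | rad < enorm x].
Arguments Sigma {R} N rad.

(* Topological boundary of an open set. *)
Definition bdry (R : realType) (N : nat) (A : set 'rV[R]_N) : set 'rV[R]_N :=
  closure A `\` A.

Definition half_domain (R : realType) (N : nat) (A : set 'rV[R]_N) (e : 'rV[R]_N) :
    set 'rV[R]_N :=
  [set x | A x /\ 0 < dot x e].

Definition refl_hyp (R : realType) (N : nat) (e x : 'rV[R]_N) : 'rV[R]_N :=
  x - (2 * dot x e) *: e.

(* The filter "|x| tends to infinity, x in A". *)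
Definition at_infinity (R : realType) (N : nat) (A : set 'rV[R]_N) :
    set_system 'rV[R]_N :=
  filter_from [set: R] (fun M => [set x | A x /\ M < enorm x]).

Definition partial (R : realType) (N : nat) (i : 'I_N) (phi : 'rV[R]_N -> R) :
    'rV[R]_N -> R :=
  fun x => 'D_(delta_mx 0 i : 'rV[R]_N) phi x.

Definition has_partial (R : realType) (N : nat) (i : 'I_N)
    (phi : 'rV[R]_N -> R) (x : 'rV[R]_N) : Prop :=
  derivable phi x (delta_mx 0 i : 'rV[R]_N).

Definition laplacian (R : realType) (N : nat) (phi : 'rV[R]_N -> R)
    (x : 'rV[R]_N) : R :=
  \sum_(i < N) partial i (partial i phi) x.

(* phi is C^2 on the open set A. *)
Definition C2_on (R : realType) (N : nat) (A : set 'rV[R]_N)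
    (phi : 'rV[R]_N -> R) : Prop :=
  [/\ {within A, continuous phi},
      forall i : 'I_N, (forall x, A x -> has_partial i phi x) /\
        {within A, continuous (partial i phi)}
    & forall i j : 'I_N, (forall x, A x -> has_partial j (partial i phi) x) /\
        {within A, continuous (partial j (partial i phi))} ].

(* u is C^{2,1} on A x (0,oo), with A open: u, u_t, u_{x_i} and u_{x_i x_j}
   exist there and are jointly continuous in (x,t). *)
Definition C21_on (R : realType) (N : nat) (A : set 'rV[R]_N)
    (u : 'rV[R]_N -> R -> R) : Prop :=
  let Q : set ('rV[R]_N * R) := A `*` `]0, +oo[ in
  [/\ {within Q, continuous (fun y : 'rV[R]_N * R => u y.1 y.2)},
      (forall x (t : R), A x -> 0 < t -> derivable (u x) t 1) /\
        {within Q, continuous (fun y : 'rV[R]_N * R => 'D_1 (u y.1) y.2)},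
      forall i : 'I_N,
        (forall x (t : R), A x -> 0 < t -> has_partial i (u^~ t) x) /\
        {within Q, continuous
           (fun y : 'rV[R]_N * R => partial i (u^~ y.2) y.1)}
    & forall i j : 'I_N,
        (forall x (t : R), A x -> 0 < t ->
           has_partial j (partial i (u^~ t)) x) /\
        {within Q, continuous
           (fun y : 'rV[R]_N * R => partial j (partial i (u^~ y.2)) y.1)} ].

(* lambda is the principal eigenvalue of the Dirichlet Laplacian on the unit
   ball: the eigenvalue that possesses a positive eigenfunction. *)
Definition principal_eigenvalue_ball (R : realType) (N : nat) (lambda : R) :
    Prop :=
  exists phi : 'rV[R]_N -> R,
    [/\ C2_on (uball R N) phi,
        {within closure (uball R N), continuous phi},
        forall x, uball R N x -> 0 < phi x,
        forall x, bdry (uball R N) x -> phi x = 0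
      & forall x, uball R N x -> - laplacian phi x = lambda * phi x ].
Arguments principal_eigenvalue_ball {R} N lambda.

Definition itv_length (R : realType) (J : set R) : R := sup J - inf J.

(* C_0(closure A): functions are total and only their values on [closure A]
   matter. *)
Definition C0_space (R : realType) (N : nat) (A : set 'rV[R]_N)
    (z : 'rV[R]_N -> R) : Prop :=
  [/\ {within closure A, continuous z},
      z x @[x --> at_infinity (closure A)] --> (0 : R)
    & forall x, bdry A x -> z x = 0 ].

Definition omega_limit (R : realType) (N : nat) (A : set 'rV[R]_N)
    (u : 'rV[R]_N -> R -> R) : set ('rV[R]_N -> R) :=
  [set z | C0_space A z /\
     exists2 s : nat -> R, s n @[n --> \oo] --> +oo &
       forall x, A x -> u x (s n) @[n --> \oo] --> z x ].

(* Invariance under every orthogonal map that fixes p (hence the axis R p)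
   pointwise: z depends on |x| and x . p only, also when N = 2. *)
Definition axially_symmetric (R : realType) (N : nat) (A : set 'rV[R]_N)
    (p : 'rV[R]_N) (z : 'rV[R]_N -> R) : Prop :=
  forall Q : 'M[R]_N, Q *m Q^T = 1%:M -> p *m Q = p ->
    forall x, A x -> z (x *m Q) = z x.

Definition polar_angle (R : realType) (N : nat) (p x : 'rV[R]_N) : R :=
  acos (dot ((enorm x)^-1 *: x) p).

Definition foliated_schwarz_symmetric (R : realType) (N : nat)
    (A : set 'rV[R]_N) (p : 'rV[R]_N) (z : 'rV[R]_N -> R) : Prop :=
  [/\ {within A, continuous z},
      axially_symmetric A p z
    & forall x y, A x -> A y -> enorm x = enorm y ->
        polar_angle p x <= polar_angle p y -> z y <= z x ].

Definition continuous_in_tr (R : realType) (rad : R) (f : R -> R -> R -> R) :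
    Prop :=
  forall w : R,
    {within (`[0, +oo[ `*` `[rad, +oo[ : set (R * R)),
       continuous (fun y : R * R => f y.1 y.2 w)}.

Definition loc_unif_lipschitz (R : realType) (rad : R)
    (f : R -> R -> R -> R) : Prop :=
  forall (J : set R) (K : R), is_interval J -> bounded_set J ->
    J `<=` `[rad, +oo[ -> 0 < K ->
    exists2 C : R, 0 < C &
      forall r t v w : R, J r -> 0 < t -> v \in `[- K, K] -> w \in `[- K, K] ->
        `|f t r v - f t r w| <= C * `|v - w|.

(* The supremum of |f_u(t,r,s)| over those (t,r,s) at which f_u exists. *)
Definition sup_abs_fu (R : realType) (rad : R) (f : R -> R -> R -> R) :
    \bar R :=
  ereal_sup [set b : \bar R | exists t r s : R,
    [/\ 0 < t, rad <= r, derivable (f t r) s 1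
      & b = `|'D_1 (f t r) s|%:E ] ].

(* Main.v *)
From HB Require Import structures.
Require Import Defs.
From mathcomp Require Import all_boot all_order all_algebra.
From mathcomp Require Import all_classical all_reals all_analysis.
From mathcomp Require Import ring lra.
Set Implicit Arguments.
Unset Strict Implicit.
Unset Printing Implicit Defensive.
Import Order.TTheory GRing.Theory Num.Theory.
Import numFieldNormedType.Exports.
Local Open Scope classical_set_scope.
Local Open Scope ring_scope.

(** For a unit vector e put w_e = u - u o sigma_e on the half domain
    {x.e > 0}.  Since f is C0-Lipschitz in u (a locally Lipschitz function is
    absolutely continuous, so the bound on f_u integrates), w_e solves a linear
    equation w_t - Laplacian w + V w = c w with |c| <= C0 and vanishes on the
    boundary.  The gap in V allows a rate gam > 0 such that
    V > gam + C0 outside the ball of radius rho, while near a ball in the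
    annulus |x| in [a, b] (with [a, b] inside J) the principal eigenfunction
    gives a subsolution decaying slower than exp(- gam t).  Hence, if w_e is
    positive on a fixed ball at some time and its negative part is small
    enough there, positivity spreads to a large compact set and stays, while
    the negative part outside decays: the negative part of w_e tends to 0
    (stability).  All bounds come from the maximum principle with explicit
    barriers; no Harnack inequality is used.

    Let M be the closed set of e for which the negative part of w_e tends to 0
    uniformly.  By stability M is a neighbourhood of the initial direction e0,
    and of each of its points for which w_e does not tend to 0.  Rotating e0
    towards any orthogonal direction therefore leaves M only at an e with
    w_e -> 0, at the latest at - e0.  For the omega-limit functions this makes
    every reflection monotone in one of its two directions; the directions of
    exact symmetry then form the sphere of a subspace of codimension at most
    one, and its normal p is the axis. *)

(** * Euclidean geometry and reflections *)

Section Euclidean.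
Context {R : realType} {N : nat}.
Implicit Types x y z e : 'rV[R]_N.

(** The gap in V becomes two strict inequalities for one rate: [gam + C0 < V] beyond [rho], and
    [|V| + C0 + 4 lam / (b - a)^2 < gam] on [a, b]. Each spends one of the two C0, because the
    coefficient c is known only by its size; [4 lam / (b - a)^2] is the principal eigenvalue of a
    ball of diameter [b - a]. The negative part outside and the lower bound inside are then measured
    against the same exponential, so their ratio is frozen and smallness at a single time is enough
    for all later times. In place of a Harnack inequality, a moving-ball subsolution gives a lower
    bound up to an error proportional to the negative part; the same smallness absorbs it.
    Closedness of M needs w_e to depend on e uniformly in late times and up to the boundary. It
    comes from the family itself: points of equal norm are mirror images, so the difference of u at
    them is a value of some w_e near its own hyperplane. Regularity is given for coordinate
    derivatives only, whereas reflections mix coordinates; hence the equation is restated with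
    second differences. *)

Lemma dotC x y : dot x y = dot y x.
Proof. by apply: eq_bigr => i _; rewrite mulrC. Qed.

Lemma dotDl x y z : dot (x + y) z = dot x z + dot y z.
Proof.
by rewrite /dot -big_split; apply: eq_bigr => i _; rewrite mxE mulrDl.
Qed.

Lemma dotZl (a : R) x y : dot (a *: x) y = a * dot x y.
Proof. by rewrite /dot big_distrr; apply: eq_bigr => i _; rewrite mxE -mulrA. Qed.

Lemma dotNl x y : dot (- x) y = - dot x y.
Proof. by rewrite -scaleN1r dotZl mulN1r. Qed.

Lemma dotDr x y z : dot x (y + z) = dot x y + dot x z.
Proof. by rewrite dotC dotDl !(dotC _ x). Qed.

Lemma dotZr (a : R) x y : dot x (a *: y) = a * dot x y.
Proof. by rewrite dotC dotZl dotC. Qed.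

Lemma dotNr x y : dot x (- y) = - dot x y.
Proof. by rewrite dotC dotNl dotC. Qed.

Lemma dot0l y : dot 0 y = 0.
Proof. by rewrite /dot big1 // => i _; rewrite mxE mul0r. Qed.

Lemma dot0r y : dot y 0 = 0.
Proof. by rewrite dotC dot0l. Qed.

Definition dotE := (dotDl, dotDr, dotNl, dotNr, dotZl, dotZr, dot0l, dot0r).

Lemma dot_ge0 x : 0 <= dot x x.
Proof. by apply: sumr_ge0 => i _; rewrite -expr2 sqr_ge0. Qed.

Lemma dot_delta x i : dot x (delta_mx 0 i) = x 0 i.
Proof.
rewrite /dot (bigD1 i) //= mxE !eqxx mulr1 big1 ?addr0 // => j ji.
by rewrite mxE (negbTE ji) andbF mulr0.
Qed.

Lemma enorm_ge0 x : 0 <= enorm x.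
Proof. exact: sqrtr_ge0. Qed.

Lemma sqr_enorm x : enorm x ^+ 2 = dot x x.
Proof. by rewrite sqr_sqrtr // dot_ge0. Qed.

Lemma sqr_coord_le x i : x 0 i ^+ 2 <= dot x x.
Proof.
rewrite /dot (bigD1 i) //= -expr2 lerDl.
by apply: sumr_ge0 => j _; rewrite -expr2 sqr_ge0.
Qed.

Lemma coord_le_enorm x i : `|x 0 i| <= enorm x.
Proof. by rewrite -sqrtr_sqr ler_sqrt ?dot_ge0 // sqr_coord_le. Qed.

Lemma enorm_eq0 x : enorm x = 0 -> x = 0.
Proof.
move=> x0; apply/rowP => i; rewrite mxE; apply/eqP; rewrite -normr_le0 -x0.
exact: coord_le_enorm.
Qed.

Lemma dot_eq0 x : dot x x = 0 -> x = 0.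
Proof. by move=> x0; apply: enorm_eq0; rewrite /enorm x0 sqrtr0. Qed.

Lemma enorm0 : enorm (0 : 'rV[R]_N) = 0.
Proof. by rewrite /enorm dot0l sqrtr0. Qed.

Lemma enormZ (a : R) x : enorm (a *: x) = `|a| * enorm x.
Proof. by rewrite /enorm !dotE mulrA -expr2 sqrtrM ?sqr_ge0 // sqrtr_sqr. Qed.

Lemma enormN x : enorm (- x) = enorm x.
Proof. by rewrite -scaleN1r enormZ normrN1 mul1r. Qed.

Lemma enormB x y : enorm (x - y) = enorm (y - x).
Proof. by rewrite -enormN opprB. Qed.

Lemma cauchy_schwarz_sqr x y : dot x y ^+ 2 <= dot x x * dot y y.
Proof.
have [y0|ny] := eqVneq (dot y y) 0.
  by rewrite (dot_eq0 y0) !dotE expr0n /= mulr0.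
have yp : 0 < dot y y by rewrite lt_neqAle eq_sym ny dot_ge0.
have := dot_ge0 (dot y y *: x - dot x y *: y).
rewrite !dotE (dotC y x).
set a := dot x x; set b := dot y y in yp *; set c := dot x y => h.
have {h} : 0 <= b * (a * b - c ^+ 2) by move: h; congr (_ <= _); ring.
by rewrite pmulr_rge0 // subr_ge0.
Qed.

Lemma cauchy_schwarz x y : `|dot x y| <= enorm x * enorm y.
Proof.
rewrite -sqrtrM ?dot_ge0 // -sqrtr_sqr ler_sqrt ?cauchy_schwarz_sqr //.
by rewrite mulr_ge0 ?dot_ge0.
Qed.

Lemma dot_le x y : dot x y <= enorm x * enorm y.
Proof. exact: le_trans (ler_norm _) (cauchy_schwarz x y). Qed.

Lemma enorm_le x (a : R) : 0 <= a -> dot x x <= a ^+ 2 -> enorm x <= a.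
Proof. by move=> a0 h; rewrite -(ler_pXn2r (n := 2)) ?nnegrE ?enorm_ge0 ?sqr_enorm. Qed.

Lemma enormD x y : enorm (x + y) <= enorm x + enorm y.
Proof.
apply: enorm_le; first by rewrite addr_ge0 ?enorm_ge0.
rewrite sqrrD !sqr_enorm !dotE (dotC y x); have := dot_le x y; lra.
Qed.

Lemma enorm_dist x y : `|enorm x - enorm y| <= enorm (x - y).
Proof.
have h1 := enormD (x - y) y; have h2 := enormD (y - x) x.
rewrite !subrK in h1 h2; rewrite (enormB y x) in h2.
by rewrite ler_norml; apply/andP; split; lra.
Qed.

Lemma enormD3 z x y : enorm (x - y) <= enorm (x - z) + enorm (z - y).
Proof. by rewrite -[x - y](subrKA z) enormD. Qed.

Lemma eq_enorm x y : dot x x = dot y y -> enorm x = enorm y.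
Proof. by rewrite /enorm => ->. Qed.

Lemma norm_le_enorm x : `|x| <= enorm x.
Proof.
rewrite [`|x|]mx_normrE; apply/bigmax_leP; split; first exact: enorm_ge0.
by move=> [i j] _ /=; rewrite (ord1 i) coord_le_enorm.
Qed.

Lemma enorm_le_norm x : enorm x <= N%:R * `|x|.
Proof.
have hc i : `|x 0 i| <= `|x|.
  rewrite [X in _ <= X]mx_normrE.
  exact: (le_bigmax _ (fun i : 'I_1 * 'I_N => `|x i.1 i.2|) (ord0, i)).
apply: enorm_le; first by rewrite mulr_ge0.
have : dot x x <= \sum_(i < N) `|x| ^+ 2.
  apply: ler_sum => i _; rewrite -expr2 -[x 0 i ^+ 2]ger0_norm ?sqr_ge0 //.
  by rewrite normrX lerXn2r ?nnegrE ?hc.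
rewrite sumr_const card_ord -[_ *+ N]mulr_natl => /le_trans; apply.
rewrite exprMn; apply: ler_wpM2r; first exact: sqr_ge0.
rewrite -natrX ler_nat.
by case: (N) => // n; rewrite leq_pmulr.
Qed.

(** The sup norm and the Euclidean norm bound each other up to a factor depending on [N], so
    neighbourhoods may be described by Euclidean balls, which orthogonal maps preserve. *)
Lemma nbhs_enormP x (P : set 'rV[R]_N) :
  nbhs x P <-> exists2 d : R, 0 < d & forall y, enorm (y - x) < d -> P y.
Proof.
split.
  move=> /nbhs_ballP [d /= d0 h]; exists d => // y yx; apply: h.
  rewrite -ball_normE /ball_ /= distrC.
  exact: le_lt_trans (norm_le_enorm _) yx.
(* [N.+1] instead of [N] keeps the radius positive when [N = 0]. *)
move=> [d d0 h]; apply/nbhs_ballP; exists (d / N.+1%:R) => /=.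
  by rewrite divr_gt0.
move=> y; rewrite -ball_normE /ball_ /= distrC => yx; apply: h.
apply: le_lt_trans (enorm_le_norm _) _.
apply: (@le_lt_trans _ _ (N.+1%:R * `|y - x|)); first by rewrite ler_wpM2r // ler_nat.
by rewrite mulrC -ltr_pdivlMr.
Qed.

Lemma continuous_dotl e : continuous (fun x => dot x e).
Proof.
move=> x; have FF := nbhs_filter x.
apply/cvgrPdist_lt => eps eps0; apply/nbhs_enormP.
have h0 : 0 < enorm e + 1 by rewrite ltr_wpDl ?enorm_ge0.
exists (eps / (enorm e + 1)); first by rewrite divr_gt0.
move=> y yx; rewrite -dotNl -dotDl; apply: le_lt_trans (cauchy_schwarz _ _) _.
rewrite enormB; move: yx; rewrite ltr_pdivlMr // => /(le_lt_trans _); apply.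
by rewrite ler_wpM2l ?enorm_ge0 // lerDl.
Qed.

Lemma continuous_enorm : continuous (@enorm R N).
Proof.
move=> x; have FF := nbhs_filter x.
apply/cvgrPdist_lt => eps eps0; apply/nbhs_enormP.
by exists eps => // y yx; apply: le_lt_trans (enorm_dist _ _) _; rewrite enormB.
Qed.

Lemma continuous_sqr_enorm : continuous (fun x => dot x x).
Proof.
have -> : (fun x => dot x x) = (fun x => enorm x * enorm x).
  by apply/funext => x; rewrite -expr2 sqr_enorm.
by move=> x; apply: continuousM; exact: continuous_enorm.
Qed.

Lemma ebounded_closed_compact (A : set 'rV[R]_N) (M : R) :
  (forall x, A x -> enorm x <= M) -> closed A -> compact A.
Proof.
move=> hA; apply: bounded_closed_compact.
exists M; split; first exact: num_real.
move=> m mM x /hA xM /=; apply: le_trans (norm_le_enorm x) _.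
exact: le_trans xM (ltW mM).
Qed.

Lemma refl_dot e x : dot e e = 1 -> dot (refl_hyp e x) e = - dot x e.
Proof. by move=> e1; rewrite /refl_hyp !dotE e1; ring. Qed.

Lemma refl_hypK e : dot e e = 1 -> involutive (refl_hyp e).
Proof.
move=> e1 x; rewrite {1}/refl_hyp refl_dot // /refl_hyp.
by rewrite mulrN scaleNr opprK subrK.
Qed.

Lemma dot_refl e x y : dot e e = 1 ->
  dot (refl_hyp e x) (refl_hyp e y) = dot x y.
Proof. by move=> e1; rewrite /refl_hyp !dotE e1 (dotC e y); ring. Qed.

Lemma enorm_refl e x : dot e e = 1 -> enorm (refl_hyp e x) = enorm x.
Proof. by move=> e1; rewrite /enorm dot_refl. Qed.

Lemma refl_hypN e x : refl_hyp (- e) x = refl_hyp e x.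
Proof. by rewrite /refl_hyp dotNr mulrN scaleNr scalerN opprK. Qed.

Lemma refl_hypD e x y : refl_hyp e (x + y) = refl_hyp e x + refl_hyp e y.
Proof. by rewrite /refl_hyp dotDl mulrDr scalerDl opprD addrACA. Qed.

Lemma refl_hypZ e (a : R) x : refl_hyp e (a *: x) = a *: refl_hyp e x.
Proof. by rewrite /refl_hyp dotZl mulrCA scalerBr !scalerA. Qed.

Lemma refl_hyp_dist e x y : dot e e = 1 ->
  enorm (refl_hyp e x - refl_hyp e y) = enorm (x - y).
Proof.
move=> e1; rewrite -(enorm_refl (x - y) e1) -[in RHS]scaleN1r refl_hypD.
by rewrite refl_hypZ scaleN1r.
Qed.

Lemma refl_hyp_id e x : dot x e = 0 -> refl_hyp e x = x.
Proof. by move=> h; rewrite /refl_hyp h mulr0 scale0r subr0. Qed.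

(** Acts on row vectors from the right. For unit [e] it is symmetric and its own inverse, hence
    orthogonal, as [heat_comp] requires. *)
Definition refl_mx e : 'M[R]_N := 1%:M - 2 *: (e^T *m e).

Lemma refl_mxE e x : x *m refl_mx e = refl_hyp e x.
Proof.
rewrite /refl_mx mulmxBr mulmx1 -scalemxAr mulmxA.
have -> : x *m e^T = (dot x e)%:M.
  by apply/rowP => i; rewrite (ord1 i) !mxE mulr1n; apply: eq_bigr => j _; rewrite mxE.
by rewrite mul_scalar_mx scalerA.
Qed.

Lemma refl_mx_sym e : (refl_mx e)^T = refl_mx e.
Proof.
by rewrite /refl_mx linearB /= trmx1 linearZ /= trmx_mul trmxK.
Qed.

Lemma refl_mx_orth e : dot e e = 1 -> refl_mx e *m refl_mx e = 1%:M.
Proof.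
move=> e1; apply/row_matrixP => i.
by rewrite row_mul !rowE !refl_mxE refl_hypK // mulmx1.
Qed.

End Euclidean.

(** * The heat operator of C^{2,1} functions *)

Section Calculus.
Context {R : realType}.

(** The directional derivative with the quotient multiplied out: [s = 0] needs no exception, and
    such estimates combine by linear arithmetic. *)
Definition eps_derive {W : normedModType R} (f : W -> R) (x v : W) (d : R) :=
  forall eps : R, 0 < eps -> exists2 del : R, 0 < del &
    forall s : R, `|s| < del -> `|f (x + s *: v) - f x - s * d| <= eps * `|s|.

Let scE (a b : R) : a *: b = a * b. Proof. by []. Qed.

Lemma eps_deriveP {W : normedModType R} (f : W -> R) (x v : W) (d : R) :
  is_derive x v f d <-> eps_derive f x v d.
Proof.
split.
  move=> [df dfE] eps eps0.
  have : (fun h => h^-1 *: ((f \o shift x) (h *: v) - f x)) @ 0^' --> d.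
    by rewrite -dfE; exact: df.
  move=> /cvgrPdist_le /(_ eps eps0); rewrite near_withinE.
  move=> /nbhs_ballP [del /= del0 h]; exists del => // s sd.
  have [->|s0] := eqVneq s 0.
    by rewrite scale0r addr0 subrr mul0r subr0 normr0 mulr0.
  have := h s; rewrite /ball /= sub0r normrN => /(_ sd s0) h1.
  have -> : f (x + s *: v) - f x - s * d =
      - (s * (d - s^-1 *: (f (s *: v + x) - f x))).
    rewrite mulrBr scE mulrA divff // mul1r opprB.
    by rewrite (addrC (s *: v)).
  by rewrite normrN normrM mulrC ler_wpM2r.
move=> h.
have hc : (fun h => h^-1 *: ((f \o shift x) (h *: v) - f x)) @ 0^' --> d.
  apply/cvgrPdist_le => eps eps0; rewrite near_withinE.
  have [del del0 hd] := h eps eps0.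
  apply/nbhs_ballP; exists del => //= s; rewrite /ball /= sub0r normrN => sd s0.
  have := hd s sd.
  have -> : f (x + s *: v) - f x - s * d =
      - (s * (d - s^-1 *: (f (s *: v + x) - f x))).
    rewrite mulrBr scE mulrA divff // mul1r opprB.
    by rewrite (addrC (s *: v)).
  by rewrite normrN normrM mulrC ler_pM2r // normr_gt0.
apply: DeriveDef; first by apply/cvg_ex; exists d.
exact: cvg_lim hc.
Qed.

Lemma eps_deriveZ {W : normedModType R} (f : W -> R) (x v : W) (a d : R) :
  eps_derive f x v d -> eps_derive f x (a *: v) (a * d).
Proof.
move=> h eps eps0; have a0 : 0 < `|a| + 1 by rewrite ltr_wpDl.
have [del del0 hd] := h (eps / (`|a| + 1)) (divr_gt0 eps0 a0).
exists (del / (`|a| + 1)); first exact: divr_gt0.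
move=> s; rewrite ltr_pdivlMr // => sd.
have sa : `|s * a| < del.
  rewrite normrM; apply: le_lt_trans sd; rewrite ler_wpM2l // lerDl //.
have := hd _ sa; rewrite scalerA mulrA => /le_trans; apply.
have -> : eps / (`|a| + 1) * `|s * a| = eps * `|s| * (`|a| / (`|a| + 1)).
  by rewrite normrM; ring.
rewrite ler_piMr ?mulr_ge0 ?(ltW eps0) // ler_pdivrMr // mul1r lerDl //.
Qed.

Lemma eps_derive_line {W : normedModType R} (f : W -> R) (x v : W) (s0 d : R) :
  eps_derive f (x + s0 *: v) v d ->
  eps_derive (fun s : R => f (x + s *: v)) s0 (1 : R) d.
Proof.
move=> h eps eps0; have [del del0 hd] := h eps eps0; exists del => // s sd.
by rewrite [s *: 1]mulr1 scalerDl addrA; exact: hd.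
Qed.

Lemma mean_value_ineq (f df : R -> R) (h M : R) : 0 <= h ->
  (forall s, 0 <= s <= h -> eps_derive f s (1 : R) (df s)) ->
  (forall s, 0 <= s <= h -> `|df s| <= M) ->
  `|f h - f 0| <= M * h.
Proof.
move=> h0 hf hM.
have hd s : s \in `[0, h] -> is_derive s 1 f (df s).
  by rewrite in_itv /= => sh; apply/eps_deriveP; exact: hf.
have hd' s : s \in `]0, h[%R -> is_derive s 1 f (df s).
  by move=> sh; apply: hd; move: sh; rewrite !in_itv /= => /andP[/ltW-> /ltW->].
have hc : {within `[0, h], continuous f}.
  by apply: derivable_within_continuous => s /hd [].
have [c ch ->] := MVT_segment h0 hd' hc.
rewrite subr0 normrM (ger0_norm h0) ler_wpM2r // hM //.
Qed.

Context {N : nat}.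
Implicit Types (x y z : 'rV[R]_N) (phi : 'rV[R]_N -> R).

Definition trunc (k : nat) (h : 'rV[R]_N) : 'rV[R]_N :=
  \row_j (if (j < k)%N then h 0 j else 0).

Lemma truncS (k : 'I_N) h :
  trunc k.+1 h = trunc k h + h 0 k *: delta_mx 0 k.
Proof.
apply/rowP => j; rewrite !mxE eqxx /= ltnS leq_eqVlt.
have [/val_inj ->|jk] := eqVneq (j : nat) k; first by rewrite ltnn eqxx add0r mulr1.
by rewrite -val_eqE /= (negbTE jk) /= mulr0 addr0.
Qed.

(* Continuous partial derivatives give Frechet differentiability: telescope
   over the coordinates and apply the mean value inequality on each edge. *)
Lemma C1_frechet (A : set 'rV[R]_N) phi x :
  open A -> A x ->
  (forall i z, A z -> has_partial i phi z) ->
  (forall i, {within A, continuous (partial i phi)}) ->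
  forall eps : R, 0 < eps -> exists2 del : R, 0 < del &
    forall h, enorm h < del ->
      `|phi (x + h) - phi x - \sum_i h 0 i * partial i phi x| <= eps * enorm h.
Proof.
move=> oA Ax hp hc eps eps0.
have eN0 : 0 < eps / N.+1%:R by rewrite divr_gt0.
have [dA dA0 hA] : exists2 d : R, 0 < d & forall y, enorm (y - x) < d -> A y.
  by apply/nbhs_enormP; exact: open_nbhs_nbhs.
have hci (i : 'I_N) : exists2 d : R, 0 < d & forall y, enorm (y - x) < d ->
    `|partial i phi y - partial i phi x| <= eps / N.+1%:R.
  have := hc i; rewrite continuous_open_subspace // => /(_ x).
  rewrite inE => /(_ Ax) /cvgrPdist_le /(_ _ eN0) /nbhs_enormP [d d0 hd].
  by exists d => // y /hd; rewrite distrC.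
have [d d0 hd] : exists2 d : R, 0 < d & forall i y, enorm (y - x) < d ->
    `|partial i phi y - partial i phi x| <= eps / N.+1%:R.
  pose f i := sval (cid2 (hci i)).
  have f0 i : 0 < f i by rewrite /f; case: cid2.
  exists (\big[Num.min/1]_i f i).
    by elim/big_ind: _ => // a b a0 b0; rewrite lt_min a0 b0.
  move=> i y yx; have : enorm (y - x) < f i.
    by apply: lt_le_trans yx _; rewrite (bigD1 i) //= ge_min lexx.
  by rewrite /f; case: cid2 => ? ? /= h ?; apply: h.
exists (Num.min d dA); first by rewrite lt_min d0.
move=> h; rewrite lt_min => /andP[hd1 hA1].
have key k : (k <= N)%N ->
   `|phi (x + trunc k h) - phi x
     - \sum_(i < N | (i < k)%N) h 0 i * partial i phi x|
   <= k%:R * (eps / N.+1%:R * enorm h).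
  elim: k => [_|k IH kN].
    have -> : trunc 0 h = 0 by apply/rowP => j; rewrite !mxE.
    by rewrite addr0 subrr big_pred0 // subr0 normr0 mul0r.
  pose K := Ordinal kN.
  rewrite (bigD1 K) //=.
  have -> : \sum_(i < N | (i < k.+1)%N && (i != K)) h 0 i * partial i phi x =
            \sum_(i < N | (i < k)%N) h 0 i * partial i phi x.
    apply: eq_bigl => i; rewrite ltnS -val_eqE /= andbC.
    by rewrite ltn_neqAle.
  have := IH (ltnW kN).
  have -> : trunc k.+1 h = trunc K h + h 0 K *: delta_mx 0 K by rewrite -truncS.
  set y := trunc k h; set e := delta_mx 0 K; set a := h 0 K.
  (* On this edge the first [k] coordinates are those of [h], the next one is a fraction of its own,
     the others vanish: the edge stays in the ball of radius [enorm h]. *)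
  have hin s : 0 <= s <= 1 -> enorm (y + s *: (a *: e)) <= enorm h.
    move=> /andP[s0 s1]; apply: enorm_le; first exact: enorm_ge0.
    rewrite sqr_enorm; apply: ler_sum => i _; rewrite !mxE eqxx /=.
    case: ltnP => ik.
      have -> : (i == K) = false by apply/eqP => ie; rewrite ie ltnn in ik.
      by rewrite mulr0 mulr0 addr0.
    case: (eqVneq i K) => [->|_]; last by rewrite !mulr0 addr0 mulr0 -expr2 sqr_ge0.
    rewrite add0r mulr1 -/a mulrACA ler_piMl //.
      by rewrite -expr2 sqr_ge0.
    by rewrite mulr_ile1.
  have hmv : `|phi (x + (y + a *: e)) - phi (x + y) - a * partial K phi x|
     <= eps / N.+1%:R * enorm h.
    (* Subtracting the linear term leaves a derivative equal to the oscillation of [partial K phi],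
       which is small by continuity. *)
    pose F s := phi (x + y + s *: (a *: e)) - s * (a * partial K phi x).
    have := @mean_value_ineq F
      (fun s => a * (partial K phi (x + y + s *: (a *: e)) - partial K phi x))
      1 (eps / N.+1%:R * enorm h) ler01.
    have -> : F 1 - F 0 = phi (x + (y + a *: e)) - phi (x + y) - a * partial K phi x.
      by rewrite /F scale0r addr0 mul0r subr0 scale1r mul1r [x + (y + _)]addrA; ring.
    rewrite mulr1; apply.
      move=> s s01; rewrite mulrBr => r r0.
      have As : A (x + y + s *: (a *: e)).
        apply: hA; rewrite -[x + y + _]addrA [x + _]addrC addrK.
        exact: le_lt_trans (hin s s01) hA1.
      have /eps_deriveZ-/(_ a) : eps_derive phi (x + y + s *: (a *: e)) e
          (partial K phi (x + y + s *: (a *: e))).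
        by apply/eps_deriveP; apply/derivableP; exact: hp.
      move=> /eps_derive_line /(_ r r0) [del del0 hdel]; exists del => // t td.
      have := hdel t td; rewrite /F; congr (`| _ | <= _).
      by rewrite [t *: 1]mulr1; ring.
    move=> s s01; rewrite normrM mulrC; apply: ler_pM => //.
      apply: hd; rewrite -[x + y + _]addrA [x + _]addrC addrK.
      exact: le_lt_trans (hin s s01) hd1.
    exact: coord_le_enorm.
  move=> h1; rewrite -natr1 mulrDl mul1r.
  apply: le_trans (lerD h1 hmv); apply: le_trans (ler_normD _ _).
  by rewrite le_eqVlt; apply/orP; left; apply/eqP; congr `| _ |; ring.
have := key N (leqnn N).
have -> : trunc N h = h by apply/rowP => j; rewrite !mxE ltn_ord.
rewrite (eq_bigl xpredT) => [|i]; last by rewrite ltn_ord.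
move=> /le_trans; apply; rewrite mulrA ler_wpM2r ?enorm_ge0 //.
rewrite mulrCA ger_pMr // ler_pdivrMr // mul1r ler_nat; exact: leqnSn.
Qed.

Lemma C1_eps_derive (A : set 'rV[R]_N) phi x y :
  open A -> A x ->
  (forall i z, A z -> has_partial i phi z) ->
  (forall i, {within A, continuous (partial i phi)}) ->
  eps_derive phi x y (\sum_i y 0 i * partial i phi x).
Proof.
move=> oA Ax hp hc eps eps0.
have y0 : 0 < enorm y + 1 by rewrite ltr_wpDl ?enorm_ge0.
have [d d0 hd] := C1_frechet oA Ax hp hc (divr_gt0 eps0 y0).
exists (d / (enorm y + 1)); first exact: divr_gt0.
move=> s; rewrite ltr_pdivlMr // => sd.
have sy : enorm (s *: y) < d.
  by rewrite enormZ; apply: le_lt_trans sd; rewrite ler_wpM2l // lerDl.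
have -> : s * \sum_i y 0 i * partial i phi x =
    \sum_i (s *: y) 0 i * partial i phi x.
  by rewrite big_distrr; apply: eq_bigr => i _; rewrite mxE -mulrA.
apply: le_trans (hd _ sy) _; rewrite enormZ -mulrA ler_wpM2l ?(ltW eps0) //.
rewrite mulrCA ler_piMr // mulrC ler_pdivrMr // mul1r lerDl //.
Qed.

Definition sdiff phi x y (s : R) := phi (x + s *: y) + phi (x - s *: y) - 2 * phi x.

(** A left derivative: at a first contact only earlier times carry information. *)
Definition tdiff (g : R -> R) (t a : R) :=
  forall eps : R, 0 < eps -> exists2 del : R, 0 < del &
    forall s, 0 < s < del -> `|g (t - s) - g t + a * s| <= eps * s.

(** Symmetric differences cancel the first-order term; what remains determines the quadratic form of
    [H], and with it the trace that [heat] reads. *)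
Definition hess phi x (H : 'M[R]_N) :=
  forall y (eps : R), 0 < eps -> exists2 del : R, 0 < del &
    forall s, 0 < s < del ->
      `|sdiff phi x y s - s ^+ 2 * (y *m H *m y^T) 0 0| <= eps * s ^+ 2.

(* v_t - Laplacian v = k at (x,t), with a left derivative in time and
   symmetric second difference quotients in space; unlike the partial
   derivatives, this notion is manifestly invariant under isometries. *)
Definition heat (v : 'rV[R]_N -> R -> R) x t k :=
  exists a H, [/\ tdiff (v x) t a, hess (v^~ t) x H & k = a - \tr H].

Lemma eps_derive_tdiff (g : R -> R) t a : eps_derive g t (1 : R) a -> tdiff g t a.
Proof.
move=> h eps eps0; have [d d0 hd] := h eps eps0; exists d => // s /andP[s0 sd].
have := hd (- s); rewrite normrN gtr0_norm // => /(_ sd).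
by rewrite scaleNr [s *: 1]mulr1 mulNr opprK (mulrC a).
Qed.

(** Along the line through [x] the error [sdiff - s^2 q] vanishes at [s = 0], and its derivative at
    [r] is [d1 r - d1 (- r) - 2 q r]. This is at most [eps * r] because [d1] has derivative [q] at
    [0]; the mean value inequality finishes. *)
Lemma C2_hess (A : set 'rV[R]_N) phi x :
  open A -> A x -> C2_on A phi ->
  hess phi x (\matrix_(i, j) partial j (partial i phi) x).
Proof.
move=> oA Ax [cphi h1 h2] y eps eps0.
set q := (_ *m _ *m _) 0 0.
have qE : q = \sum_i y 0 i * \sum_j y 0 j * partial j (partial i phi) x.
  rewrite /q mxE; under eq_bigr => j _ do rewrite !mxE big_distrl.
  rewrite exchange_big; apply: eq_bigr => i _; rewrite big_distrr.
  by apply: eq_bigr => j _; rewrite !mxE /= -!mulrA [_ * y 0 j]mulrC.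
have [dA dA0 hA] : exists2 d : R, 0 < d & forall y, enorm (y - x) < d -> A y.
  by apply/nbhs_enormP; exact: open_nbhs_nbhs.
have y0 : 0 < enorm y + 1 by rewrite ltr_wpDl ?enorm_ge0.
have hAs s : `|s| < dA / (enorm y + 1) -> A (x + s *: y).
  rewrite ltr_pdivlMr // => sd; apply: hA; rewrite [x + _]addrC addrK enormZ.
  by apply: le_lt_trans sd; rewrite ler_wpM2l // lerDl.
pose d1 s := \sum_i y 0 i * partial i phi (x + s *: y).
have hd1 (r : R) : `|r| < dA / (enorm y + 1) ->
    eps_derive (fun s : R => phi (x + s *: y)) r (1 : R) (d1 r).
  move=> /hAs As; apply: eps_derive_line; apply: (C1_eps_derive _ oA As).
    by move=> i; exact: (h1 i).1.
  by move=> i; exact: (h1 i).2.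
have hd2 : eps_derive d1 0 (1 : R) q.
  have hi i : is_derive (0 : R) (1 : R)
      (fun s => y 0 i * partial i phi (x + s *: y))
      (y 0 i * \sum_j y 0 j * partial j (partial i phi) x).
    apply: is_deriveZ; apply/eps_deriveP; apply: eps_derive_line.
    rewrite scale0r addr0; apply: (C1_eps_derive _ oA Ax).
      by move=> j; exact: (h2 i j).1.
    by move=> j; exact: (h2 i j).2.
  apply/eps_deriveP; rewrite qE.
  have -> : d1 = \sum_i (fun s => y 0 i * partial i phi (x + s *: y)).
    by apply/funext => s; rewrite /d1 fct_sumE.
  exact: is_derive_sum.
have e2 : 0 < eps / 2 by rewrite divr_gt0.
have [d d0 hd] := hd2 _ e2.
exists (Num.min d (dA / (enorm y + 1))).
  by rewrite lt_min d0 divr_gt0.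
move=> s /andP[s0]; rewrite lt_min => /andP[sd sA].
pose F r := phi (x + r *: y) + phi (x + (- r) *: y) - q * r ^+ 2.
have -> : sdiff phi x y s - s ^+ 2 * q = F s - F 0.
  by rewrite /sdiff /F oppr0 scale0r addr0 scaleNr expr0n /= mulr0; ring.
rewrite expr2 mulrA.
apply: (@mean_value_ineq F (fun r => d1 r - d1 (- r) - 2 * q * r)) => [|r /andP[r0 rs]|r /andP[r0 rs]].
- exact: ltW.
- have rA : `|r| < dA / (enorm y + 1) by rewrite ger0_norm //; exact: le_lt_trans sA.
  apply/eps_deriveP.
  have i1 : is_derive r 1 (fun r => phi (x + r *: y)) (d1 r).
    by apply/eps_deriveP; exact: hd1.
  have i2 : is_derive r 1 (fun r => phi (x + (- r) *: y)) (- d1 (- r)).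
    apply/eps_deriveP => e e0.
    have := hd1 (- r); rewrite normrN => /(_ rA e e0) [del del0 hdel].
    exists del => // t td; have := hdel (- t); rewrite normrN => /(_ td).
    by rewrite scaleNr [t *: 1]mulr1 -opprD mulrN mulNr.
  have i3 : is_derive r 1 (fun r : R => q * r ^+ 2) (q * (2 * r)).
    apply/eps_deriveP => e e0; have q0 : 0 < `|q| + 1 by rewrite ltr_wpDl.
    exists (e / (`|q| + 1)); first exact: divr_gt0.
    move=> t; rewrite ltr_pdivlMr // => td.
    rewrite [t *: 1]mulr1 (_ : _ - _ - _ = q * t * t); last by ring.
    rewrite !normrM ler_wpM2r //; apply: le_trans (ltW td).
    by rewrite mulrC ler_wpM2l // lerDl.
  rewrite (_ : _ - _ - _ = d1 r + - d1 (- r) - q * (2 * r)); last by ring.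
  by apply: is_deriveB.
- have b1 := hd r; have b2 := hd (- r).
  rewrite !add0r [r *: 1]mulr1 [(- r) *: 1]mulr1 normrN ger0_norm // in b1 b2.
  have rd : r < d by exact: le_lt_trans sd.
  have := lerD (b1 rd) (b2 rd).
  have -> : eps / 2 * r + eps / 2 * r = eps * r by field.
  rewrite -[`|d1 (- r) - _ - _|]normrN => hh.
  apply: (@le_trans _ _ (eps * r)); last by rewrite ler_wpM2l // ltW.
  apply: le_trans hh; apply: le_trans (ler_normD _ _).
  by rewrite le_eqVlt; apply/orP; left; apply/eqP; congr `| _ |; ring.
Qed.

Lemma hess_sub phi1 phi2 x H1 H2 : hess phi1 x H1 -> hess phi2 x H2 ->
  hess (fun z => phi1 z - phi2 z) x (H1 - H2).
Proof.
move=> h1 h2 y eps eps0; have e2 : 0 < eps / 2 by rewrite divr_gt0.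
have [d1 d10 hd1] := h1 y _ e2; have [d2 d20 hd2] := h2 y _ e2.
exists (Num.min d1 d2); first by rewrite lt_min d10.
move=> s /andP[s0]; rewrite lt_min => /andP[s1 s2].
have b1 := hd1 s; have b2 := hd2 s; rewrite s0 s1 in b1; rewrite s0 s2 in b2.
have := lerD (b1 isT) (b2 isT).
have -> : eps / 2 * s ^+ 2 + eps / 2 * s ^+ 2 = eps * s ^+ 2 by field.
apply: le_trans; rewrite -[`|sdiff phi2 _ _ _ - _|]normrN.
apply: le_trans (ler_normD _ _).
rewrite mulmxBr mulmxBl !mxE /sdiff le_eqVlt; apply/orP; left; apply/eqP.
by congr `| _ |; ring.
Qed.

Lemma hess_scale phi x H (c : R) : hess phi x H ->
  hess (fun z => c * phi z) x (c *: H).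
Proof.
move=> h y eps eps0; have c0 : 0 < `|c| + 1 by rewrite ltr_wpDl.
have [d d0 hd] := h y _ (divr_gt0 eps0 c0).
exists d => // s sd; have := hd s sd.
have -> : (y *m (c *: H) *m y^T) 0 0 = c * (y *m H *m y^T) 0 0.
  by rewrite -scalemxAr -scalemxAl [LHS]mxE.
have -> : sdiff (fun z => c * phi z) x y s - s ^+ 2 * (c * (y *m H *m y^T) 0 0)
   = c * (sdiff phi x y s - s ^+ 2 * (y *m H *m y^T) 0 0).
  by rewrite /sdiff; ring.
move=> b; rewrite normrM.
apply: (@le_trans _ _ ((`|c| + 1) * (eps / (`|c| + 1) * s ^+ 2))).
  by apply: ler_pM => //; rewrite lerDl.
by rewrite mulrA [_ * (eps / _)]mulrC divfK // gt_eqF.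
Qed.

Lemma hess_comp phi (T : 'rV[R]_N -> 'rV[R]_N) (Q : 'M[R]_N) x H :
  (forall z y, T (z + y) = T z + y *m Q) -> hess phi (T x) H ->
  hess (phi \o T) x (Q *m H *m Q^T).
Proof.
move=> hT h y eps eps0; have [d d0 hd] := h (y *m Q) eps eps0.
exists d => // s sd; have := hd s sd.
by rewrite /sdiff /= !hT -scalemxAl mulNmx -scalemxAl trmx_mul !mulmxA.
Qed.

Lemma tdiff_sub g1 g2 t a1 a2 : tdiff g1 t a1 -> tdiff g2 t a2 ->
  tdiff (fun s => g1 s - g2 s) t (a1 - a2).
Proof.
move=> h1 h2 eps eps0; have e2 : 0 < eps / 2 by rewrite divr_gt0.
have [d1 d10 hd1] := h1 _ e2; have [d2 d20 hd2] := h2 _ e2.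
exists (Num.min d1 d2); first by rewrite lt_min d10.
move=> s /andP[s0]; rewrite lt_min => /andP[s1 s2].
have b1 := hd1 s; have b2 := hd2 s; rewrite s0 s1 in b1; rewrite s0 s2 in b2.
have := lerD (b1 isT) (b2 isT).
have -> : eps / 2 * s + eps / 2 * s = eps * s by field.
apply: le_trans; rewrite -[`|g2 _ - _ + _|]normrN.
apply: le_trans (ler_normD _ _).
rewrite le_eqVlt; apply/orP; left; apply/eqP.
by congr `| _ |; ring.
Qed.

Lemma heat_sub v1 v2 x t k1 k2 : heat v1 x t k1 -> heat v2 x t k2 ->
  heat (fun z s => v1 z s - v2 z s) x t (k1 - k2).
Proof.
move=> [a1 [H1 [t1 h1 ->]]] [a2 [H2 [t2 h2 ->]]].
exists (a1 - a2), (H1 - H2); split; [exact: tdiff_sub|exact: hess_sub|].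
by rewrite raddfB /=; ring.
Qed.

(** Conjugation by an orthogonal [Q] preserves the trace of the second-order part, and the
    translation part of [T] drops out of differences. *)
Lemma heat_comp v (T : 'rV[R]_N -> 'rV[R]_N) (Q : 'M[R]_N) x t k :
  (forall z y, T (z + y) = T z + y *m Q) -> Q *m Q^T = 1%:M ->
  heat v (T x) t k -> heat (fun z s => v (T z) s) x t k.
Proof.
move=> hT QQ [a [H [ha hH ->]]]; exists a, (Q *m H *m Q^T); split => //.
  exact: (hess_comp hT hH).
by rewrite -mulmxA mxtrace_mulC -mulmxA (mulmx1C QQ) mulmx1.
Qed.

Lemma C21_heat (A : set 'rV[R]_N) u x t : open A -> C21_on A u -> A x -> 0 < t ->
  heat u x t ('D_1 (u x) t - laplacian (u^~ t) x).
Proof.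
move=> oA [cu ut ux uxx] Ax t0.
have slice (g : 'rV[R]_N * R -> R) :
    {within A `*` `]0, +oo[, continuous g} ->
    {within A, continuous (fun z => g (z, t))}.
  have oQ : open (A `*` `]0, +oo[%classic : set ('rV[R]_N * R)).
    rewrite (_ : _ `*` _ = fst @^-1` A `&` snd @^-1` `]0, +oo[%classic) //.
    by apply: openI; apply: open_comp => // y _; [exact: cvg_fst|exact: cvg_snd].
  rewrite !continuous_open_subspace // => hg z zA.
  have gz : {for (z, t), continuous g}.
    by apply: hg; rewrite inE; split; [rewrite inE in zA|rewrite /= in_itv /= t0].
  apply: (@continuous_comp _ _ _ (fun z => (z, t)) g) => //.
  move=> B [[P P'] /= [hP hP'] PB]; have FF := nbhs_filter z.
  by apply: filterS hP => y Py; apply: PB; split => //=; exact: nbhs_singleton.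
exists ('D_1 (u x) t), (\matrix_(i, j) partial j (partial i (u^~ t)) x); split.
- by apply: eps_derive_tdiff; apply/eps_deriveP; exact: DeriveDef (ut.1 x t Ax t0) _.
- apply: (C2_hess oA Ax); split.
  + exact: (slice _ cu).
  + move=> i; split; first by move=> z Az; exact: (ux i).1.
    exact: (slice _ (ux i).2).
  + move=> i j; split; first by move=> z Az; exact: (uxx i j).1.
    exact: (slice _ (uxx i j).2).
- by congr (_ - _); apply: eq_bigr => i _; rewrite mxE.
Qed.

(** One-sided, because the barriers contain truncated parabolas and squared positive parts, which
    need not be twice differentiable; contact from below asks for nothing more. *)
Definition sec_lower phi x y (c : R) :=
  forall eps : R, 0 < eps -> exists2 del : R, 0 < del &
    forall s, 0 < s < del -> (c - eps) * s ^+ 2 <= sdiff phi x y s.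

(** Contact from below after staying above: [v (t - s) - v t >= F (t - s) - F t] forces the left
    derivative of [v] to be at most [b], while the second differences force each diagonal entry of
    [H] to be at least [c i]. *)
Lemma heat_touch v x t k (F : R -> R) b (c : 'I_N -> R) :
  heat v x t k -> tdiff F t b ->
  (exists2 del : R, 0 < del & forall s, 0 < s < del -> F (t - s) <= v x (t - s)) ->
  v x t = F t ->
  (forall i, sec_lower (v^~ t) x (delta_mx 0 i) (c i)) ->
  k <= b - \sum_i c i.
Proof.
move=> [a [H [ha hH ->]]] hF [d d0 hd] vF hc.
apply: lerB.
  rewrite leNgt; apply/negP => ba; pose e := (a - b) / 4.
  have e0 : 0 < e by rewrite divr_gt0 // subr_gt0.
  have [d1 d10 h1] := ha _ e0; have [d2 d20 h2] := hF _ e0.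
  pose s := Num.min d (Num.min d1 d2) / 2.
  have m0 : 0 < Num.min d (Num.min d1 d2) by rewrite !lt_min d0 d10.
  have s0 : 0 < s by rewrite divr_gt0.
  have : s < Num.min d (Num.min d1 d2) by rewrite /s; lra.
  rewrite !lt_min => /and3P[sd sd1 sd2].
  have := hd s; rewrite s0 sd => /(_ isT).
  have := h1 s; rewrite s0 sd1 => /(_ isT); rewrite ler_norml => /andP[_].
  have := h2 s; rewrite s0 sd2 => /(_ isT); rewrite ler_norml => /andP[+ _].
  rewrite vF.
  have : 0 < (a - b) * s by rewrite mulr_gt0 // subr_gt0.
  have : e * s = (a - b) * s / 4 by rewrite /e; field.
  lra.
apply: ler_sum => i _; set p := H i i.
rewrite leNgt; apply/negP => ba; pose e := (c i - p) / 4.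
have e0 : 0 < e by rewrite divr_gt0 // subr_gt0.
have [d1 d10 h1] := hH (delta_mx 0 i) _ e0; have [d2 d20 h2] := hc i _ e0.
have pE : ((delta_mx 0 i : 'rV[R]_N) *m H *m (delta_mx 0 i : 'rV[R]_N)^T) 0 0 = p.
  by rewrite trmx_delta -rowE -colE !mxE.
rewrite pE in h1.
pose s := Num.min d1 d2 / 2.
have m0 : 0 < Num.min d1 d2 by rewrite !lt_min d10.
have s0 : 0 < s by rewrite divr_gt0.
have : s < Num.min d1 d2 by rewrite /s; lra.
rewrite !lt_min => /andP[sd1 sd2].
have := h1 s; rewrite s0 sd1 => /(_ isT); rewrite ler_norml => /andP[_].
have := h2 s; rewrite s0 sd2 => /(_ isT).
have : 0 < (c i - p) * s ^+ 2 by rewrite mulr_gt0 ?subr_gt0 // exprn_gt0.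
have : e * s ^+ 2 = (c i - p) * s ^+ 2 / 4 by rewrite /e; field.
lra.
Qed.

End Calculus.

(** * Parabolic comparison *)

Lemma closed_sublevel {R : realType} {T : topologicalType} (K : set T) (h : T -> R) :
  closed K -> {within K, continuous h} -> closed (K `&` [set x | h x <= 0]).
Proof.
move=> cK ch p hp.
have Kp : K p by apply: cK => B /hp [q [[Kq _] Bq]]; exists q.
split => //=; rewrite leNgt; apply/negP => hp0.
have /subspace_continuousP/(_ p Kp)/cvgrPdist_lt/(_ _ hp0) := ch; rewrite near_withinE => /hp [q [[Kq /= hq] /(_ Kq)]].
change (`|h p - h q| < h p -> False).
rewrite ltr_norml => /andP[_]; lra.
Qed.

Section Comparison.
Context {R : realType} {N : nat}.
Implicit Types (x y z : 'rV[R]_N) (h v F : 'rV[R]_N -> R -> R).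

Lemma within_prod_continuousP (K : set 'rV[R]_N) (I : set R) h :
  {within K `*` I, continuous (fun y : 'rV[R]_N * R => h y.1 y.2)} <->
  forall x t, K x -> I t -> forall eps : R, 0 < eps -> exists2 d : R, 0 < d &
    forall y s, K y -> I s -> enorm (y - x) < d -> `|s - t| < d ->
    `|h y s - h x t| < eps.
Proof.
split=> [/subspace_continuousP ch x t Kx It eps eps0|ch].
  have FF : Filter (nbhs (x, t)) by exact: nbhs_filter.
  have /cvgrPdist_lt/(_ _ eps0) := ch (x, t) (conj Kx It).
  rewrite near_withinE => -[[P P'] /= [/nbhs_enormP [d1 d10 h1] hP']] PB.
  have [d2 /= d20 h2] := (nbhs_ballP _ _).1 hP'.
  exists (Num.min d1 d2); first by rewrite lt_min d10.
  move=> y s Ky Is; rewrite !lt_min => /andP[y1 _] /andP[_ s2].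
  rewrite distrC; apply: (PB (y, s)) => //; split => /=; first exact: h1.
  by apply: h2; rewrite /ball /= distrC.
apply/subspace_continuousP => -[x t] [/= Kx It].
have FF : Filter (nbhs (x, t)) by exact: nbhs_filter.
apply/cvgrPdist_lt => eps eps0; rewrite near_withinE.
have [d d0 hd] := ch x t Kx It eps eps0.
exists ([set y | enorm (y - x) < d], ball t d) => /=.
  by split; [apply/nbhs_enormP; exists d|exact: nbhsx_ballx].
move=> [y s] [/= yx]; rewrite /ball /= distrC => st [/= Ky Is].
by rewrite distrC; exact: hd.
Qed.

(** If the set [h <= 0] is nonempty, compactness yields a point in it of minimal time. Before that
    time [h] is positive, at that time nonnegative by continuity, so [h] vanishes at this point:
    exactly the configuration that the hypothesis on contact excludes. *)
Lemma first_touch (K : set 'rV[R]_N) (T T1 : R) h :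
  compact K -> T <= T1 ->
  {within K `*` `[T, T1], continuous (fun y : 'rV[R]_N * R => h y.1 y.2)} ->
  (forall x, K x -> 0 < h x T) ->
  (forall x t, K x -> T < t <= T1 -> h x t = 0 ->
     (forall y s, K y -> T <= s < t -> 0 < h y s) ->
     (forall y, K y -> 0 <= h y t) -> False) ->
  forall x t, K x -> T <= t <= T1 -> 0 < h x t.
Proof.
move=> cK TT1 ch h0 touch x t Kx tT; rewrite ltNge; apply/negP => hxt.
pose Q : set ('rV[R]_N * R) := K `*` `[T, T1].
have cQ : compact Q by apply: compact_setX => //; exact: segment_compact.
have clK : closed K by apply: compact_closed => //; exact: norm_hausdorff.
have clQ : closed Q.
  rewrite (_ : Q = fst @^-1` K `&` snd @^-1` `[T, T1]%classic) //.
  apply: closedI; apply: closed_comp => //; try exact: itv_closed.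
  - by move=> y _; exact: cvg_fst.
  - by move=> y _; exact: cvg_snd.
pose Z := Q `&` [set y | h y.1 y.2 <= 0].
have cZ : compact Z.
  apply: (@subclosed_compact _ Z Q) => //; first exact: closed_sublevel.
  by move=> y [].
have [[x0 t0] /set_mem [[/= Kx0]]] : exists2 c, c \in Z &
    forall y : 'rV[R]_N * R, y \in Z -> c.2 <= y.2.
  apply: (@compact_EVT_min _ R snd Z _ cZ).
    by exists (x, t); split => //; split => //=; rewrite in_itv.
  by apply: continuous_subspaceT => y; exact: cvg_snd.
rewrite in_itv /= => t0T /= hx0 hmin.
have pos y s : K y -> T <= s < t0 -> 0 < h y s.
  move=> Ky /andP[sT st]; rewrite ltNge; apply/negP => hys.
  have : t0 <= s.
    apply: (hmin (y, s)); apply/mem_set; split => //; split => //=.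
    by rewrite in_itv /= sT /=; move: t0T => /andP[_]; apply: le_trans; exact: ltW.
  by rewrite leNgt st.
have Tt0 : T < t0.
  rewrite lt_neqAle; move: (t0T) => /andP[-> _]; rewrite andbT.
  by apply/eqP => E; move: hx0; rewrite -E leNgt h0.
have nn y : K y -> 0 <= h y t0.
  move=> Ky; rewrite leNgt; apply/negP => hyt.
  have hyt' : 0 < - h y t0 by rewrite oppr_gt0.
  have Qy : Q (y, t0) by split => //=; rewrite in_itv.
  have [d d0 hd] := (within_prod_continuousP _ _ _).1 ch y t0 Qy.1 Qy.2 _ hyt'.
  (* A time after [T] and so shortly before [t0] that [h y s] would still be negative, against
     [pos]. *)
  pose s := t0 - Num.min d (t0 - T) / 2.
  have m0 : 0 < Num.min d (t0 - T) by rewrite lt_min d0 subr_gt0.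
  have md : Num.min d (t0 - T) <= d by rewrite ge_min lexx.
  have mT : Num.min d (t0 - T) <= t0 - T by rewrite ge_min lexx orbT.
  have hs : 0 < h y s by apply: pos => //; apply/andP; split; rewrite /s; lra.
  have Is : `[T, T1]%classic s.
    by rewrite /= in_itv /=; move: t0T => /andP[? ?]; apply/andP; split; rewrite /s; lra.
  have := hd y s Ky Is; rewrite subrr enorm0 d0 => /(_ isT).
  have -> : s - t0 = - (Num.min d (t0 - T) / 2) by rewrite /s; ring.
  rewrite normrN ger0_norm; last by lra.
  have -> : Num.min d (t0 - T) / 2 < d by lra.
  move=> /(_ isT); rewrite ltr_norml => /andP[_]; lra.
apply: (touch x0 t0) => //; first by rewrite Tt0; case/andP: t0T.
by apply/eqP; rewrite eq_le hx0 nn.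
Qed.

(** The strict differential inequality is asked only at contact points, so barriers may use [v = F]
    there or rule the contact out altogether. The ball in [K] around the point lets [v] inherit the
    second differences of [F]. *)
Lemma parabolic_comparison (K : set 'rV[R]_N) (T T1 : R) v F :
  compact K -> T <= T1 ->
  {within K `*` `[T, T1],
     continuous (fun y : 'rV[R]_N * R => v y.1 y.2 - F y.1 y.2)} ->
  (forall x, K x -> F x T < v x T) ->
  (forall x t, K x -> T < t <= T1 -> v x t = F x t ->
     exists k b (c : 'I_N -> R),
     [/\ exists2 d : R, 0 < d & forall y, enorm (y - x) < d -> K y,
         heat v x t k, tdiff (F x) t b,
         forall i, sec_lower (F^~ t) x (delta_mx 0 i) (c i) &
         b - \sum_i c i < k]) ->
  forall x t, K x -> T <= t <= T1 -> F x t < v x t.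
Proof.
move=> cK TT1 cvF v0 touch x t Kx tT; rewrite -subr_gt0.
apply: (@first_touch K T T1 (fun y s => v y s - F y s)) => // [y Ky|].
  by rewrite subr_gt0 v0.
move=> {Kx tT t x} x t Kx tT /eqP; rewrite subr_eq0 => /eqP vF pos nn.
have [k [b [c [[d d0 hd] hk hF hc]]]] := touch x t Kx tT vF.
apply/negP; rewrite -leNgt; apply: (heat_touch hk hF) => //.
  exists (t - T); first by rewrite subr_gt0; case/andP: tT.
  move=> s /andP[s0 sT]; rewrite ltW // -subr_gt0; apply: pos => //.
  by apply/andP; split; lra.
move=> i eps eps0; have [d1 d10 hd1] := hc i eps eps0.
exists (Num.min d d1); first by rewrite lt_min d0.
move=> s /andP[s0]; rewrite lt_min => /andP[sd sd1].
have := hd1 s; rewrite s0 sd1 => /(_ isT) /le_trans; apply.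
have e1 : enorm (s *: (delta_mx 0 i : 'rV[R]_N)) < d.
  by rewrite enormZ /enorm dot_delta mxE !eqxx sqrtr1 mulr1 gtr0_norm.
have h1 : K (x + s *: delta_mx 0 i) by apply: hd; rewrite addrAC subrr add0r.
have h2 : K (x - s *: delta_mx 0 i) by apply: hd; rewrite addrAC subrr add0r enormN.
have := nn _ h1; have := nn _ h2; rewrite /sdiff vF; lra.
Qed.

End Comparison.

(** * Continuity of the building blocks of barriers *)

Section Continuity.
Context {R : realType} {T : topologicalType}.
Implicit Types f g : T -> R.

Lemma cts_cst (a : R) : continuous (fun _ : T => a).
Proof. by move=> x; exact: cvg_cst. Qed.

Lemma ctsN f : continuous f -> continuous (fun x => - f x).
Proof. by move=> cf x; apply: cvgN; exact: cf. Qed.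

Lemma ctsD f g : continuous f -> continuous g -> continuous (fun x => f x + g x).
Proof. by move=> cf cg x; apply: cvgD; [exact: cf|exact: cg]. Qed.

Lemma ctsB f g : continuous f -> continuous g -> continuous (fun x => f x - g x).
Proof. by move=> cf cg x; apply: cvgB; [exact: cf|exact: cg]. Qed.

Lemma ctsM f g : continuous f -> continuous g -> continuous (fun x => f x * g x).
Proof. by move=> cf cg x; apply: cvgM; [exact: cf|exact: cg]. Qed.

Lemma cts_exp f : continuous f -> continuous (fun x => expR (f x)).
Proof. by move=> cf x; apply: continuous_comp; [exact: cf|exact: continuous_expR]. Qed.

Lemma cts_norm f : continuous f -> continuous (fun x => `|f x|).
Proof. by move=> cf x; apply: continuous_comp; [exact: cf|exact: norm_continuous]. Qed.

Definition pos (r : R) := (r + `|r|) / 2.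

Lemma cts_pos f : continuous f -> continuous (fun x => pos (f x)).
Proof.
by move=> cf; apply: ctsM; [apply: ctsD => //; exact: cts_norm|exact: cts_cst].
Qed.

(* The parabola [2 d s - s^2], continued by its maximal value for [d <= s]. *)
Definition par (d s : R) := d ^+ 2 - pos (d - s) ^+ 2.

Lemma cts_par (d : R) f : continuous f -> continuous (fun x => par d (f x)).
Proof.
move=> cf; apply: ctsB; first exact: cts_cst.
have cp : continuous (fun x => pos (d - f x)).
  by apply: cts_pos; apply: ctsB => //; exact: cts_cst.
exact: (ctsM cp cp).
Qed.

End Continuity.

(** * Derivatives and second differences of the barriers *)

Section Barriers.
Context {R : realType} {N : nat}.
Implicit Types (x y z e : 'rV[R]_N).

Lemma cts_fst (g : 'rV[R]_N -> R) :
  continuous g -> continuous (fun y : 'rV[R]_N * R => g y.1).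
Proof.
by move=> cg y; apply: (@continuous_comp _ _ _ fst g); [exact: cvg_fst|exact: cg].
Qed.

Lemma cts_snd : continuous (fun y : 'rV[R]_N * R => y.2).
Proof. by move=> y; exact: cvg_snd. Qed.

Lemma is_derive_tdiff (g : R -> R) t a : is_derive t (1 : R) g a -> tdiff g t a.
Proof. by move=> h; apply: eps_derive_tdiff; apply/eps_deriveP. Qed.

Lemma is_derive_exp (A c T t : R) :
  is_derive t (1 : R) (fun s => A * expR (c * (s - T))) (c * (A * expR (c * (t - T)))).
Proof.
pose g (s : R) := c * (s - T).
have i1 : is_derive t (1 : R) g c.
  apply: is_derive_eq; rewrite subr0; exact: mulr1.
have i2 : is_derive t (1 : R) (fun s => expR (g s)) (expR (g t) * c).
  by have := @is_derive1_comp _ expR g t _ _ (is_derive_expR (g t)) i1.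
apply: is_derive_eq; rewrite /g.
change (A * (expR (c * (t - T)) * c) = c * (A * expR (c * (t - T)))); ring.
Qed.

Lemma sec_lower_exact (phi : 'rV[R]_N -> R) x y (c : R) :
  (exists2 d : R, 0 < d & forall s, 0 < s < d -> c * s ^+ 2 <= sdiff phi x y s) ->
  sec_lower phi x y c.
Proof.
move=> [d d0 hd] eps eps0; exists d => // s sd; apply: le_trans (hd s sd).
by rewrite ler_wpM2r ?sqr_ge0 // lerBlDr lerDl ltW.
Qed.

Lemma pos_id (r : R) : 0 <= r -> pos r = r.
Proof. by move=> r0; rewrite /pos ger0_norm //; field. Qed.

Lemma pos_eq0 (r : R) : r <= 0 -> pos r = 0.
Proof. by move=> r0; rewrite /pos ler0_norm // subrr mul0r. Qed.

Lemma par_id (d s : R) : s <= d -> par d s = 2 * d * s - s ^+ 2.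
Proof. by move=> sd; rewrite /par pos_id ?subr_ge0 //; ring. Qed.

Lemma par_max (d s : R) : d <= s -> par d s = d ^+ 2.
Proof. by move=> sd; rewrite /par pos_eq0 ?subr_le0 // expr0n /= subr0. Qed.

Lemma par_le (d s : R) : par d s <= d ^+ 2.
Proof. by rewrite /par gerBl sqr_ge0. Qed.

Lemma par_ge0 (d s : R) : 0 <= d -> 0 <= s -> 0 <= par d s.
Proof.
move=> d0 s0; case: (lerP s d) => sd; last by rewrite par_max ?sqr_ge0 // ltW.
by rewrite par_id //; nra.
Qed.

Lemma sdiff_par_lin d e x y : dot x e < d ->
  exists2 del : R, 0 < del & forall s, 0 < s < del ->
    sdiff (fun z => par d (dot z e)) x y s <= (- 2 * dot y e ^+ 2) * s ^+ 2.
Proof.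
move=> xd; have y0 : 0 < `|dot y e| + 1 by rewrite ltr_wpDl.
have dx : 0 < d - dot x e by rewrite subr_gt0.
exists ((d - dot x e) / (`|dot y e| + 1)); first exact: divr_gt0.
move=> s /andP[s0]; rewrite ltr_pdivlMr // => sd.
have b : `|s * dot y e| < d - dot x e.
  by rewrite normrM gtr0_norm //; apply: le_lt_trans sd; rewrite ler_pM2l // lerDl.
move: b; rewrite ltr_norml => /andP[b1 b2].
rewrite /sdiff !dotE !par_id; [|lra|lra|lra].
by rewrite le_eqVlt; apply/orP; left; apply/eqP; ring.
Qed.

Lemma sdiff_par_max (d : R) (f : 'rV[R]_N -> R) x y s : d <= f x ->
  sdiff (fun z => par d (f z)) x y s <= 0.
Proof.
move=> xd; rewrite /sdiff (par_max xd).
have := par_le d (f (x + s *: y)); have := par_le d (f (x - s *: y)); lra.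
Qed.

(** Two second-order effects: the slope of [par] times the second derivative of the squared norm,
    and the curvature [- 2] of [par] times the squared directional derivative. The remaining quartic
    term has the good sign. *)
Lemma sdiff_par_sqr (r d : R) x y : dot x x - r < d ->
  exists2 del : R, 0 < del & forall s, 0 < s < del ->
    sdiff (fun z => par d (dot z z - r)) x y s <=
    (4 * (d - (dot x x - r)) * dot y y - 8 * dot x y ^+ 2) * s ^+ 2.
Proof.
move=> xd; set a := d - (dot x x - r).
have a0 : 0 < a by rewrite subr_gt0.
(* For [s < 1] the squared norm moves by less than [s * C], so both shifted points stay on the
   quadratic branch of [par]. *)
pose C := 2 * `|dot x y| + dot y y + 1.
have yy := dot_ge0 y.
have C0 : 0 < C by rewrite /C; have := normr_ge0 (dot x y); lra.
exists (Num.min 1 (a / C)); first by rewrite lt_min ltr01 divr_gt0.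
move=> s /andP[s0]; rewrite lt_min ltr_pdivlMr // => /andP[s1 sd].
have ss : s ^+ 2 <= s by rewrite expr2 ler_piMr // ltW.
have s2 : s ^+ 2 * dot y y <= s * dot y y by rewrite ler_wpM2r.
have b : `|s * dot x y| = s * `|dot x y| by rewrite normrM gtr0_norm.
have [b1 b2] : - (s * `|dot x y|) <= s * dot x y /\ s * dot x y <= s * `|dot x y|.
  by rewrite -b; split; [rewrite lerNl -normrN ler_norm|exact: ler_norm].
have sC : s * C = 2 * (s * `|dot x y|) + s * dot y y + s by rewrite /C; ring.
have q1 : dot (x + s *: y) (x + s *: y) - r = d - a + (2 * (s * dot x y) + s ^+ 2 * dot y y).
  by rewrite /a !dotE (dotC y x); ring.
have q2 : dot (x - s *: y) (x - s *: y) - r = d - a + (- 2 * (s * dot x y) + s ^+ 2 * dot y y).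
  by rewrite /a !dotE (dotC y x); ring.
have q0 : dot x x - r = d - a by rewrite /a; ring.
rewrite /sdiff q1 q2 q0 !par_id; [|lra|lra|lra].
have := sqr_ge0 (s ^+ 2 * dot y y); set Y := dot y y; set X := dot x y.
have -> : 2 * d * (d - a + (2 * (s * X) + s ^+ 2 * Y)) -
  (d - a + (2 * (s * X) + s ^+ 2 * Y)) ^+ 2 +
  (2 * d * (d - a + (- 2 * (s * X) + s ^+ 2 * Y)) -
   (d - a + (- 2 * (s * X) + s ^+ 2 * Y)) ^+ 2) -
  2 * (2 * d * (d - a) - (d - a) ^+ 2) =
  (4 * a * Y - 8 * X ^+ 2) * s ^+ 2 - 2 * (s ^+ 2 * Y) ^+ 2 by ring.
lra.
Qed.

Lemma sum_delta_dot_sqr e : \sum_(i < N) dot (delta_mx 0 i) e ^+ 2 = dot e e.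
Proof. by apply: eq_bigr => i _; rewrite dotC dot_delta expr2. Qed.

Lemma dot_delta_delta (i : 'I_N) : dot (delta_mx 0 i) (delta_mx 0 i) = 1 :> R.
Proof. by rewrite dot_delta mxE !eqxx. Qed.

End Barriers.

(** * Linear equations on the half domain *)

Section HalfDomain.
Context {R : realType} {N : nat} (rad : R).
Hypothesis rad0 : 0 <= rad.
Implicit Types (x y z e : 'rV[R]_N).

Lemma SigmaP x : Sigma N rad x <-> rad = 0 \/ rad < enorm x.
Proof.
rewrite /Sigma; case: eqP => [->|r0]; first by split => // _; left.
by split=> [h|[//|h]]; [right|].
Qed.

Lemma Sigma_le x : Sigma N rad x -> rad <= enorm x.
Proof. by move=> /SigmaP [->|/ltW //]; exact: enorm_ge0. Qed.

Lemma Sigma_nbhs x : Sigma N rad x ->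
  exists2 d : R, 0 < d & forall y, enorm (y - x) < d -> Sigma N rad y.
Proof.
move=> /SigmaP [r0|rx]; first by exists 1 => // y _; apply/SigmaP; left.
exists (enorm x - rad); first by rewrite subr_gt0.
move=> y yx; apply/SigmaP; right.
have := enorm_dist y x; rewrite ler_norml => /andP[h _]; lra.
Qed.

Lemma open_Sigma : open (Sigma N rad).
Proof.
rewrite openE => x /Sigma_nbhs [d d0 hd]; rewrite /interior.
by apply/nbhs_enormP; exists d.
Qed.

Lemma Sigma_refl e x : dot e e = 1 -> Sigma N rad (refl_hyp e x) <-> Sigma N rad x.
Proof. by move=> e1; rewrite !SigmaP enorm_refl. Qed.

Definition half_closed e : set 'rV[R]_N := [set x | 0 <= dot x e /\ rad <= enorm x].

Notation hd e := (half_domain (Sigma N rad) e).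

Lemma half_domain_closed e x : hd e x -> half_closed e x.
Proof. by move=> [/Sigma_le h /ltW]. Qed.

Lemma half_domain_nbhs e x : dot e e = 1 -> hd e x ->
  exists2 d : R, 0 < d & forall y, enorm (y - x) < d -> hd e y.
Proof.
move=> e1 [Sx xe]; have [d d0 hd] := Sigma_nbhs Sx.
exists (Num.min d (dot x e)); first by rewrite lt_min d0.
move=> y; rewrite lt_min => /andP[/hd Sy yx]; split => //.
have := cauchy_schwarz (y - x) e; rewrite dotDl dotNl.
have -> : enorm e = 1 by rewrite /enorm e1 sqrtr1.
rewrite mulr1 ler_norml => /andP[h _]; lra.
Qed.

Lemma closed_half_closed e : closed (half_closed e).
Proof.
rewrite (_ : half_closed e = (fun x => dot x e) @^-1` [set r | 0 <= r] `&`
   (@enorm R N) @^-1` [set r | rad <= r]) //.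
apply: closedI; apply: closed_comp; try exact: closed_ge.
- by move=> y _; exact: continuous_dotl.
- by move=> y _; exact: continuous_enorm.
Qed.

Lemma compact_half_closed e (M : R) :
  compact (half_closed e `&` [set x | enorm x <= M]).
Proof.
apply: (@ebounded_closed_compact _ _ _ M); first by move=> x [].
apply: closedI; first exact: closed_half_closed.
apply: (@closed_comp _ _ (@enorm R N) [set r | r <= M]); last exact: closed_le.
by move=> y _; exact: continuous_enorm.
Qed.

Variables (V : R -> R) (C0 : R).

(* Abstracts w = u - u o sigma_e; [ls_eq] is the linear equation
   w_t - Laplacian w + V w = c w with an unknown coefficient |c| <= C0. *)
Record linsol e (w : 'rV[R]_N -> R -> R) : Prop := Linsol {
  ls_unit : dot e e = 1;
  ls_cont : {within half_closed e `*` `[0, +oo[,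
               continuous (fun y : 'rV[R]_N * R => w y.1 y.2)};
  ls_bdry : forall x t, half_closed e x -> ~ hd e x -> 0 <= t -> w x t = 0;
  ls_eq : forall x t, hd e x -> 0 < t -> exists2 k, heat w x t k &
            `|k + V (enorm x) * w x t| <= C0 * `|w x t|;
  ls_decay : forall eps : R, 0 < eps -> exists M : R, forall x t,
            hd e x -> 0 < t -> M < enorm x -> `|w x t| < eps }.

(** Reduction to a compact set: far out [F <= - g0 < w], on the boundary [F < 0 = w], so contact can
    only occur in the half domain within a bounded region. The unknown coefficient is replaced by
    its worst case [C0 * |F|]. *)
Lemma lower_comparison e w (F : 'rV[R]_N -> R -> R) (T T1 : R) :
  linsol e w -> 0 <= T <= T1 ->
  continuous (fun y : 'rV[R]_N * R => F y.1 y.2) ->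
  (exists2 g0 : R, 0 < g0 & exists M : R, forall x t, hd e x -> M < enorm x ->
     T <= t <= T1 -> F x t <= - g0) ->
  (forall x t, half_closed e x -> ~ hd e x -> T <= t <= T1 -> F x t < 0) ->
  (forall x, hd e x -> F x T < w x T) ->
  (forall x t, hd e x -> T < t <= T1 -> w x t = F x t ->
     exists b (c : 'I_N -> R), [/\ tdiff (F x) t b,
       forall i, sec_lower (F^~ t) x (delta_mx 0 i) (c i) &
       b - \sum_i c i < - V (enorm x) * F x t - C0 * `|F x t|]) ->
  forall x t, hd e x -> T <= t <= T1 -> F x t < w x t.
Proof.
move=> [e1 wc wb weq wdec] /andP[T0 TT1] cF [g0 g00 [M1 hM1]] hb hi ht x t hx tT.
have [M2 hM2] := wdec g0 g00.
(* Including [enorm x] puts the given point into [K]; the extra [1] makes contact points interior to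
   the cut-off ball. *)
pose M := Num.max (Num.max M1 M2) (enorm x) + 1.
pose K := half_closed e `&` [set x | enorm x <= M].
have xM : enorm x <= M.
  by rewrite /M (@le_trans _ _ (Num.max (Num.max M1 M2) (enorm x))) ?le_max ?lexx ?orbT // lerDl.
apply: (@parabolic_comparison _ _ K T T1) => //.
- exact: compact_half_closed.
- have -> : (fun y : 'rV[R]_N * R => w y.1 y.2 - F y.1 y.2) =
    (fun y : 'rV[R]_N * R => w y.1 y.2) - (fun y : 'rV[R]_N * R => F y.1 y.2) by [].
  apply: within_continuousB; last exact: continuous_subspaceT.
  apply: continuous_subspaceW wc => -[y s] [/= [Ky _]]; rewrite in_itv /= => /andP[Ts _].
  by split => //=; rewrite in_itv /= andbT (le_trans T0).
- move=> y [Ky _]; have [/hi //|ny] := pselect (hd e y).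
  by rewrite (wb _ _ Ky ny T0) hb // lexx TT1.
- move=> y s [Ky yM] /andP[Ts sT1] wF.
  have hs : T <= s <= T1 by rewrite (ltW Ts).
  have s0 : 0 < s by exact: le_lt_trans Ts.
  have [hy|ny] := pselect (hd e y); last first.
    by have := hb y s Ky ny hs; rewrite -wF (wb _ _ Ky ny (ltW s0)) ltxx.
  have [ylarge|ysmall] := ltP (Num.max M1 M2) (enorm y).
    move: ylarge; rewrite gt_max => /andP[y1 y2].
    have := hM2 y s hy s0 y2; have := hM1 y s hy y1 hs.
    rewrite -wF ltr_norml => h1 /andP[h2 _]; lra.
  have [b [c [hF hc hlt]]] := ht y s hy (introT andP (conj Ts sT1)) wF.
  have [k hk hk'] := weq y s hy s0.
  exists k, b, c; split => //.
    have [d d0 hd'] := half_domain_nbhs e1 hy.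
    exists (Num.min d 1); first by rewrite lt_min d0 ltr01.
    move=> z; rewrite lt_min => /andP[/hd' hz zy1]; split; first exact: half_domain_closed.
    rewrite /= /M; have := enormD (z - y) y; rewrite subrK => zy.
    have : enorm y <= Num.max (Num.max M1 M2) (enorm x) by rewrite le_max ysmall.
    lra.
  apply: lt_le_trans hlt _; rewrite -wF.
  by move: hk'; rewrite ler_norml => /andP[h _]; lra.
- by split => //; exact: half_domain_closed.
Qed.

(* Barrier - eta g(x) exp(- kap (t - T)). *)
Lemma decay_comparison e w (g : 'rV[R]_N -> R) (D : set 'rV[R]_N) (kap G T T1 eta : R) :
  linsol e w -> 0 <= T <= T1 -> 0 <= eta -> continuous g ->
  (forall x, half_closed e x -> 1 <= g x <= G) ->
  (forall x, hd e x -> D x \/ exists2 c : 'I_N -> R,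
     (forall i, exists2 d : R, 0 < d & forall s, 0 < s < d ->
        sdiff g x (delta_mx 0 i) s <= c i * s ^+ 2) &
     (kap + C0 - V (enorm x)) * g x + \sum_i c i < 0) ->
  (forall x, hd e x -> - eta <= w x T) ->
  (forall x t, hd e x -> D x -> T < t <= T1 -> 0 <= w x t) ->
  forall x t, hd e x -> T <= t <= T1 -> - (eta * g x * expR (- kap * (t - T))) <= w x t.
Proof.
move=> lw T01 eta0 cg hg hc hT hD.
(* A slightly larger [eta1] makes the initial inequality strict; afterwards [eta1] tends to
   [eta]. *)
have main (eta1 : R) : eta < eta1 -> forall x t, hd e x -> T <= t <= T1 ->
    - (eta1 * g x * expR (- kap * (t - T))) < w x t.
  move=> eta1e; have eta10 : 0 < eta1 by exact: le_lt_trans eta1e.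
  have gp x : half_closed e x -> 0 < g x by move=> /hg /andP[h _]; exact: lt_le_trans h.
  apply: (@lower_comparison e w (fun x t => - (eta1 * g x * expR (- kap * (t - T))))) => //.
  - apply: ctsN; apply: ctsM.
      by apply: ctsM; [exact: cts_cst|exact: cts_fst].
    apply: cts_exp; apply: ctsM; first exact: cts_cst.
    by apply: ctsB; [exact: cts_snd|exact: cts_cst].
  - exists (eta1 * expR (- `|kap| * (T1 - T))); first by rewrite mulr_gt0 ?expR_gt0.
    exists 0 => x t hx _ /andP[Tt tT1]; rewrite lerN2.
    have g1 : 1 <= g x by case/andP: (hg x (half_domain_closed hx)).
    apply: ler_pM; rewrite ?(ltW eta10) ?expR_ge0 //.
      by rewrite ler_peMr // ltW.
    rewrite ler_expR.
    apply: (@le_trans _ _ (- `|kap| * (t - T))).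
      by rewrite !mulNr lerN2 ler_wpM2l // lerD2r.
    by rewrite !mulNr lerN2 ler_wpM2r ?subr_ge0 // ler_norm.
  - move=> x t /gp gx _ _; rewrite oppr_lt0 mulr_gt0 ?expR_gt0 // mulr_gt0 //.
  - move=> x hx; rewrite subrr mulr0 expR0 mulr1; apply: lt_le_trans (hT x hx).
    rewrite ltrN2; apply: lt_le_trans eta1e _; rewrite ler_peMr ?(ltW eta10) //.
    by case/andP: (hg x (half_domain_closed hx)).
  - move=> x t hx tT wF.
    have E0 : 0 < expR (- kap * (t - T)) by exact: expR_gt0.
    have gx := gp _ (half_domain_closed hx).
    have [Dx|[c hcx hcs]] := hc x hx.
      have := hD x t hx Dx tT; rewrite wF oppr_ge0 leNgt.
      by rewrite mulr_gt0 ?expR_gt0 // mulr_gt0.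
    set E := expR _ in wF E0 *.
    exists (kap * (eta1 * g x * E)), (fun i => - (eta1 * E * c i)); split.
    + have := is_derive_tdiff (is_derive_exp (- (eta1 * g x)) (- kap) T t).
      rewrite -/E; congr tdiff; first by apply/funext => s; rewrite mulNr.
      ring.
    + move=> i; apply: sec_lower_exact; have [d d0 hd'] := hcx i.
      exists d => // s sd; have := hd' s sd; rewrite /sdiff -/E => h.
      have := ler_wpM2l (ltW (mulr_gt0 eta10 E0)) h; lra.
    + rewrite sumrN opprK -mulr_sumr normrN ger0_norm; last by rewrite !mulr_ge0 // ltW.
      rewrite -subr_lt0.
      have -> : kap * (eta1 * g x * E) + eta1 * E * \sum_i c i -
        (- V (enorm x) * - (eta1 * g x * E) - C0 * (eta1 * g x * E)) =
        eta1 * E * ((kap + C0 - V (enorm x)) * g x + \sum_i c i) by ring.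
      by rewrite pmulr_rlt0 // mulr_gt0.
move=> x t hx tT; have g0 : 0 < g x.
  by case/andP: (hg x (half_domain_closed hx)) => h _; exact: lt_le_trans h.
have E0 : 0 < expR (- kap * (t - T)) by exact: expR_gt0.
apply/ler_addgt0Pr => eps eps0.
have h : eta < eta + eps / (g x * expR (- kap * (t - T))).
  by rewrite ltrDl divr_gt0 // mulr_gt0.
have := main _ h x t hx tT.
have -> : (eta + eps / (g x * expR (- kap * (t - T)))) * g x * expR (- kap * (t - T))
  = eta * g x * expR (- kap * (t - T)) + eps.
  by field; apply/andP; split; exact: lt0r_neq0.
lra.
Qed.

End HalfDomain.

(** * Growth and decay of the negative part *)

Section Decay.
Context {R : realType} {N : nat} (rad : R).
Hypothesis rad0 : 0 <= rad.
Variables (V : R -> R) (C0 Lam : R).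
Hypothesis C00 : 0 <= C0.
Hypothesis Lam0 : 0 <= Lam.
Hypothesis V_lower : forall r, rad <= r -> C0 - V r <= Lam.
Hypothesis V_bounded : forall M, exists2 L : R, 0 <= L &
  forall r, 0 <= r <= M -> `|V r| + C0 <= L.
Implicit Types (x y z e : 'rV[R]_N).

Notation hd e := (half_domain (Sigma N rad) e).
Notation lsol := (linsol rad V C0).

(** [decay_comparison] with the constant profile and the negative rate [- (Lam + 1)]; the summand
    [1] makes the differential inequality strict. *)
Lemma growth_bound e w (T T1 eta : R) :
  lsol e w -> 0 <= T <= T1 -> 0 <= eta ->
  (forall x, hd e x -> - eta <= w x T) ->
  forall x t, hd e x -> T <= t <= T1 -> - (eta * expR ((Lam + 1) * (t - T))) <= w x t.
Proof.
move=> lw T01 eta0 hT x t hx tT.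
have := @decay_comparison R N rad V C0 e w (fun=> 1) set0 (- (Lam + 1)) 1 T T1 eta
  lw T01 eta0.
rewrite mulr1 opprK; apply => //.
- exact: cts_cst.
- by move=> y _; rewrite lexx.
- move=> y hy; right; exists (fun=> 0).
    by move=> i; exists 1 => // s _; rewrite /sdiff mul0r; lra.
  rewrite big1 // addr0 mulr1.
  by have := V_lower (Sigma_le hy.1); lra.
Qed.

(** The region of the half domain that no decay barrier reaches: off the strip, off the shell and
    inside radius [rho]. Positivity has to be supplied there. The shell is measured in the squared
    norm, which is a polynomial. *)
Definition core (d Dq rho : R) e : set 'rV[R]_N :=
  [set x | [/\ d <= dot x e, rad ^+ 2 + Dq <= dot x x & enorm x <= rho]].

Let mul_sqr_le1 (L d : R) : 0 <= L -> 0 <= d <= 1 -> d <= 1 / L -> L * d ^+ 2 <= 1.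
Proof.
move=> L0 /andP[d0 d1] dL; rewrite expr2 mulrA mulr_ile1 ?mulr_ge0 //.
have [->|Ln] := eqVneq L 0; first by rewrite mul0r ler01.
by rewrite mulrC -ler_pdivlMr // lt_neqAle eq_sym Ln.
Qed.

(** [L2 * Dq ^+ 2 <= 1] limits the height of the shell barrier, [N * Dq <= rad ^+ 2] makes its
    Laplacian at most [- 4 * rad ^+ 2], and the last inequality lets it beat a zeroth-order term of
    size [3 * Lb]. For [rad = 0] there is no inner sphere and both parameters are [0]. *)
Lemma shell_parameters (Lb a : R) : 0 <= Lb -> rad < a ->
  exists Dq L2 : R, [/\ 0 <= L2, rad ^+ 2 + Dq <= a ^+ 2,
    L2 * Dq ^+ 2 <= 1, N%:R * Dq <= rad ^+ 2 &
    (rad = 0 /\ Dq = 0) \/ (0 < Dq /\ 3 * Lb < 4 * rad ^+ 2 * L2)].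
Proof.
move=> Lb0 ra; have [r0|r0] := eqVneq rad 0.
  exists 0, 0; rewrite r0 expr0n /= !mulr0 addr0 sqr_ge0 ?mul0r !lexx ler01.
  by split => //; left.
have rp : 0 < rad by rewrite lt_neqAle eq_sym r0.
have r2 : 0 < rad ^+ 2 by rewrite exprn_gt0.
pose L2 := (Lb + 1) / rad ^+ 2.
have L20 : 0 < L2 by rewrite divr_gt0 // ltr_wpDl.
have ar : 0 < a ^+ 2 - rad ^+ 2 by rewrite subr_gt0 ltrXn2r // ?nnegrE ?(ltW (lt_trans rp ra)).
pose Dq := Num.min (Num.min (a ^+ 2 - rad ^+ 2) (rad ^+ 2 / N.+1%:R)) (Num.min 1 (1 / L2)).
have D0 : 0 < Dq.
  by rewrite !lt_min ar ltr01 /=; apply/andP; split; rewrite divr_gt0.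
have [D1 D2 D3 D4] : [/\ Dq <= a ^+ 2 - rad ^+ 2, Dq <= rad ^+ 2 / N.+1%:R, Dq <= 1 & Dq <= 1 / L2].
  by split; rewrite /Dq !ge_min lexx ?orbT.
exists Dq, L2; split; [exact: ltW|by lra| | |].
- by apply: mul_sqr_le1 => //; rewrite ltW ?D3 // ltW.
- move: D2; rewrite ler_pdivlMr // => h; apply: le_trans h.
  by rewrite mulrC ler_pM2l // ler_nat.
- right; split => //.
  rewrite (_ : 4 * rad ^+ 2 * L2 = 4 * (Lb + 1)); first by lra.
  by rewrite /L2; field.
Qed.

(* In the thin strip along the hyperplane and in the thin shell along the
   inner sphere the concave barrier [g] has a large negative Laplacian;
   outside the ball of radius [rho] the potential exceeds [gam + C0]. *)
Lemma outer_decay (rho gam dmax a : R) : 0 < dmax -> rad < a ->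
  (forall r, rho < r -> gam + C0 < V r) ->
  exists d Dq : R, [/\ 0 < d <= dmax, 0 <= Dq, rad ^+ 2 + Dq <= a ^+ 2,
    rad = 0 \/ 0 < Dq &
    forall e w (T T1 eta : R), lsol e w -> 0 <= T <= T1 -> 0 <= eta ->
      (forall x, hd e x -> - eta <= w x T) ->
      (forall x t, hd e x -> core d Dq rho e x -> T < t <= T1 -> 0 <= w x t) ->
      forall x t, hd e x -> T <= t <= T1 ->
        - (3 * eta * expR (- gam * (t - T))) <= w x t].
Proof.
move=> dm0 ra hgam.
have [L0 L00 hL0] := V_bounded rho.
pose Lb := `|gam| + L0; have Lb0 : 0 <= Lb by rewrite addr_ge0.
have [Dq [L2 [L20 Da LD ND hD]]] := shell_parameters Lb0 ra.
have D0 : 0 <= Dq by case: hD => [[_ ->]|[/ltW]].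
(* The strip contributes [- 2 * L1], which beats the zeroth-order term, at most [3 * Lb] since
   [g <= 3]. *)
pose L1 := 2 * Lb + 1; have L10 : 0 < L1 by rewrite /L1; lra.
pose d := Num.min dmax (Num.min 1 (1 / L1)).
have d0 : 0 < d by rewrite !lt_min dm0 ltr01 divr_gt0.
have [d1 d2 d3] : [/\ d <= dmax, d <= 1 & d <= 1 / L1].
  by split; rewrite /d !ge_min lexx ?orbT.
have Ld : L1 * d ^+ 2 <= 1 by apply: mul_sqr_le1; rewrite ?(ltW d0) ?(ltW L10).
exists d, Dq; split => //.
- by rewrite d0.
- by case: hD => [[->]|[? _]]; [left|right].
move=> e w T T1 eta lw T01 eta0 hT hcore x t hx tT.
pose g y := 1 + L1 * par d (dot y e) + L2 * par Dq (dot y y - rad ^+ 2).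
have gb y : half_closed rad e y -> 1 <= g y <= 3.
  move=> [ye yr]; have q0 : 0 <= dot y y - rad ^+ 2.
    by rewrite subr_ge0 -sqr_enorm lerXn2r // ?nnegrE ?enorm_ge0.
  have p1 := par_ge0 (ltW d0) ye; have p2 := par_ge0 D0 q0.
  have p3 := ler_wpM2l (ltW L10) (par_le d (dot y e)).
  have p4 := ler_wpM2l L20 (par_le Dq (dot y y - rad ^+ 2)).
  have p5 := mulr_ge0 (ltW L10) p1; have p6 := mulr_ge0 L20 p2.
  by rewrite /g; apply/andP; split; lra.
have cg : continuous g.
  apply: ctsD; [apply: ctsD; first exact: cts_cst|]; apply: ctsM; try exact: cts_cst.
    by apply: cts_par; exact: continuous_dotl.
  by apply: cts_par; apply: ctsB; [exact: continuous_sqr_enorm|exact: cts_cst].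
have hgx : g x <= 3 by have /andP[] := gb x (half_domain_closed hx).
have main := @decay_comparison R N rad V C0 e w g (core d Dq rho e) gam 3 T T1 eta
  lw T01 eta0 cg gb.
apply: le_trans (main _ hT hcore x t hx tT).
  rewrite lerN2 [3 * _]mulrC ler_wpM2r ?expR_ge0 // ler_wpM2l //.
move=> {main hx tT x t hgx} x hx; have [ye yr] := half_domain_closed hx.
have [Dx|nD] := pselect (core d Dq rho e x); first by left.
right.
have q0 : 0 <= dot x x - rad ^+ 2.
  by rewrite subr_ge0 -sqr_enorm lerXn2r // ?nnegrE ?enorm_ge0.
pose c1 (i : 'I_N) := if dot x e < d then - 2 * dot (delta_mx 0 i) e ^+ 2 else 0.
pose c2 (i : 'I_N) := if dot x x - rad ^+ 2 < Dq then
  4 * (Dq - (dot x x - rad ^+ 2)) * dot (delta_mx 0 i) (delta_mx 0 i)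
  - 8 * dot x (delta_mx 0 i) ^+ 2 else 0.
exists (fun i => L1 * c1 i + L2 * c2 i).
  move=> i.
  have [a1 a10 h1] : exists2 a : R, 0 < a & forall s, 0 < s < a ->
      sdiff (fun z => par d (dot z e)) x (delta_mx 0 i) s <= c1 i * s ^+ 2.
    rewrite /c1; case: ltP => xe; first exact: sdiff_par_lin.
    by exists 1 => // s _; rewrite mul0r; exact: (@sdiff_par_max _ _ d (fun z => dot z e)).
  have [a2 a20 h2] : exists2 a : R, 0 < a & forall s, 0 < s < a ->
      sdiff (fun z => par Dq (dot z z - rad ^+ 2)) x (delta_mx 0 i) s <= c2 i * s ^+ 2.
    rewrite /c2; case: ltP => xe; first exact: sdiff_par_sqr.
    by exists 1 => // s _; rewrite mul0r; exact: (@sdiff_par_max _ _ Dq (fun z => dot z z - rad ^+ 2)).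
  exists (Num.min a1 a2); first by rewrite lt_min a10.
  move=> s /andP[s0]; rewrite lt_min => /andP[s1 s2].
  have := h1 s; have := h2 s; rewrite s0 s1 s2 => /(_ isT) b2 /(_ isT) b1.
  have := ler_wpM2l (ltW L10) b1; have := ler_wpM2l L20 b2.
  rewrite /sdiff /g; lra.
rewrite big_split /= -!mulr_sumr.
have S1 : \sum_i c1 i = if dot x e < d then - 2 else 0.
  rewrite /c1; case: ifP => _; last by rewrite big1.
  by rewrite -mulr_sumr sum_delta_dot_sqr (ls_unit lw) mulr1.
have S2 : \sum_i c2 i = if dot x x - rad ^+ 2 < Dq then
   4 * (Dq - (dot x x - rad ^+ 2)) * N%:R - 8 * dot x x else 0.
  rewrite /c2; case: ifP => _; last by rewrite big1.
  rewrite sumrB -!mulr_sumr; congr (_ - _).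
    congr (_ * _); rewrite (eq_bigr (fun=> 1)) => [|i _]; last exact: dot_delta_delta.
    by rewrite sumr_const card_ord.
  by congr (_ * _); rewrite -sum_delta_dot_sqr; apply: eq_bigr => i _; rewrite dotC.
(* The first term is at most [4 * N * Dq <= 4 * rad ^+ 2], the second at most [- 8 * rad ^+ 2]. *)
have S2' : dot x x - rad ^+ 2 < Dq ->
   4 * (Dq - (dot x x - rad ^+ 2)) * N%:R - 8 * dot x x <= - 4 * rad ^+ 2.
  move=> h; have : (dot x x - rad ^+ 2) * N%:R >= 0 by rewrite mulr_ge0.
  by move: q0 ND; lra.
have S2le : \sum_i c2 i <= 0.
  rewrite S2; case: ltP => // h; apply: le_trans (S2' h) _.
  by have := sqr_ge0 rad; lra.
have S1le : \sum_i c1 i <= 0 by rewrite S1; case: ifP => // _; lra.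
have /andP[g1 g3] := gb x (half_domain_closed hx).
have m1 : L1 * \sum_i c1 i <= 0 by rewrite pmulr_rle0.
have m2 : L2 * \sum_i c2 i <= 0 by rewrite mulr_ge0_le0.
have [xr|xr] := ltP rho (enorm x).
  have : (gam + C0 - V (enorm x)) * g x < 0.
    rewrite pmulr_llt0 ?(lt_le_trans ltr01) // subr_lt0; exact: hgam.
  lra.
have : (gam + C0 - V (enorm x)) * g x <= 3 * Lb.
  apply: (@le_trans _ _ (Lb * g x)); last by rewrite mulrC ler_wpM2r.
  rewrite ler_wpM2r ?(le_trans ler01) // /Lb.
  have := hL0 (enorm x); rewrite enorm_ge0 xr => /(_ isT).
  have := ler_norm gam; have := ler_norm (- V (enorm x)); rewrite normrN; lra.
have [h|h] := ltP (dot x e) d.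
  by move: m1; rewrite S1 h /L1; lra.
have hq : dot x x - rad ^+ 2 < Dq.
  by rewrite ltNge; apply/negP => hq; apply: nD; split => //; lra.
case: hD => [[r0 Dq0]|[_ hL2]].
  by move: hq; rewrite Dq0 ltNge q0.
have := ler_wpM2l L20 (S2' hq); rewrite S2 hq in m2 *.
rewrite S1 ifN ?mulr0; last by rewrite -leNgt.
lra.
Qed.

End Decay.

(** * Boundary layers and spreading of positivity *)

Section Spreading.
Context {R : realType} {N : nat} (rad : R).
Hypothesis rad0 : 0 <= rad.
Variables (V : R -> R) (C0 Lam : R).
Hypothesis C00 : 0 <= C0.
Hypothesis Lam0 : 0 <= Lam.
Hypothesis V_lower : forall r, rad <= r -> C0 - V r <= Lam.
Hypothesis V_bounded : forall M, exists2 L : R, 0 <= L &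
  forall r, 0 <= r <= M -> `|V r| + C0 <= L.
Implicit Types (x y z e : 'rV[R]_N).

Notation hd e := (half_domain (Sigma N rad) e).
Notation lsol := (linsol rad V C0).

Lemma exp_le1 (a : R) : a <= 0 -> expR a <= 1.
Proof. by move=> a0; rewrite -[leRHS]expR0 ler_expR. Qed.

Lemma exp_ge1 (a : R) : 0 <= a -> 1 <= expR a.
Proof. by move=> a0; rewrite -[leLHS]expR0 ler_expR. Qed.

(* The odd function [w] vanishes on the hyperplane: a concave barrier in the
   strip, whose height is reached only after the initial layer has decayed. *)
Lemma strip_bound (K2 : R) : 0 <= K2 -> exists d A : R, [/\ 0 < d, 0 < A &
  forall e w, lsol e w -> (forall x t, hd e x -> 0 < t -> `|w x t| <= K2) ->
  forall x t, hd e x -> 1 <= t -> dot x e < d ->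
    - (A * dot x e + A * expR (- (t - 1))) <= w x t].
Proof.
move=> K20; have L1 : 0 < Lam + 1 by rewrite ltr_wpDl.
(* With this width [(Lam + 1) * d ^+ 2 = d <= 1], which bounds the correction inside [F]. *)
pose d : R := 1 / (Lam + 1).
have d0 : 0 < d by rewrite divr_gt0.
have Lam1 := Lam0; have d1 : d <= 1 by rewrite ler_pdivrMr //; lra.
have dL : (Lam + 1) * d = 1 by rewrite /d mulrCA mulfV ?mulr1 // gt_eqF.
(* [A * d ^+ 2 = K2 + 1] puts the barrier below [- K2] where the parabola has full height, so
   contact occurs only inside the strip. *)
pose A := (K2 + 1) / d ^+ 2; have A0 : 0 < A by rewrite divr_gt0 ?exprn_gt0 //; lra.
have Ad : A * d ^+ 2 = K2 + 1 by rewrite /A divfK // gt_eqF // exprn_gt0.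
exists d, (2 * A * (d + 1)); split => //.
  by apply: mulr_gt0; [exact: mulr_gt0|exact: addr_gt0].
move=> e w lw hK x t hx t1 xd.
pose E (s : R) := (K2 + 1) * expR (-1 * (s - 1)).
have E0 s : 0 < E s by rewrite mulr_gt0 ?expR_gt0 //; lra.
(* The first term yields the bound linear in the distance. The second starts at height [K2 + 1] at
   time [1]; its concave correction pays for the decay of [E] and for the growth rate [Lam]. *)
pose F y s := - (A * par d (dot y e) + E s * (1 + (Lam + 1) * par d (dot y e))).
have q1 y : half_closed rad e y -> 0 <= par d (dot y e) /\ (Lam + 1) * par d (dot y e) <= 1.
  move=> [ye _]; split; first by apply: par_ge0 => //; exact: ltW.
  apply: le_trans (ler_wpM2l (ltW L1) (par_le d (dot y e))) _.
  by rewrite expr2 mulrA dL mul1r.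
have FE y s : half_closed rad e y -> F y s <= - E s - A * par d (dot y e).
  move=> /q1 [p0 _]; rewrite /F; have := mulr_ge0 (ltW (E0 s)) (mulr_ge0 (ltW L1) p0); lra.
have Em s s' : s <= s' -> E s' <= E s.
  by move=> ss; rewrite ler_wpM2l ?ler_expR //; lra.
have key : F x t < w x t.
  apply: (@lower_comparison R N rad V C0 e w F 1 t lw) => //; last by rewrite lexx t1.
  - by rewrite ler01 t1.
  - apply: ctsN; apply: ctsD.
      apply: ctsM; first exact: cts_cst.
      by apply: (@cts_fst _ _ (fun y => par d (dot y e))); apply: cts_par; exact: continuous_dotl.
    apply: ctsM.
      apply: ctsM; first exact: cts_cst.
      apply: cts_exp; apply: ctsM; first exact: cts_cst.
      by apply: ctsB; [exact: cts_snd|exact: cts_cst].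
    apply: ctsD; first exact: cts_cst.
    apply: ctsM; first exact: cts_cst.
    by apply: (@cts_fst _ _ (fun y => par d (dot y e))); apply: cts_par; exact: continuous_dotl.
  - exists (E t) => //; exists 0 => y s hy _ /andP[_ st].
    have hc := half_domain_closed hy; have [p0 _] := q1 y hc.
    apply: le_trans (FE y s hc) _; have := Em _ _ st; have := mulr_ge0 (ltW A0) p0; lra.
  - move=> y s hc _ _; have [p0 _] := q1 y hc.
    apply: le_lt_trans (FE y s hc) _; have := E0 s; have := mulr_ge0 (ltW A0) p0; lra.
  - move=> y hy; have hc := half_domain_closed hy; have [p0 _] := q1 y hc.
    apply: le_lt_trans (FE y 1 hc) _.
    have := hK y 1 hy ltr01; rewrite ler_norml => /andP[h _].
    have E1 : E 1 = K2 + 1 by rewrite /E subrr mulr0 expR0 mulr1.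
    have := mulr_ge0 (ltW A0) p0; rewrite E1; lra.
  - move=> y s hy /andP[s1 _] wF.
    have hc := half_domain_closed hy; have [p0 pL] := q1 y hc.
    have s0 : 0 < s by lra.
    have := hK y s hy s0; rewrite ler_norml => /andP[h _].
    have [yd|yd] := leP d (dot y e).
      have := FE y s hc; rewrite par_max // Ad -wF; have := E0 s; lra.
    exists (E s * (1 + (Lam + 1) * par d (dot y e))),
      (fun i => (A + E s * (Lam + 1)) * (2 * dot (delta_mx 0 i) e ^+ 2)).
    split.
    + have i1 := is_derive_exp (- ((K2 + 1) * (1 + (Lam + 1) * par d (dot y e)))) (-1) 1 s.
      have := tdiff_sub (is_derive_tdiff i1) (is_derive_tdiff (is_derive_cst (A * par d (dot y e)) s 1)).
      congr tdiff; last by rewrite /E; ring.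
      by apply/funext => r; rewrite /F /E /=; ring.
    + move=> i; apply: sec_lower_exact.
      have [a a0 ha] := sdiff_par_lin (delta_mx 0 i) yd; exists a => // r /ha.
      have AE : 0 < A + E s * (Lam + 1) by rewrite addr_gt0 // mulr_gt0.
      move=> /(ler_wpM2l (ltW AE)); rewrite /sdiff /F; lra.
    + rewrite -mulr_sumr -mulr_sumr sum_delta_dot_sqr (ls_unit lw) mulr1.
      have F0 : 0 < - F y s by have := FE y s hc; have := E0 s; have := mulr_ge0 (ltW A0) p0; lra.
      rewrite -normrN gtr0_norm //.
      have hV := V_lower hc.2.
      have := ler_wpM2r (ltW F0) hV.
      have FQ : - F y s = A * par d (dot y e) + E s * (1 + (Lam + 1) * par d (dot y e)) by rewrite opprK.
      have b1 : Lam * (A * par d (dot y e)) <= A.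
        have := ler_wpM2l (ltW A0) pL; have := mulr_ge0 (ltW A0) p0; lra.
      have b2 : E s * ((Lam + 1) * par d (dot y e)) <= E s.
        have := ler_wpM2l (ltW (E0 s)) pL; lra.
      have b3 := ler_wpM2l Lam1 b2; have := E0 s.
      have b4 : Lam * - F y s <= A + 2 * (Lam * E s) by rewrite FQ; lra.
      lra.
apply: le_trans (ltW key); rewrite lerN2 (par_id (ltW xd)).
have hc := half_domain_closed hx; have [p0 pL] := q1 x hc.
have ex : 0 <= dot x e by case: hc.
have EE : E t = (A * d ^+ 2) * expR (- (t - 1)) by rewrite Ad /E mulN1r.
have X0 := expR_gt0 (- (t - 1)); set X := expR _ in EE X0 *.
have := ler_wpM2l (ltW (E0 t)) pL; rewrite (par_id (ltW xd)) => h1.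
have h2 : E t <= A * X.
  by rewrite EE ler_wpM2r ?(ltW X0) // ler_piMr ?(ltW A0) // expr2 mulr_ile1 // ltW.
have h3 := mulr_ge0 (ltW A0) (sqr_ge0 (dot x e)).
have h4 := mulr_ge0 (mulr_ge0 (ltW A0) (ltW X0)) (ltW d0).
have h5 := mulr_ge0 (ltW A0) ex.
lra.
Qed.

Lemma ball_nbhs z y (q : R) : dot z z < q -> exists2 d : R, 0 < d &
  forall s, `|s| < d -> dot (z + s *: y) (z + s *: y) < q.
Proof.
move=> zq; pose C := 2 * `|dot z y| + dot y y + 1.
have yy := dot_ge0 y; have C00' : 0 < C by rewrite /C; have := normr_ge0 (dot z y); lra.
exists (Num.min 1 ((q - dot z z) / C)); first by rewrite lt_min ltr01 divr_gt0 // subr_gt0.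
move=> s; rewrite lt_min ltr_pdivlMr // => /andP[s1 sd].
have -> : dot (z + s *: y) (z + s *: y) = dot z z + (2 * (s * dot z y) + s ^+ 2 * dot y y).
  by rewrite !dotE (dotC y z); ring.
have h1 : s * dot z y <= `|s| * `|dot z y| by rewrite -normrM ler_norm.
have h2 : s ^+ 2 * dot y y <= `|s| * dot y y.
  by rewrite ler_wpM2r // -normr_id -[s ^+ 2]ger0_norm ?sqr_ge0 // normrX normr_id expr2 ler_piMr // ltW.
have : `|s| * C = 2 * (`|s| * `|dot z y|) + `|s| * dot y y + `|s| by rewrite /C; ring.
have := normr_ge0 s; lra.
Qed.

Lemma tdiff_local (f g : R -> R) t a : (exists2 d : R, 0 < d &
  forall s, `|s| < d -> f (t - s) = g (t - s)) -> tdiff f t a -> tdiff g t a.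
Proof.
move=> [d d0 hd] hf eps eps0; have [d1 d10 h1] := hf eps eps0.
exists (Num.min d d1); first by rewrite lt_min d0.
move=> s /andP[s0]; rewrite lt_min => /andP[sd sd1].
have := h1 s; rewrite s0 sd1 => /(_ isT).
have := hd 0; rewrite normr0 subr0 => -> //; rewrite hd //.
by rewrite gtr0_norm.
Qed.

(* Moving-ball subsolution
   - eps exp(L (t-s)) + kap r^-4 exp(- beta (t-s)) (r^2 - |x - y - (t-s) b|^2)_+^2. *)
Lemma spread (r M b0 : R) : 0 < r -> 0 <= b0 ->
  exists c C : R, [/\ 0 < c <= 1, 1 <= C &
  forall e w y b (tau s kap eps : R), lsol e w -> enorm b <= b0 ->
    1 <= tau <= 2 -> 0 <= s -> 0 <= eps ->
    (forall th x, 0 <= th <= tau -> enorm (x - (y + th *: b)) < r ->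
       hd e x /\ enorm x <= M) ->
    (forall x, enorm (x - y) < r -> kap <= w x s) ->
    (forall x t, hd e x -> s <= t <= s + tau -> - eps <= w x t) ->
    forall x, enorm (x - (y + tau *: b)) <= r / 2 ->
      c * kap - C * eps <= w x (s + tau)].
Proof.
move=> r0 b00; have [L L0 hL] := V_bounded M.
(* [C1] collects the terms linear in [P]: motion of the centre, Laplacian, and
   [8 |q|^2 = 8 r^2 - 8 P]. The choice of [beta] turns [8 r^2 - C1 P + (beta - L) P^2] into a
   perfect square. *)
pose C1 := 4 * r * b0 + 4 * N%:R + 8.
pose beta := L + C1 ^+ 2 / (32 * r ^+ 2).
have r2 : 0 < r ^+ 2 by rewrite exprn_gt0.
have be0 : 0 <= beta by rewrite addr_ge0 // divr_ge0 ?sqr_ge0 // mulr_ge0 // ltW.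
exists (expR (- beta * 2) / 2), (expR ((L + 1) * 2)); split.
- rewrite divr_gt0 ?expR_gt0 //=.
  have : expR (- beta * 2) <= 1 by apply: exp_le1; lra.
  lra.
- by apply: exp_ge1; lra.
move=> e w y b tau s kap eps lw hb /andP[tau1 tau2] s0 eps0 htube hkap heps x hx.
have hxr : enorm (x - (y + tau *: b)) < r by apply: le_lt_trans hx _; lra.
have [hdx _] : hd e x /\ enorm x <= M by apply: htube hxr; rewrite lexx andbT; lra.
have Csn : 1 <= expR ((L + 1) * 2) :> R by apply: exp_ge1; lra.
(* For [kap <= 0] the assumed bound [- eps <= w] is already stronger than the claim. *)
have [kap0|kap0] := leP kap 0.
  apply: (@le_trans _ _ (- eps)); last by apply: heps => //; rewrite lexx andbT; lra.
  have := expR_gt0 (- beta * 2); have := ler_wpM2r eps0 Csn => h1 h2.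
  have := mulr_ge0_le0 (ltW h2) kap0; lra.
pose k1 := kap / r ^+ 4; have k10 : 0 < k1 by rewrite divr_gt0 // exprn_gt0.
have k1r : k1 * (r ^+ 2) ^+ 2 = kap by rewrite -exprM divfK // gt_eqF // exprn_gt0.
pose P z t := r ^+ 2 - dot (z - y - (t - s) *: b) (z - y - (t - s) *: b).
have Ppos z t : 0 < P z t -> s <= t <= s + tau -> hd e z /\ enorm z <= M.
  move=> Pz /andP[st ts]; apply: (htube (t - s)); first by apply/andP; split; lra.
  have h : enorm (z - (y + (t - s) *: b)) ^+ 2 < r ^+ 2.
    by rewrite sqr_enorm opprD addrA -subr_gt0.
  by move: h; rewrite ltr_pXn2r // nnegrE ?enorm_ge0 // ltW.
have Pr z t : P z t <= r ^+ 2 by rewrite gerBl dot_ge0.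
have main eps1 : eps < eps1 ->
    - (eps1 * expR ((L + 1) * tau)) + k1 * expR (- beta * tau) * pos (P x (s + tau)) ^+ 2
    <= w x (s + tau).
  move=> he; have e10 : 0 < eps1 by exact: le_lt_trans he.
  pose X t := eps1 * expR ((L + 1) * (t - s)).
  pose Y t := k1 * expR (- beta * (t - s)).
  have Y0 t : 0 < Y t by rewrite mulr_gt0 ?expR_gt0.
  have X0 t : s <= t -> eps1 <= X t.
    by move=> st; rewrite ler_peMr ?(ltW e10) // exp_ge1 // mulr_ge0 ?subr_ge0 // addr_ge0.
  pose F z t := - X t + Y t * pos (P z t) ^+ 2.
  have FX z t : P z t <= 0 -> F z t = - X t.
    by move=> Pz; rewrite /F pos_eq0 // expr0n /= mulr0 addr0.
  suff H : F x (s + tau) < w x (s + tau).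
    by move: (ltW H); rewrite /F /X /Y (_ : s + tau - s = tau) //; ring.
  apply: (@lower_comparison R N rad V C0 e w F s (s + tau) lw) => //; last by rewrite lexx andbT; lra.
  - by rewrite s0 /=; lra.
  - rewrite /F /X /Y /=; have cP : continuous (fun q : 'rV[R]_N * R => P q.1 q.2).
      have -> : (fun q : 'rV[R]_N * R => P q.1 q.2) = (fun q : 'rV[R]_N * R =>
        r ^+ 2 - (dot (q.1 - y) (q.1 - y) - 2 * (q.2 - s) * (dot q.1 b - dot y b)
          + (q.2 - s) * (q.2 - s) * dot b b)).
        by apply/funext => q; rewrite /P !dotE (dotC y q.1) (dotC b y) (dotC b q.1); ring.
      have ct : continuous (fun q : 'rV[R]_N * R => q.2 - s).
        by apply: ctsB; [exact: cts_snd|exact: cts_cst].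
      apply: ctsB; first exact: cts_cst.
      apply: ctsD; [apply: ctsB|].
      + have -> : (fun q : 'rV[R]_N * R => dot (q.1 - y) (q.1 - y)) =
          (fun q => dot q.1 q.1 - 2 * dot q.1 y + dot y y).
          by apply/funext => q; rewrite !dotE (dotC y q.1); ring.
        apply: ctsD; last exact: cts_cst.
        apply: ctsB; first by apply: (@cts_fst _ _ (fun z => dot z z)); exact: continuous_sqr_enorm.
        apply: ctsM; first exact: cts_cst.
        by apply: (@cts_fst _ _ (fun z => dot z y)); exact: continuous_dotl.
      + apply: ctsM; first by apply: ctsM => //; exact: cts_cst.
        apply: ctsB; last exact: cts_cst.
        by apply: (@cts_fst _ _ (fun z => dot z b)); exact: continuous_dotl.
      + by apply: ctsM; [exact: ctsM|exact: cts_cst].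
    have cE (a : R) : continuous (fun q : 'rV[R]_N * R => expR (a * (q.2 - s))).
      apply: cts_exp; apply: ctsM; first exact: cts_cst.
      by apply: ctsB; [exact: cts_snd|exact: cts_cst].
    apply: ctsD; first by apply: ctsN; apply: ctsM; [exact: cts_cst|exact: cE].
    apply: ctsM; first by apply: ctsM; [exact: cts_cst|exact: cE].
    by have cp := cts_pos cP; exact: (ctsM cp cp).
  - exists eps1 => //; exists M => z t hz zM /andP[st ts].
    have Pz : P z t <= 0.
      rewrite leNgt; apply/negP => /Ppos; rewrite st ts => /(_ isT) [_].
      by rewrite leNgt zM.
    by rewrite FX // lerN2; exact: X0.
  - move=> z t hz nz stt; have Pz : P z t <= 0.
      by rewrite leNgt; apply/negP => /Ppos /(_ stt) [].
    by rewrite FX // oppr_lt0 /X mulr_gt0 // expR_gt0.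
  - move=> z hz; rewrite /F /X /Y subrr !mulr0 expR0 !mulr1.
    have [Pz|Pz] := leP (P z s) 0.
      rewrite pos_eq0 // expr0n /= mulr0 addr0.
      apply: (@lt_le_trans _ _ (- eps)); first by rewrite ltrN2.
      by apply: heps => //; rewrite lexx /=; lra.
    have kz : kap <= w z s.
      apply: hkap; rewrite -(@ltr_pXn2r _ 2) // ?nnegrE ?enorm_ge0 ?(ltW r0) //.
      by rewrite sqr_enorm -subr_gt0; move: Pz; rewrite /P subrr scale0r subr0.
    apply: lt_le_trans kz; rewrite pos_id ?(ltW Pz) //.
    have : k1 * P z s ^+ 2 <= k1 * (r ^+ 2) ^+ 2.
      by rewrite ler_wpM2l ?(ltW k10) // lerXn2r ?nnegrE ?(ltW Pz) ?(ltW r2).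
    by rewrite k1r; lra.
  - move=> z t hz /andP[st ts] wF; have stt : s <= t <= s + tau by rewrite (ltW st).
    (* Outside the moving ball the barrier is below [- eps], so contact there contradicts [heps]. *)
    have [Pz|Pz] := leP (P z t) 0.
      by have := heps z t hz stt; rewrite wF FX //; have := X0 t (ltW st); lra.
    have [_ zM] := Ppos _ _ Pz stt.
    have [q qE] : {q : 'rV[R]_N | q = z - y - (t - s) *: b} by exists (z - y - (t - s) *: b).
    have PE : P z t = r ^+ 2 - dot q q by rewrite /P qE.
    have qb : dot q b <= r * b0.
      apply: le_trans (dot_le q b) _; apply: ler_pM; rewrite ?enorm_ge0 //.
      by apply: enorm_le; [exact: ltW|move: Pz; rewrite PE; lra].
    have qr : dot q q < r ^+ 2 by move: Pz; rewrite PE subr_gt0.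
    exists (- ((L + 1) * X t) + (- beta * Y t * P z t ^+ 2 + Y t * (4 * P z t * dot q b))),
      (fun i => Y t * (8 * dot q (delta_mx 0 i) ^+ 2 - 4 * P z t)).
    split.
    + pose p t' := P z t + 2 * dot q b * (t' - t) - dot b b * (t' - t) ^+ 2.
      have pE t' : p t' = P z t'.
        rewrite /p PE /P; have -> : z - y - (t' - s) *: b = q - (t' - t) *: b.
          by rewrite qE; apply/rowP => j; rewrite !mxE; ring.
        by rewrite !dotE (dotC b q); ring.
      have ip : is_derive t (1 : R) p (2 * dot q b).
        apply/eps_deriveP => a a0; exists (a / (dot b b + 1)).
          by rewrite divr_gt0 // ltr_wpDl ?dot_ge0.
        have bb := dot_ge0 b.
        move=> h; rewrite ltr_pdivlMr ?ltr_wpDl // => ha.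
        have -> : p (t + h *: 1) - p t - h * (2 * dot q b) = - (dot b b * h * h).
          by rewrite [h *: 1]mulr1 /p; ring.
        rewrite normrN !normrM ler_wpM2r // (ger0_norm bb).
        by have := normr_ge0 h; lra.
      have iX := is_derive_exp eps1 (L + 1) s t.
      have iY := is_derive_exp k1 (- beta) s t.
      have i2 : is_derive t (1 : R) (fun t' => - X t' + Y t' * (p t' * p t'))
        (- ((L + 1) * X t) + (- beta * Y t * P z t ^+ 2 + Y t * (4 * P z t * dot q b))).
        have iN : is_derive t (1 : R) (fun t' => - X t') (- ((L + 1) * X t)).
          by apply: is_deriveN.
        have iM : is_derive t (1 : R) (fun t' => Y t' * (p t' * p t'))
           (- beta * Y t * P z t ^+ 2 + Y t * (4 * P z t * dot q b)).
          have ipp : is_derive t (1 : R) (fun t' => p t' * p t') (P z t * (2 * dot q b) + P z t * (2 * dot q b)).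
            by rewrite -pE; apply: is_deriveM.
          have := @is_deriveM _ _ Y _ t 1 _ _ iY ipp.
          congr is_derive; rewrite !pE /Y.
          change (k1 * expR (- beta * (t - s)) * (P z t * (2 * dot q b) + P z t * (2 * dot q b)) + (P z t * P z t) * (- beta * (k1 * expR (- beta * (t - s)))) = - beta * (k1 * expR (- beta * (t - s))) * P z t ^+ 2 +
  k1 * expR (- beta * (t - s)) * (4 * P z t * dot q b)).
          by ring.
        by apply: is_deriveD.
      apply: tdiff_local (is_derive_tdiff i2).
      have [d d0 hd'] := ball_nbhs b qr; exists d => // h hh.
      have Ph : 0 <= P z (t - h).
        rewrite /P subr_ge0 ltW //.
        have -> : z - y - (t - h - s) *: b = q + h *: b.
          by rewrite qE; apply/rowP => j; rewrite !mxE; ring.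
        exact: hd'.
      by rewrite /F pE pos_id // expr2.
    + move=> i; apply: sec_lower_exact.
      have := dot_delta_delta i : dot _ _ = 1 :> R.
      move: (delta_mx 0 i : 'rV[R]_N) => ei ei1.
      have [d d0 hd'] := ball_nbhs ei qr; exists d => // h /andP[h0 hh].
      have Pe h' : P (z + h' *: ei) t = r ^+ 2 - dot (q + h' *: ei) (q + h' *: ei).
        rewrite /P; have -> // : z + h' *: ei - y - (t - s) *: b = q + h' *: ei.
        by rewrite qE; apply/rowP => j; rewrite !mxE; ring.
      have P1 : 0 <= P (z + h *: ei) t.
        by rewrite Pe subr_ge0 ltW // hd' // gtr0_norm.
      have P2 : 0 <= P (z + (- h) *: ei) t.
        by rewrite Pe subr_ge0 ltW // hd' // normrN gtr0_norm.
      have zz : z - h *: ei = z + (- h) *: ei by rewrite scaleNr.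
      have F1 : F (z + h *: ei) t = - X t + Y t * (P (z + h *: ei) t) ^+ 2 by rewrite /F pos_id.
      have F2 : F (z + (- h) *: ei) t = - X t + Y t * (P (z + (- h) *: ei) t) ^+ 2 by rewrite /F pos_id.
      have F3 : F z t = - X t + Y t * P z t ^+ 2 by rewrite /F pos_id // ltW.
      rewrite /sdiff zz F1 F2 F3 (Pe h) (Pe (- h)) PE.
      rewrite !dotE (dotC ei q) ei1.
      set Q := dot q ei; set A := dot q q.
      have -> : - X t + Y t * (r ^+ 2 - (A + h * Q + (h * Q + h * (h * 1)))) ^+ 2 +
        (- X t + Y t * (r ^+ 2 - (A + - h * Q + (- h * Q + - h * (- h * 1)))) ^+ 2) -
        2 * (- X t + Y t * (r ^+ 2 - A) ^+ 2)
        = Y t * (8 * Q ^+ 2 - 4 * (r ^+ 2 - A)) * h ^+ 2 + Y t * (2 * (h ^+ 2) ^+ 2).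
        by ring.
      by rewrite lerDl mulr_ge0 ?(ltW (Y0 t)) // mulr_ge0 // sqr_ge0.
    + rewrite -mulr_sumr sumrB -mulr_sumr sumr_const card_ord.
      have -> : \sum_(i < N) dot q (delta_mx 0 i) ^+ 2 = dot q q.
        by rewrite -sum_delta_dot_sqr; apply: eq_bigr => i _; rewrite dotC.
      rewrite /F pos_id ?(ltW Pz) //.
      change (- ((L + 1) * X t) + (- beta * Y t * P z t ^+ 2 + Y t * (4 * P z t * dot q b)) -
        Y t * (8 * dot q q - 4 * P z t *+ N) <
        - V (enorm z) * (- X t + Y t * P z t ^+ 2) - C0 * `|- X t + Y t * P z t ^+ 2|).
      have hVz := hL (enorm z); rewrite enorm_ge0 zM in hVz; have {hVz} := hVz isT.
      have Xp : 0 < X t by exact: lt_le_trans (X0 t (ltW st)).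
      have Yp : 0 <= Y t * P z t ^+ 2 by rewrite mulr_ge0 ?sqr_ge0 // ltW.
      set F0 := - X t + Y t * P z t ^+ 2.
      have FF : `|F0| <= X t + Y t * P z t ^+ 2.
        by apply: le_trans (ler_normD _ _) _; rewrite normrN (gtr0_norm Xp) (ger0_norm Yp).
      move=> hVz.
      have : - (L * (X t + Y t * P z t ^+ 2)) <= - V (enorm z) * F0 - C0 * `|F0|.
        have h1 : V (enorm z) * F0 <= `|V (enorm z)| * `|F0| by rewrite -normrM ler_norm.
        have h2 := ler_wpM2l L0 FF; have h3 := ler_wpM2r (normr_ge0 F0) hVz; lra.
      apply: lt_le_trans.
      rewrite -subr_gt0.
      have -> : - (L * (X t + Y t * P z t ^+ 2)) -
        (- ((L + 1) * X t) + (- beta * Y t * P z t ^+ 2 + Y t * (4 * P z t * dot q b)) -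
         Y t * (8 * dot q q - 4 * P z t *+ N)) =
        X t + Y t * (8 * dot q q - 4 * P z t * N%:R - 4 * P z t * dot q b + (beta - L) * P z t ^+ 2).
        by rewrite -(mulr_natr (4 * P z t)); ring.
      have -> : dot q q = r ^+ 2 - P z t by rewrite PE; ring.
      apply: ltr_wpDr => //; apply: mulr_ge0; first exact: ltW.
      have -> : beta - L = C1 ^+ 2 / (32 * r ^+ 2) by rewrite /beta; ring.
      have h1 : P z t * dot q b <= P z t * (r * b0) by rewrite ler_wpM2l // ltW.
      have : 0 <= 8 * (r ^+ 2 - C1 * P z t / 16) ^+ 2 / r ^+ 2 by rewrite divr_ge0 ?(ltW r2) // mulr_ge0 ?sqr_ge0.
      have -> : 8 * (r ^+ 2 - C1 * P z t / 16) ^+ 2 / r ^+ 2 =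
        8 * r ^+ 2 - C1 * P z t + C1 ^+ 2 / (32 * r ^+ 2) * P z t ^+ 2.
        by field; rewrite gt_eqF.
      by rewrite {1}/C1; lra.
(* In the concentric half ball [P ^+ 2] is at least [9/16] of [r ^+ 4], hence at least half of it:
   the origin of the factor [1/2] in [c]. *)
have cP : 3 / 4 * r ^+ 2 <= P x (s + tau).
  rewrite /P (_ : s + tau - s = tau); last by ring.
  have : dot (x - y - tau *: b) (x - y - tau *: b) <= (r / 2) ^+ 2.
    rewrite -sqr_enorm lerXn2r ?nnegrE ?enorm_ge0 ?divr_ge0 ?(ltW r0) //.
    by move: hx; rewrite opprD addrA.
  by rewrite expr_div_n; lra.
have P0 : 0 <= P x (s + tau) by apply: le_trans cP; rewrite mulr_ge0 // ltW.
have kP : kap / 2 <= k1 * P x (s + tau) ^+ 2.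
  have : k1 * (3 / 4 * r ^+ 2) ^+ 2 <= k1 * P x (s + tau) ^+ 2.
    by rewrite ler_wpM2l ?(ltW k10) // lerXn2r ?nnegrE // mulr_ge0 // ltW.
  by rewrite exprMn mulrCA k1r; lra.
have kE : expR (- beta * 2) / 2 * kap <= k1 * expR (- beta * tau) * pos (P x (s + tau)) ^+ 2.
  rewrite pos_id //.
  have : expR (- beta * 2) <= expR (- beta * tau) by rewrite ler_expR; nra.
  have := expR_gt0 (- beta * 2); move=> h1 h2.
  have := ler_pM (ltW h1) (divr_ge0 (ltW kap0) (ler0n _ 2)) h2 kP; lra.
have Et : expR ((L + 1) * tau) <= expR ((L + 1) * 2).
  by rewrite ler_expR ler_wpM2l // addr_ge0.
apply/ler_addgt0Pr => a a0.
have h := main (eps + a / expR ((L + 1) * 2)); have h' := expR_gt0 ((L + 1) * 2).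
have := h; rewrite ltrDl divr_gt0 // => /(_ isT).
have : (eps + a / expR ((L + 1) * 2)) * expR ((L + 1) * tau) <=
   (eps + a / expR ((L + 1) * 2)) * expR ((L + 1) * 2).
  by rewrite ler_wpM2l // addr_ge0 // divr_ge0 // ltW.
rewrite [X in _ <= X]mulrDl divfK ?gt_eqF //.
lra.
Qed.

End Spreading.

(** * Spreading along chains and the eigenfunction barrier *)

Section FarSpreading.
Context {R : realType} {N : nat} (rad : R).
Hypothesis rad0 : 0 <= rad.
Variables (V : R -> R) (C0 Lam : R).
Hypothesis C00 : 0 <= C0.
Hypothesis Lam0 : 0 <= Lam.
Hypothesis V_lower : forall r, rad <= r -> C0 - V r <= Lam.
Hypothesis V_bounded : forall M, exists2 L : R, 0 <= L &
  forall r, 0 <= r <= M -> `|V r| + C0 <= L.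
Implicit Types (x y z e : 'rV[R]_N).

Notation hd e := (half_domain (Sigma N rad) e).
Notation lsol := (linsol rad V C0).

Lemma cts_lipschitz (f : 'rV[R]_N -> 'rV[R]_N) (c : R) : 0 < c ->
  (forall x y, enorm (f x - f y) <= c * enorm (x - y)) -> continuous f.
Proof.
move=> c0 hf x P /nbhs_enormP [d d0 hd]; apply/nbhs_enormP.
exists (d / c); first exact: divr_gt0.
move=> y yx; apply: hd; apply: le_lt_trans (hf _ _) _.
by rewrite mulrC -ltr_pdivlMr.
Qed.

Lemma within_comp {T U W : topologicalType} (A : set T) (B : set U)
    (f : T -> U) (g : U -> W) :
  continuous f -> (forall q : T, A q -> B (f q)) -> {within B, continuous g} ->
  {within A, continuous (g \o f)}.
Proof.
move=> cf AB /subspace_continuousP cg; apply/subspace_continuousP => x Ax P hP.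
have h : nbhs (f x) [set y | B y -> P (g y)] by exact: (cg (f x) (AB x Ax) P hP).
have h2 : nbhs x [set z | B (f z) -> P (g (f z))] by exact: cf x _ h.
change (nbhs x [set z | A z -> P (g (f z))]).
by apply: filterS h2 => z hz Az; exact: hz (AB z Az).
Qed.

Lemma half_domain_tube (d R1 r : R) e p z : dot e e = 1 ->
  r <= d / 2 -> r <= R1 - rad -> 0 < d -> d <= dot p e -> R1 <= enorm p ->
  enorm (z - p) < r -> hd e z.
Proof.
move=> e1 rd rR d0 pe pR zp; have ee : enorm e = 1 by rewrite /enorm e1 sqrtr1.
split.
  apply/SigmaP; right; have := enorm_dist z p; rewrite ler_norml => /andP[h _].
  by clear - rad0 V_lower V_bounded C00 Lam0 h rR pR zp; lra.
have := cauchy_schwarz (z - p) e; rewrite dotDl dotNl ee mulr1 ler_norml => /andP[h _].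
by clear - rad0 V_lower V_bounded C00 Lam0 h rd pe zp d0; lra.
Qed.

Lemma shift_away (d R1 r1 th : R) e p : dot e e = 1 -> 0 <= d ->
  d <= dot p e -> R1 <= enorm p -> enorm p <= r1 -> 0 <= th <= R1 ->
  [/\ d <= dot (p + th *: e) e, R1 <= enorm (p + th *: e) & enorm (p + th *: e) <= r1 + R1].
Proof.
move=> e1 d0 pe pR pr /andP[th0 thR]; have ee : enorm e = 1 by rewrite /enorm e1 sqrtr1.
split.
- by rewrite !dotE e1 mulr1 (le_trans pe) // lerDl.
- apply: le_trans pR _; apply: enorm_le; first exact: enorm_ge0.
  rewrite sqr_enorm !dotE (dotC e p) e1.
  have h1 : 0 <= th * dot p e by apply: mulr_ge0 => //; exact: le_trans pe.
  by have h2 := mulr_ge0 th0 th0; clear - rad0 V_lower V_bounded C00 Lam0 h1 h2; lra.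
- by apply: le_trans (enormD _ _) _; rewrite enormZ ee mulr1 ger0_norm // lerD.
Qed.

(** The reason for the detour: the segment from [x] to [y] may meet the removed ball, but after the
    shift by [L] along [e] it lies in a half space, where the product with [e] bounds the norm from
    below. *)
Lemma convex_bounds (d r1 L th : R) e x y : dot e e = 1 -> 0 <= th <= 1 ->
  d <= dot x e -> d <= dot y e -> enorm x <= r1 -> enorm y <= r1 -> 0 <= L ->
  d + L <= dot (x + L *: e + th *: (y - x)) e /\
  enorm (x + L *: e + th *: (y - x)) <= r1 + L.
Proof.
move=> e1 /andP[th0 th1] xe ye xr yr L0; have ee : enorm e = 1 by rewrite /enorm e1 sqrtr1.
have a1 : 0 <= 1 - th by rewrite subr_ge0.
split.
  have -> : dot (x + L *: e + th *: (y - x)) e = (1 - th) * dot x e + th * dot y e + L.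
    by rewrite !dotE e1; ring.
  have h1 := ler_wpM2l th0 ye; have h2 := ler_wpM2l a1 xe; clear - rad0 V_lower V_bounded C00 Lam0 h1 h2; lra.
have -> : x + L *: e + th *: (y - x) = ((1 - th) *: x + th *: y) + L *: e.
  by apply/rowP => j; rewrite !mxE; ring.
apply: le_trans (enormD _ _) _; apply: lerD; last by rewrite enormZ ee mulr1 ger0_norm.
apply: le_trans (enormD _ _) _; rewrite !enormZ (ger0_norm th0) (ger0_norm a1).
have h1 := ler_wpM2l th0 yr; have h2 := ler_wpM2l a1 xr; clear - rad0 V_lower V_bounded C00 Lam0 h1 h2; lra.
Qed.

(* Two points away from the boundary are joined by a chain x, x + L e,
   y + L e, y of segments that stays away from the boundary. *)
Lemma spread_far (d R1 r1 r0 : R) : 0 < d -> rad < R1 -> 0 < r0 ->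
  exists r c C : R, [/\ 0 < r <= r0, 0 < c <= 1, 1 <= C &
  forall e w x y (s tau kap eps : R), lsol e w ->
    [/\ d <= dot x e, R1 <= enorm x & enorm x <= r1] ->
    [/\ d <= dot y e, R1 <= enorm y & enorm y <= r1] ->
    0 <= s -> 1 <= tau <= 2 -> 0 <= eps ->
    (forall z, enorm (z - x) < r -> kap <= w z s) ->
    (forall z t, hd e z -> s <= t <= s + 3 * tau -> - eps <= w z t) ->
    c * kap - C * eps <= w y (s + 3 * tau)].
Proof.
move=> d0 R1r r00; have R10 : 0 < R1 by exact: le_lt_trans R1r.
pose r := Num.min r0 (Num.min (d / 2) (R1 - rad)).
have rp : 0 < r by rewrite !lt_min r00 divr_gt0 //= subr_gt0.
have [rr0 rd rR] : [/\ r <= r0, r <= d / 2 & r <= R1 - rad].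
  by split; rewrite /r !ge_min lexx ?orbT.
pose M := `|r1| + R1 + r; pose b0 := R1 + 2 * `|r1|.
have b00 : 0 <= b0 by rewrite addr_ge0 ?mulr_ge0 // ltW.
(* Each leg returns positivity on a ball of half the radius, so the three legs start with [r],
   [r / 2] and [r / 4]. *)
have [c1 [C1 [/andP[c10 c11] C11 H1]]] := @spread R N rad V C0 V_bounded _ M _ rp b00.
have [c2 [C2 [/andP[c20 c21] C21 H2]]] := @spread R N rad V C0 V_bounded _ M _ (divr_gt0 rp (ltr0n _ 2)) b00.
have [c3 [C3 [/andP[c30 c31] C31 H3]]] := @spread R N rad V C0 V_bounded _ M _ (divr_gt0 (divr_gt0 rp (ltr0n _ 2)) (ltr0n _ 2)) b00.
exists r, (c3 * (c2 * c1)), (C1 + C2 + C3); split.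
- by rewrite rp.
- by rewrite !mulr_gt0 //= mulr_ile1 ?mulr_ile1 ?mulr_ge0 // ltW.
- by clear - rad0 V_lower V_bounded C00 Lam0 C11 C21 C31; lra.
move=> e w x y s tau kap eps lw [xe xR xr1] [ye yR yr1] s0 /andP[tau1 tau2] eps0 hk hw.
have e1 := ls_unit lw; have ee : enorm e = 1 by rewrite /enorm e1 sqrtr1.
have xr1' : enorm x <= `|r1| := le_trans xr1 (ler_norm r1).
have yr1' : enorm y <= `|r1| := le_trans yr1 (ler_norm r1).
have t0 : 0 < tau by clear - rad0 V_lower V_bounded C00 Lam0 tau1; lra.
have tube p z : d <= dot p e -> R1 <= enorm p -> enorm p <= `|r1| + R1 ->
    enorm (z - p) < r -> hd e z /\ enorm z <= M.
  move=> pe pR pM zp; split; first exact: (half_domain_tube e1 rd rR d0 pe pR zp).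
  by have := enormD (z - p) p; rewrite subrK /M; clear - rad0 V_lower V_bounded C00 Lam0 pM zp; lra.
have up p th := @shift_away d R1 `|r1| th e p e1 (ltW d0).
have eps_ind s1 : s <= s1 -> s1 + tau <= s + 3 * tau ->
    forall z t, hd e z -> s1 <= t <= s1 + tau -> - eps <= w z t.
  by move=> h1 h2 z t hz /andP[t1 t2]; apply: hw => //; clear - rad0 V_lower V_bounded C00 Lam0 h1 h2 t1 t2; apply/andP; split; lra.
have tt : 1 <= tau <= 2 by rewrite tau1.
have be : enorm ((R1 / tau) *: e) <= b0.
  rewrite enormZ ee mulr1 ger0_norm ?divr_ge0 ?(ltW R10) ?(ltW t0) //.
  move=> {H1 H2 H3}; have h1 : R1 / tau <= R1 by rewrite ler_pdivrMr // ler_peMr // ltW.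
  have h2 := normr_ge0 r1; apply: le_trans h1 _; rewrite /b0 lerDl mulr_ge0 //.
have step1 : forall z, enorm (z - (x + R1 *: e)) <= r / 2 -> c1 * kap - C1 * eps <= w z (s + tau).
  have -> : x + R1 *: e = x + tau *: ((R1 / tau) *: e).
    by rewrite scalerA mulrC divfK // gt_eqF.
  apply: (H1 e w x _ tau s kap eps lw be tt s0 eps0 _ hk).
    move=> th z /andP[th0 tht]; rewrite scalerA.
    have hth : 0 <= th * (R1 / tau) <= R1.
      rewrite mulr_ge0 ?divr_ge0 ?(ltW R10) ?(ltW t0) //=.
      by rewrite mulrCA ger_pMr // ler_pdivrMr // mul1r.
    by have [h1 h2 h3] := up x _ xe xR xr1' hth; exact: tube.
  by apply: eps_ind; clear - rad0 V_lower V_bounded C00 Lam0 t0; lra.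
have step2 : forall z, enorm (z - (y + R1 *: e)) <= r / 2 / 2 ->
    c2 * (c1 * kap - C1 * eps) - C2 * eps <= w z (s + tau + tau).
  have -> : y + R1 *: e = x + R1 *: e + tau *: (tau^-1 *: (y - x)).
    by rewrite scalerA mulfV ?gt_eqF // scale1r; apply/rowP => j; rewrite !mxE; ring.
  apply: (H2 e w (x + R1 *: e) _ tau (s + tau) _ eps lw _ tt _ eps0 _ _).
  - rewrite enormZ ger0_norm ?invr_ge0 ?(ltW t0) //.
    apply: (@le_trans _ _ (enorm (y - x))).
      by rewrite ler_piMl ?enorm_ge0 // invf_le1.
    by apply: le_trans (enormD _ _) _; rewrite enormN /b0; clear - rad0 V_lower V_bounded C00 Lam0 xr1' yr1' R10; lra.
  - by clear - rad0 V_lower V_bounded C00 Lam0 s0 t0; lra.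
  - move=> th z /andP[th0 tht] hz; apply: tube (lt_le_trans hz _).
    + have hth : 0 <= th / tau <= 1 by rewrite divr_ge0 ?(ltW t0) //= ler_pdivrMr // mul1r.
      have [h1 _] := convex_bounds e1 hth xe ye xr1' yr1' (ltW R10).
      by rewrite scalerA; apply: le_trans h1; rewrite lerDl ltW.
    + have hth : 0 <= th / tau <= 1 by rewrite divr_ge0 ?(ltW t0) //= ler_pdivrMr // mul1r.
      have [h1 _] := convex_bounds e1 hth xe ye xr1' yr1' (ltW R10).
      rewrite scalerA; have h2 := dot_le (x + R1 *: e + (th / tau) *: (y - x)) e.
      by rewrite ee mulr1 in h2; apply: le_trans h2; apply: le_trans h1; rewrite lerDr ltW.
    + have hth : 0 <= th / tau <= 1 by rewrite divr_ge0 ?(ltW t0) //= ler_pdivrMr // mul1r.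
      by rewrite scalerA; have [_] := convex_bounds e1 hth xe ye xr1' yr1' (ltW R10).
    + by clear - rad0 V_lower V_bounded C00 Lam0 rp; lra.
  - by move=> z hz; apply: step1; exact: ltW.
  - by apply: eps_ind; clear - rad0 V_lower V_bounded C00 Lam0 t0; lra.
have step3 : c3 * (c2 * (c1 * kap - C1 * eps) - C2 * eps) - C3 * eps <= w y (s + tau + tau + tau).
  apply: (H3 e w (y + R1 *: e) (- (R1 / tau) *: e) tau (s + tau + tau) _ eps lw _ tt _ eps0 _ _).
  - by rewrite scaleNr enormN.
  - by clear - rad0 V_lower V_bounded C00 Lam0 s0 t0; lra.
  - move=> th z /andP[th0 tht] hz.
    have hth : 0 <= R1 - th * (R1 / tau) <= R1.
      have h1 : 0 <= th * (R1 / tau) by rewrite mulr_ge0 ?divr_ge0 ?(ltW R10) ?(ltW t0).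
      have h2 : th * (R1 / tau) <= R1 by rewrite mulrCA ger_pMr // ler_pdivrMr // mul1r.
      by clear - rad0 V_lower V_bounded C00 Lam0 h1 h2; apply/andP; split; lra.
    have [h1 h2 h3] := up y _ ye yR yr1' hth.
    apply: tube h1 h2 h3 _; apply: lt_le_trans (_ : r / 2 / 2 <= r); last by clear - rad0 V_lower V_bounded C00 Lam0 rp; lra.
    move: hz; congr (enorm _ < _); apply/rowP => j; rewrite !mxE; ring.
  - by move=> z hz; apply: step2; exact: ltW.
  - by apply: eps_ind; clear - rad0 V_lower V_bounded C00 Lam0 t0; lra.
  - have -> : y - (y + R1 *: e + tau *: (- (R1 / tau) *: e)) = 0.
      by apply/rowP => j; rewrite !mxE; field; rewrite gt_eqF.
    by rewrite enorm0 !divr_ge0 // ltW.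
move: step3; rewrite (_ : s + tau + tau + tau = s + 3 * tau); last by ring.
apply: le_trans.
have C1e : 0 <= C1 * eps by rewrite mulr_ge0 // (le_trans ler01).
have C2e : 0 <= C2 * eps by rewrite mulr_ge0 // (le_trans ler01).
have h1 : c3 * (c2 * (C1 * eps)) <= C1 * eps.
  rewrite mulrA ler_piMl // mulr_ile1 // ltW //.
have h2 : c3 * (C2 * eps) <= C2 * eps by rewrite ler_piMl.
clear - rad0 V_lower V_bounded C00 Lam0 h1 h2; lra.
Qed.

Lemma closure_uball x : enorm x <= 1 -> closure (uball R N) x.
Proof.
move=> x1 B /nbhs_enormP [d d0 hd].
pose a := Num.min (1 / 2) (d / 2).
have a0 : 0 < a by rewrite lt_min !divr_gt0.
have ad : a < d by apply: (@le_lt_trans _ _ (d / 2)); [rewrite ge_min lexx orbT|lra].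
have a1 : a <= 1 / 2 by rewrite ge_min lexx.
exists ((1 - a) *: x); split.
  rewrite /uball /= enormZ ger0_norm; last by lra.
  have := enorm_ge0 x; have : (1 - a) * enorm x <= (1 - a) * 1 by rewrite ler_wpM2l //; lra.
  lra.
apply: hd; have -> : (1 - a) *: x - x = - (a *: x) by apply/rowP => j; rewrite !mxE; ring.
rewrite enormN enormZ gtr0_norm //; apply: le_lt_trans ad.
by rewrite ler_piMr // ltW.
Qed.

Lemma bdry_uball x : enorm x = 1 -> bdry (uball R N) x.
Proof.
by move=> x1; split; [apply: closure_uball; rewrite x1|rewrite /uball /= x1 ltxx].
Qed.

Lemma open_uball : open (uball R N).
Proof.
rewrite openE => x /= x1; rewrite /interior; apply/nbhs_enormP.
exists (1 - enorm x); first by rewrite subr_gt0.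
by move=> y yx; rewrite /uball /=; have := enormD (y - x) x; rewrite subrK; lra.
Qed.

Lemma compact_eball y (a : R) : compact [set x | enorm (x - y) <= a].
Proof.
apply: (@ebounded_closed_compact _ _ _ (a + enorm y)).
  by move=> x /= xa; have := enormD (x - y) y; rewrite subrK; lra.
apply: (@closed_comp _ _ (fun x => enorm (x - y)) [set r | r <= a]); last exact: closed_le.
move=> x _; apply: (@continuous_comp _ _ _ (fun x => x - y) (@enorm R N)); last exact: continuous_enorm.
apply: (@cts_lipschitz (fun x => x - y) 1) => // u v.
by rewrite mul1r opprB addrA subrK.
Qed.

Lemma hess_sec_lower (phi : 'rV[R]_N -> R) x (H : 'M[R]_N) i :
  hess phi x H -> sec_lower phi x (delta_mx 0 i) (H i i).
Proof.
move=> hH eps eps0; have [d d0 hd] := hH (delta_mx 0 i) eps eps0.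
exists d => // s sd; have := hd s sd.
have -> : ((delta_mx 0 i : 'rV[R]_N) *m H *m (delta_mx 0 i : 'rV[R]_N)^T) 0 0 = H i i.
  by rewrite trmx_delta -rowE -colE !mxE.
by rewrite ler_norml => /andP[h _]; lra.
Qed.

(** At an interior maximum of the eigenfunction its Laplacian is nonpositive. Viewed as a stationary
    function, the eigenfunction falls under [heat_touch]. The sign ensures [gam > 0] in
    [potential_gap]. *)
Lemma principal_eigenvalue_ge0 (lam : R) : principal_eigenvalue_ball N lam -> 0 <= lam.
Proof.
move=> [phi [hC2 hcont hpos hbd heig]].
pose K : set 'rV[R]_N := [set x | enorm (x - 0) <= 1].
have KE x : K x <-> enorm x <= 1 by rewrite /K /= subr0.
have cphi : {within K, continuous phi}.
  by apply: continuous_subspaceW hcont => x /KE; exact: closure_uball.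
have K0 : K !=set0 by exists 0; apply/KE; rewrite enorm0 ler01.
have [x0 /set_mem Kx0 hmax] := compact_EVT_max K0 (@compact_eball 0 1) cphi.
have u0 : uball R N 0 by rewrite /uball /= enorm0.
have p0 : 0 < phi x0.
  by apply: lt_le_trans (hpos 0 u0) (hmax 0 _); apply/mem_set/KE; rewrite enorm0 ler01.
have x01 : uball R N x0.
  rewrite /uball /= lt_neqAle; move/KE: (Kx0) => ->; rewrite andbT.
  by apply/eqP => /bdry_uball /hbd h; move: p0; rewrite h ltxx.
have hH := C2_hess open_uball x01 hC2.
have hv : heat (fun x _ => phi x) x0 0 (0 - laplacian phi x0).
  exists 0, (\matrix_(i, j) partial j (partial i phi) x0); split => //.
    by move=> eps eps0; exists 1 => // s /andP[s0 _]; rewrite subrr mul0r addr0 normr0 mulr_ge0 ?ltW.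
  by congr (_ - _); apply: eq_bigr => i _; rewrite mxE.
have hv0 : heat (fun (x : 'rV[R]_N) (_ : R) => 0 : R) x0 0 0.
  exists 0, 0; rewrite mxtrace0 subr0; split => //.
    by move=> eps eps0; exists 1 => // s /andP[s0 _]; rewrite subrr mul0r addr0 normr0 mulr_ge0 ?ltW.
  move=> y eps eps0; exists 1 => // s _.
  by rewrite /sdiff mulmx0 mul0mx mxE !mulr0 !subr0 addr0 normr0 mulr_ge0 ?sqr_ge0 ?ltW.
have := heat_sub hv0 hv; set k := (X in heat _ _ _ X) => hk.
have [d d0 hd] : exists2 d : R, 0 < d & forall y, enorm (y - x0) < d -> K y.
  exists (1 - enorm x0); first by rewrite subr_gt0.
  by move=> y yx; apply/KE; have := enormD (y - x0) x0; rewrite subrK; lra.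
have : k <= 0 - \sum_(i < N) 0.
  apply: (heat_touch (F := fun=> - phi x0) hk).
  - by move=> eps eps0; exists 1 => // s /andP[s0 _]; rewrite subrr mul0r addr0 normr0 mulr_ge0 ?ltW.
  - by exists 1 => // s _; rewrite sub0r.
  - by rewrite sub0r.
  - move=> i; apply: sec_lower_exact; exists d => // s /andP[s0 sd].
    have es : enorm (s *: (delta_mx 0 i : 'rV[R]_N)) < d.
      by rewrite enormZ /enorm dot_delta_delta sqrtr1 mulr1 gtr0_norm.
    have K1 : x0 + s *: delta_mx 0 i \in K by apply/mem_set/hd; rewrite addrAC subrr add0r.
    have K2 : x0 - s *: delta_mx 0 i \in K.
      by apply/mem_set/hd; rewrite addrAC subrr add0r enormN.
    by have := hmax _ K1; have := hmax _ K2; rewrite /sdiff mul0r; lra.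
rewrite big1 // /k => h; have := heig x0 x01 => hl.
have : 0 <= lam * phi x0 by rewrite -hl; lra.
by rewrite pmulr_lge0.
Qed.

(** The barrier is the eigenfunction rescaled to the ball of radius [(b - a) / 2] about
    [((a + b) / 2) *: e], times an exponential. The scaling turns [lam] into
    [4 * lam / (b - a) ^+ 2], the constant in the condition on [V]; the ball lies in the annulus
    because its centre has norm [(a + b) / 2]. *)
Lemma eigen_lower (lam a b gam : R) : rad < a -> a < b ->
  principal_eigenvalue_ball N lam ->
  (forall r, a <= r <= b -> `|V r| + C0 + 4 * (lam / (b - a) ^+ 2) < gam) ->
  exists2 c : R, 0 < c <= 1 &
  forall e w (s t1 kap : R), lsol e w -> 0 < s <= t1 -> 0 < kap ->
    (forall x, enorm (x - ((a + b) / 2) *: e) <= (b - a) / 2 -> kap <= w x s) ->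
    (forall x t, enorm (x - ((a + b) / 2) *: e) <= (b - a) / 2 -> s <= t <= t1 -> 0 < w x t) ->
    forall x t, enorm (x - ((a + b) / 2) *: e) <= (b - a) / 4 -> s <= t <= t1 ->
      c * kap * expR (- gam * (t - s)) <= w x t.
Proof.
move=> ra ab [phi [hC2 hcont hpos hbd heig]] hgam.
pose m := (a + b) / 2; pose l := (b - a) / 2.
have l0 : 0 < l by rewrite divr_gt0 // subr_gt0.
pose K : set 'rV[R]_N := [set x | enorm (x - 0) <= 1].
have KE x : K x <-> enorm x <= 1 by rewrite /K /= subr0.
have cphi : {within K, continuous phi}.
  by apply: continuous_subspaceW hcont => x /KE; exact: closure_uball.
have K0 : K 0 by apply/KE; rewrite enorm0 ler01.
have [xM /set_mem KxM hmax] := compact_EVT_max (ex_intro _ _ K0) (@compact_eball 0 1) cphi.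
pose K2 : set 'rV[R]_N := [set x | enorm (x - 0) <= 1 / 2].
have K2K : K2 `<=` K by move=> x; rewrite /K2 /K /=; lra.
have K20 : K2 0 by rewrite /K2 /= subr0 enorm0; lra.
have [xm /set_mem Kxm hmin] := compact_EVT_min (ex_intro _ _ K20) (@compact_eball 0 (1 / 2))
  (continuous_subspaceW K2K cphi).
have pm : 0 < phi xm.
  by apply: hpos; move: Kxm; rewrite /K2 /uball /= subr0; lra.
have mM : phi xm <= phi xM by apply: hmax; apply/mem_set/K2K.
have pM : 0 < phi xM by exact: lt_le_trans mM.
(* Minimum on the half ball over maximum on the ball; the factor [1/2] makes the initial inequality
   strict. *)
exists (phi xm / phi xM / 2).
  rewrite !divr_gt0 //=; have : phi xm / phi xM <= 1 by rewrite ler_pdivrMr // mul1r.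
  lra.
move=> e w s t1 kap lw /andP[s0 st1] kap0 hk hw.
have e1 := ls_unit lw; have ee : enorm e = 1 by rewrite /enorm e1 sqrtr1.
pose T z := l^-1 *: (z - m *: e).
have TD z y : T (z + y) = T z + y *m (l^-1)%:M.
  by rewrite mul_mx_scalar /T -scalerDr; congr (_ *: _); apply/rowP => j; rewrite !mxE; ring.
have nT z : enorm (T z) = enorm (z - m *: e) / l.
  by rewrite /T enormZ gtr0_norm ?invr_gt0 // mulrC.
have cT : continuous T.
  apply: (@cts_lipschitz _ l^-1); first by rewrite invr_gt0.
  move=> u v; rewrite (_ : T u - T v = l^-1 *: (u - v)); last first.
    by apply/rowP => j; rewrite !mxE; ring.
  by rewrite enormZ gtr0_norm ?invr_gt0.
pose B := [set z | enorm (z - m *: e) <= l].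
have BT z : B z -> K (T z).
  by move=> Bz; apply/KE; rewrite nT ler_pdivrMr // mul1r.
pose A := kap / (2 * phi xM); have A0 : 0 < A by rewrite divr_gt0 // mulr_gt0.
pose F z t := A * phi (T z) * expR (- gam * (t - s)).
have main : forall z t, B z -> s <= t <= t1 -> F z t < w z t.
  have Brange z : B z -> a <= enorm z <= b.
    move=> Bz; have := enorm_dist z (m *: e).
    have m0 : 0 < m by rewrite divr_gt0 //; have := rad0; lra.
    rewrite [enorm (m *: e)]enormZ ee mulr1 (gtr0_norm m0) ler_norml => /andP[h1 h2].
    by move: Bz; rewrite /B /= /l /m in h1 h2 *; move=> Bz; apply/andP; split; lra.
  have Bhd z : B z -> hd e z.
    move=> Bz; split.
      by apply/SigmaP; right; case/andP: (Brange z Bz) => h _; lra.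
    have := cauchy_schwarz (z - m *: e) e.
    rewrite !dotE e1 ee mulr1 ler_norml => /andP[h _]; have r0 := rad0.
    by move: Bz; rewrite /B /= /l /m in h *; lra.
  apply: (@parabolic_comparison R N B s t1 w F) => //.
  - exact: compact_eball.
  - have -> : (fun y : 'rV[R]_N * R => w y.1 y.2 - F y.1 y.2) =
      (fun y : 'rV[R]_N * R => w y.1 y.2) - (fun y : 'rV[R]_N * R => F y.1 y.2) by [].
    apply: within_continuousB.
      apply: continuous_subspaceW (ls_cont lw) => -[y t] [/= By]; rewrite in_itv /= => /andP[Ts _].
      split => /=; first exact: half_domain_closed (Bhd y By).
      by rewrite in_itv /= andbT; lra.
    have c1 : {within B `*` `[s, t1], continuous (fun q : 'rV[R]_N * R => phi (T q.1))}.
      apply: (@within_comp _ _ _ _ K (fun q : 'rV[R]_N * R => T q.1) phi) => //.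
        by move=> q; apply: (@continuous_comp _ _ _ fst T); [exact: cvg_fst|exact: cT].
      by move=> q [Bq _]; exact: BT.
    have c2 : {within B `*` `[s, t1], continuous (fun q : 'rV[R]_N * R => expR (- gam * (q.2 - s)))}.
      apply: continuous_subspaceT; apply: cts_exp; apply: ctsM; first exact: cts_cst.
      by apply: ctsB; [exact: cts_snd|exact: cts_cst].
    have c3 : {within B `*` `[s, t1], continuous (fun q : 'rV[R]_N * R => A)}.
      by apply: continuous_subspaceT; exact: cts_cst.
    exact: (ctsM (ctsM c3 c1) c2).
  - move=> z Bz; apply: lt_le_trans (hk z Bz).
    rewrite /F subrr mulr0 expR0 mulr1 /A.
    have : phi (T z) <= phi xM by apply: hmax; apply/mem_set/BT.
    move=> h; rewrite mulrAC ltr_pdivrMr ?mulr_gt0 // ltr_pM2l //; lra.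
  - move=> z t Bz /andP[st tt1] wF.
    have ht : s <= t <= t1 by rewrite (ltW st).
    have wp := hw z t Bz ht.
    have t0 : 0 < t by exact: lt_trans st.
    (* On the sphere the barrier vanishes while [w] is positive, so contact is interior. *)
    have zl : enorm (z - m *: e) < l.
      rewrite lt_neqAle; have := Bz; rewrite /B /= => ->; rewrite andbT; apply/eqP => zl.
      have /bdry_uball /hbd h : enorm (T z) = 1 by rewrite nT zl divff // gt_eqF.
      by move: wp; rewrite wF /F h mulr0 mul0r ltxx.
    have uT : uball R N (T z) by rewrite /uball /= nT ltr_pdivrMr // mul1r.
    have [k hk1 hk2] := ls_eq lw (Bhd z Bz) t0.
    have hH := C2_hess open_uball uT hC2.
    pose E := expR (- gam * (t - s)).
    have hH2 := hess_scale (A * E) (hess_comp TD hH).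
    set H := \matrix_(i, j) _ in hH hH2.
    exists k, (- gam * F z t), (fun i => ((A * E) *: ((l^-1)%:M *m H *m ((l^-1)%:M)^T)) i i).
    split => //.
    + exists (l - enorm (z - m *: e)); first by rewrite subr_gt0.
      move=> y yz; rewrite /B /=; have := enormD (y - z) (z - m *: e).
      by rewrite addrA subrK; lra.
    + exact: is_derive_tdiff (is_derive_exp _ _ _ _).
    + move=> i; have := hess_sec_lower i hH2; congr sec_lower.
      by apply/funext => y; rewrite /F /E /=; ring.
    + have -> : \sum_i ((A * E) *: ((l^-1)%:M *m H *m ((l^-1)%:M)^T)) i i =
         - (lam / l ^+ 2) * F z t.
        have -> : \sum_i ((A * E) *: ((l^-1)%:M *m H *m ((l^-1)%:M)^T)) i i =
          \tr ((A * E) *: ((l^-1)%:M *m H *m ((l^-1)%:M)^T)) by [].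
        rewrite tr_scalar_mx mul_mx_scalar mul_scalar_mx scalerA scalerA mxtraceZ.
        have -> : \tr H = laplacian phi (T z) by apply: eq_bigr => i _; rewrite mxE.
        have -> : laplacian phi (T z) = - (lam * phi (T z)) by rewrite -heig // opprK.
        by rewrite /F -/E; field; rewrite gt_eqF.
      move: hk2; rewrite ler_norml => /andP[h _].
      have hV := hgam (enorm z) (Brange z Bz).
      have l4 : 4 * (lam / (b - a) ^+ 2) = lam / l ^+ 2.
        by rewrite /l; field; rewrite subr_eq0 gt_eqF.
      rewrite l4 in hV; rewrite wF in h wp.
      have := ler_norm (V (enorm z)) => hV'.
      rewrite (gtr0_norm wp) in h.
      have : (`|V (enorm z)| + C0 + lam / l ^+ 2) * F z t < gam * F z t by rewrite ltr_pM2r.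
      have := ler_wpM2r (ltW wp) hV'; lra.
move=> x t xm4 ht.
have xB : B x by rewrite /B /= /l; move: xm4; rewrite -/m; have := ab; lra.
apply: le_trans (ltW (main x t xB ht)); rewrite /F.
rewrite ler_wpM2r ?expR_ge0 //.
have : phi xm <= phi (T x).
  apply: hmin; apply/mem_set; rewrite /K2 /= subr0 nT ler_pdivrMr //.
  by move: xm4; rewrite -/m /l; lra.
move=> h; have := ler_wpM2l (ltW A0) h; apply: le_trans.
by rewrite /A le_eqVlt; apply/orP; left; apply/eqP; field; rewrite gt_eqF.
Qed.

End FarSpreading.

(** * Stability of almost positivity *)

Section Stabilization.
Context {R : realType} {N : nat} (rad : R).
Hypothesis rad0 : 0 <= rad.
Variables (V : R -> R) (C0 Lam : R).
Hypothesis C00 : 0 <= C0.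
Hypothesis Lam0 : 0 <= Lam.
Hypothesis V_lower : forall r, rad <= r -> C0 - V r <= Lam.
Hypothesis V_bounded : forall M, exists2 L : R, 0 <= L &
  forall r, 0 <= r <= M -> `|V r| + C0 <= L.
Implicit Types (x y z e : 'rV[R]_N).

Notation hd e := (half_domain (Sigma N rad) e).
Notation lsol := (linsol rad V C0).

Lemma exp_decay (g A eps : R) : 0 < g -> 0 <= A -> 0 < eps ->
  exists2 S : R, 0 < S & forall s, S <= s -> A * expR (- g * s) <= eps.
Proof.
move=> g0 A0 eps0; exists (A / eps / g + 1).
  by rewrite ltr_wpDl // !divr_ge0 // ltW.
move=> s Ss; rewrite mulNr expRN ler_pdivrMr ?expR_gt0 //.
have h1 : A / eps <= g * s.
  by rewrite (mulrC g) -ler_pdivrMr //; apply: le_trans Ss; rewrite lerDl.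
have h2 := expR_ge1Dx (g * s).
rewrite mulrC -ler_pdivrMr //; apply: le_trans h1 _; apply: le_trans h2.
by rewrite lerDr.
Qed.

Lemma core_away (d Dq : R) : 0 < d -> rad = 0 \/ 0 < Dq ->
  exists2 R1 : R, rad < R1 & forall e x, dot e e = 1 -> d <= dot x e ->
    rad ^+ 2 + Dq <= dot x x -> R1 <= enorm x.
Proof.
move=> d0 [r0|D0].
  exists d; first by rewrite r0.
  move=> e x e1 xe _; apply: le_trans xe _; apply: le_trans (dot_le _ _) _.
  by rewrite [enorm e]/enorm e1 sqrtr1 mulr1.
exists (Num.sqrt (rad ^+ 2 + Dq)).
  rewrite -[X in X < _](ger0_norm rad0) -sqrtr_sqr ltr_sqrt ?ltrDl //.
  by rewrite ltr_wpDl ?sqr_ge0.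
by move=> e x _ _ h; rewrite /enorm ler_sqrt ?dot_ge0.
Qed.

Lemma compact_core d Dq rho e : compact (core rad d Dq rho e).
Proof.
apply: (@ebounded_closed_compact _ _ _ rho); first by move=> x [].
rewrite (_ : core rad d Dq rho e = ((fun x => dot x e) @^-1` [set r | d <= r] `&`
   (fun x => dot x x) @^-1` [set r | rad ^+ 2 + Dq <= r]) `&`
   (@enorm R N) @^-1` [set r | r <= rho]); last first.
  by apply/seteqP; split => x /=; [case => *; split|case=> -[*]; split].
apply: closedI; [apply: closedI|]; apply: closed_comp;
  try exact: closed_ge; try exact: closed_le.
- by move=> y _; exact: continuous_dotl.
- by move=> y _; exact: continuous_sqr_enorm.
- by move=> y _; exact: continuous_enorm.
Qed.

Section Stability.
Variables (lam gam rho a b : R).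
Hypothesis hlam : principal_eigenvalue_ball N lam.
Hypothesis gam0 : 0 < gam.
Hypotheses (ra : rad < a) (ab : a < b) (brho : b <= rho).
Hypothesis V_out : forall r, rho < r -> gam + C0 < V r.
Hypothesis V_in : forall r, a <= r <= b -> `|V r| + C0 + 4 * (lam / (b - a) ^+ 2) < gam.

(** A continuation argument. As long as [w] is positive on the core, the negative part decays at
    rate [gam] everywhere, while the eigenfunction barrier keeps [w] above a multiple of the same
    exponential near [((a + b) / 2) *: e]. Spreading this to the core over the last three time units
    wins by a ratio independent of time, so a first zero on the core cannot occur. *)
Lemma stability (d0 R0 r1 r2 del : R) : 0 < d0 -> rad < R0 -> 0 < r2 -> 0 < del ->
  exists2 eta : R, 0 < eta & forall e w x0 (T : R), lsol e w ->
    [/\ d0 <= dot x0 e, R0 <= enorm x0 & enorm x0 <= r1] -> 0 <= T ->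
    (forall x, hd e x -> - eta <= w x T) ->
    (forall z, enorm (z - x0) < r2 -> del <= w z T) ->
    forall eps : R, 0 < eps -> exists T2 : R, forall t x, T2 <= t -> hd e x ->
      - eps <= w x t.
Proof.
move=> d00 R0r r20 del0.
have a0 : 0 < a by exact: le_lt_trans ra.
(* Bounding by [a] makes the core contain the eigenfunction ball; bounding by [d0] lets [x0] start a
   chain for [spread_far]. *)
have da0 : 0 < Num.min d0 a by rewrite lt_min d00.
have aR : rad < Num.min a R0 by rewrite lt_min ra.
have [d [Dq [/andP[dp dmax] Dq0 Dqa DqD Hout]]] :=
  @outer_decay R N rad rad0 V C0 V_bounded rho gam _ _ da0 aR V_out.
have [R1 R1r hR1] := core_away dp DqD.
pose R1' := Num.min R1 R0; have R1'r : rad < R1' by rewrite lt_min R1r.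
pose rm := Num.max rho r1.
have rs0 : 0 < Num.min r2 ((b - a) / 4) by rewrite lt_min r20 divr_gt0 // subr_gt0.
have [r [c [C [/andP[rp rle] /andP[c0 c1] C1 Hspread]]]] :=
  @spread_far R N rad rad0 V C0 V_bounded d R1' rm _ dp R1'r rs0.
have rr2 : r <= r2 by apply: le_trans rle _; rewrite ge_min lexx.
have rba : r <= (b - a) / 4 by apply: le_trans rle _; rewrite ge_min lexx orbT.
have [cp /andP[cp0 cp1] Heig] := @eigen_lower R N rad rad0 V C0 lam a b gam ra ab hlam V_in.
(* Half of the spread positivity; the other half covers the loss [C * eta1]. *)
pose k1 := c * del / 2; have k10 : 0 < k1 by rewrite divr_gt0 // mulr_gt0.
(* Three legs of duration at most [2] take at most [6] time units, during which the negative part is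
   controlled by [growth_bound] alone. *)
pose E6 := expR ((Lam + 1) * 6).
have E60 : 0 < E6 by exact: expR_gt0.
have C0' : 0 < C by exact: lt_le_trans C1.
(* Gives [4 * C * eta1 = c * cp * k1]; the final comparison consumes [3 * C * eta1] and leaves a
   positive rest. *)
pose eta := c * (cp * k1) / (4 * C * E6).
have eta0 : 0 < eta by rewrite divr_gt0 ?mulr_gt0.
have etaE : 4 * (C * (eta * E6)) = c * (cp * k1).
  by rewrite /eta; field; rewrite !gt_eqF.
have ck1 : c * (cp * k1) <= k1.
  by rewrite mulrA ler_piMl ?(ltW k10) // mulr_ile1 // ltW.
exists eta => // e w x0 T lw [x0e x0R x0r] T0 hT hdel.
have e1 := ls_unit lw.
pose eta1 := eta * E6; have eta10 : 0 < eta1 by rewrite mulr_gt0.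
have eta3 : 0 <= 3 * eta1 by apply: mulr_ge0 => //; exact: ltW.
have Ceta : C * eta1 <= k1 / 4 by rewrite /eta1; move: etaE ck1; set X := C * _; set Y := c * _; clear - rad0 V_lower V_bounded C00 Lam0 hlam gam0 ra ab brho V_out V_in; lra.
have far y : core rad d Dq rho e y -> [/\ d <= dot y e, R1' <= enorm y & enorm y <= rm].
  move=> [ye yD yr]; split => //.
    by rewrite /R1' ge_min (hR1 e y) // .
  by rewrite /rm le_max yr.
have corehd y : core rad d Dq rho e y -> hd e y.
  move=> [ye yD yr]; split; last exact: lt_le_trans ye.
  by apply/SigmaP; right; apply: lt_le_trans R1r _; exact: (hR1 e y).
have x0far : [/\ d <= dot x0 e, R1' <= enorm x0 & enorm x0 <= rm].
  split.
  - by apply: le_trans dmax _; rewrite ge_min x0e.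
  - by rewrite /R1' ge_min x0R orbT.
  - by rewrite /rm le_max x0r orbT.
have ballcore z : enorm (z - ((a + b) / 2) *: e) <= (b - a) / 2 -> core rad d Dq rho e z.
  move=> hz; have ee : enorm e = 1 by rewrite /enorm e1 sqrtr1.
  have m0 : 0 <= (a + b) / 2 by rewrite divr_ge0 // addr_ge0 // ltW // (lt_trans a0).
  have h1 := cauchy_schwarz (z - ((a + b) / 2) *: e) e.
  rewrite !dotE e1 ee mulr1 ler_norml in h1; move/andP: h1 => [h1 _].
  have h2 := enormD (z - ((a + b) / 2) *: e) (((a + b) / 2) *: e).
  rewrite subrK [enorm (((a + b) / 2) *: e)]enormZ ee mulr1 ger0_norm // in h2.
  have az : a <= dot z e by move: h1 hz; clear - rad0 V_lower V_bounded C00 Lam0 hlam gam0 ra ab brho V_out V_in; lra.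
  split.
  - by apply: le_trans dmax _; rewrite ge_min az orbT.
  - apply: le_trans Dqa _; apply: (@le_trans _ _ (a ^+ 2)).
      by rewrite lerXn2r ?nnegrE ?ge_min ?lexx // ?(ltW a0) // ltW // (le_lt_trans rad0).
    rewrite -sqr_enorm lerXn2r ?nnegrE ?(ltW a0) ?enorm_ge0 //.
    by apply: le_trans az _; apply: le_trans (dot_le _ _) _; rewrite ee mulr1.
  - by apply: le_trans brho; move: h2 hz; clear - rad0 V_lower V_bounded C00 Lam0 hlam gam0 ra ab brho V_out V_in; lra.
have grow x t : hd e x -> T <= t <= T + 6 -> - eta1 <= w x t.
  move=> hx tT; have T6 : 0 <= T <= T + 6 by rewrite T0 lerDl ler0n.
  apply: le_trans (growth_bound V_lower lw T6 (ltW eta0) hT hx tT).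
  rewrite lerN2 /eta1 ler_wpM2l ?(ltW eta0) // ler_expR ler_wpM2l ?addr_ge0 //.
  by move/andP: tT => [_ h]; move: h; clear - rad0 V_lower V_bounded C00 Lam0 hlam gam0 ra ab brho V_out V_in; lra.
have early y t : core rad d Dq rho e y -> T + 3 <= t <= T + 6 -> k1 <= w y t.
  move=> Dy /andP[t3 t6].
  have tE : T + 3 * ((t - T) / 3) = t by field.
  have htau : 1 <= (t - T) / 3 <= 2 by apply/andP; split; move: t3 t6; clear - rad0 V_lower V_bounded C00 Lam0 hlam gam0 ra ab brho V_out V_in; lra.
  have := Hspread e w x0 y T ((t - T) / 3) del eta1 lw x0far (far y Dy) T0 htau (ltW eta10).
  rewrite tE => h; have : c * del - C * eta1 <= w y t.
    apply: h => [z zx|z s hz /andP[s1 s2]]; first by apply: hdel; exact: lt_le_trans rr2.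
    by apply: grow => //; rewrite s1 /=; move: s2 t6; clear - rad0 V_lower V_bounded C00 Lam0 hlam gam0 ra ab brho V_out V_in; lra.
  apply: le_trans; have : c * del = 2 * k1 by rewrite /k1; field.
  by move: Ceta k10; clear - rad0 V_lower V_bounded C00 Lam0 hlam gam0 ra ab brho V_out V_in; lra.
have pos Te : T + 3 <= Te -> forall y t, core rad d Dq rho e y -> T + 3 <= t <= Te -> 0 < w y t.
  move=> hTe; apply: first_touch => //.
  - exact: compact_core.
  - apply: continuous_subspaceW (ls_cont lw) => -[y t] [/= Dy]; rewrite in_itv /= => /andP[Ts _].
    split => /=; first exact: half_domain_closed (corehd y Dy).
    by rewrite in_itv /= andbT; move: Ts T0; clear - rad0 V_lower V_bounded C00 Lam0 hlam gam0 ra ab brho V_out V_in; lra.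
  - move=> y Dy; apply: lt_le_trans k10 (early y _ Dy _).
    by rewrite lexx lerD2l ler_nat.
  - move=> y t Dy /andP[Tt tTe] wt hbefore hnow.
    (* Durations [3 * tau] with [1 <= tau <= 2] cover the times up to [T + 6]; a later contact
       leaves room for three units of spreading after [T + 3]. *)
    have [t6|t6] := leP t (T + 6).
      have := early y t Dy; rewrite (ltW Tt) t6 => /(_ isT); rewrite wt leNgt k10 //.
    have T3 : 0 <= T + 3 <= t by rewrite addr_ge0 //= ltW.
    (* [outer_decay] asks for a sign on the core only up to the contact time [t], which is known
       from [hbefore] and [hnow]. *)
    have hout : forall x s, hd e x -> T + 3 <= s <= t ->
        - (3 * eta1 * expR (- gam * (s - (T + 3)))) <= w x s.
      apply: (Hout e w (T + 3) t eta1 lw T3 (ltW eta10)).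
        by move=> x hx; apply: grow => //; rewrite lerDl lerD2l ler0n ler_nat.
      move=> x s hx Dx /andP[s1]; rewrite le_eqVlt => /orP[/eqP ->|s2]; first exact: hnow.
      by apply: ltW; apply: hbefore => //; rewrite s2 ltW.
    pose E := expR (- gam * (t - 3 - (T + 3))).
    have E0 : 0 < E by exact: expR_gt0.
    have hs : 0 < T + 3 <= t - 3 by apply/andP; split; move: T0 t6; clear - rad0 V_lower V_bounded C00 Lam0 hlam gam0 ra ab brho V_out V_in; lra.
    have heig z : enorm (z - ((a + b) / 2) *: e) < r -> cp * k1 * E <= w z (t - 3).
      move=> hz; apply: (Heig e w (T + 3) (t - 3) k1 lw hs k10).
      - by move=> x /ballcore Dx; apply: early => //; rewrite lexx lerD2l ler_nat.
      - move=> x s /ballcore Dx /andP[s1 s2]; apply: hbefore => //.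
        by rewrite s1 /=; move: s2; clear - rad0 V_lower V_bounded C00 Lam0 hlam gam0 ra ab brho V_out V_in; lra.
      - by apply: le_trans (ltW hz) rba.
      - by case/andP: hs => _ ->; rewrite lexx.
    have cm : core rad d Dq rho e (((a + b) / 2) *: e).
      by apply: ballcore; rewrite subrr enorm0 divr_ge0 // subr_ge0 ltW.
    have t30 : 0 <= t - 3 by case/andP: hs => h1 h2; move: h1 h2; clear - rad0 V_lower V_bounded C00 Lam0 hlam gam0 ra ab brho V_out V_in; lra.
    have one : 1 <= (1 : R) <= 2.
      by apply/andP; split; [exact: lexx|exact: (ler1n R 2)].
    have eE : 0 <= 3 * eta1 * E by apply: mulr_ge0 => //; exact: ltW.
    have := Hspread e w _ y (t - 3) 1 (cp * k1 * E) (3 * eta1 * E) lw (far _ cm) (far _ Dy) t30 one eE heig.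
    rewrite mulr1 subrK => h.
    have : c * (cp * k1 * E) - C * (3 * eta1 * E) <= w y t.
      apply: h => z s hz /andP[s1 s2].
      have hs' : T + 3 <= s <= t.
        by rewrite s2 andbT; case/andP: hs => _ h; exact: le_trans s1.
      apply: le_trans (hout z s hz hs'); rewrite lerN2 ler_wpM2l //.
      by rewrite ler_expR ler_wnM2l ?oppr_le0 ?(ltW gam0) // lerD2r.
    rewrite wt leNgt => /negP; apply.
    have -> : c * (cp * k1 * E) - C * (3 * eta1 * E) = (c * (cp * k1) - 3 * (C * eta1)) * E by ring.
    rewrite mulr_gt0 // -etaE -/eta1.
    have : 0 < C * eta1 by rewrite mulr_gt0.
    by clear - rad0 V_lower V_bounded C00 Lam0 hlam gam0 ra ab brho V_out V_in; lra.
move=> eps eps0.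
have [S S0 hS] := exp_decay gam0 eta3 eps0.
exists (T + 3 + S) => t x tS hx.
have Tt : T + 3 <= t by move: tS S0; clear - rad0 V_lower V_bounded C00 Lam0 hlam gam0 ra ab brho V_out V_in; lra.
have T3 : 0 <= T + 3 <= t by rewrite addr_ge0.
have tt : T + 3 <= t <= t by rewrite Tt lexx.
have hg : forall x, hd e x -> - eta1 <= w x (T + 3).
  by move=> y hy; apply: grow => //; rewrite lerDl lerD2l ler0n ler_nat.
have hp : forall x s, hd e x -> core rad d Dq rho e x -> T + 3 < s <= t -> 0 <= w x s.
  by move=> y s hy Dy /andP[s1 s2]; apply: ltW; apply: (pos t Tt) => //; rewrite s2 ltW.
apply: le_trans (Hout e w (T + 3) t eta1 lw T3 (ltW eta10) hg hp x t hx tt).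
by rewrite lerN2; apply: hS; move: tS; clear - rad0 V_lower V_bounded C00 Lam0 hlam gam0 ra ab brho V_out V_in; lra.
Qed.

End Stability.

Definition refl_aff (c n z : 'rV[R]_N) : 'rV[R]_N := z - (2 * dot (z - c) n) *: n.

(* Reflect at the hyperplane that exchanges the two points; the difference
   of [w] and its reflection vanishes there and is controlled by a barrier in
   a half ball. *)
Lemma local_lipschitz e w x0 (K : R) : lsol e w -> hd e x0 -> 0 <= K ->
  (forall x t, hd e x -> 0 < t -> `|w x t| <= K) ->
  exists r C : R, [/\ 0 < r, 0 < C & forall x y t,
    enorm (x - x0) < r -> enorm (y - x0) < r -> 1 < t ->
    - (C * enorm (x - y)) <= w x t - w y t].
Proof.
move=> lw hx0 K0 hK; have [r' r'0 hr'] := half_domain_nbhs (ls_unit lw) hx0.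
(* Halving keeps the ball of radius [r] about the midpoint [c] within distance [r'] of [x0]. *)
pose r := r' / 2; have r0 : 0 < r by rewrite divr_gt0.
have [L L0 hL] := V_bounded (enorm x0 + r').
(* The concave term contributes [- 2 * beta]; this offsets the time slope [2 * K], the Laplacian of
   the quadratic term and the right-hand sides [L * K] of the two equations, with [2] to spare. *)
pose beta := K + 2 * K * N%:R / r ^+ 2 + L * K + 1.
have be0 : 0 < beta.
  rewrite /beta ltr_wpDl // addr_ge0 ?mulr_ge0 // addr_ge0 // divr_ge0 ?sqr_ge0 //.
  by rewrite !mulr_ge0.
pose C := K / r + beta * r.
have C0' : 0 < C.
  by apply: ltr_wpDl; [rewrite divr_ge0 // ltW|exact: mulr_gt0].
exists r, C; split => // x y t xr yr t1.
have [->|nxy] := eqVneq x y; first by rewrite !subrr enorm0 mulr0 oppr0.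
pose D := enorm (x - y).
have D0 : 0 < D.
  rewrite lt_neqAle enorm_ge0 andbT eq_sym; apply/eqP => /enorm_eq0 /eqP.
  by rewrite subr_eq0 (negbTE nxy).
have [n nE] : {n | n = D^-1 *: (x - y)} by exists (D^-1 *: (x - y)).
have [c cE] : {c | c = 2^-1 *: (x + y)} by exists (2^-1 *: (x + y)).
have n1 : dot n n = 1.
  rewrite nE dotZl dotZr -sqr_enorm -/D; field; exact: lt0r_neq0.
have nn : enorm n = 1 by rewrite /enorm n1 sqrtr1.
have xc : x - c = (D / 2) *: n.
  rewrite nE scalerA cE; apply/rowP => j; rewrite !mxE; field; exact: lt0r_neq0.
have dx : dot (x - c) n = D / 2 by rewrite xc dotZl n1 mulr1.
have tx : refl_aff c n x = y.
  rewrite /refl_aff dx nE; apply/rowP => j; rewrite !mxE; field; exact: lt0r_neq0.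
have cx0 : enorm (c - x0) < r.
  have -> : c - x0 = 2^-1 *: ((x - x0) + (y - x0)).
    by rewrite cE; apply/rowP => j; rewrite !mxE; field.
  rewrite enormZ ger0_norm ?invr_ge0 //.
  have h := enormD (x - x0) (y - x0); move: h xr yr; clear - rad0 V_lower V_bounded C00 Lam0; lra.
have inr z : enorm (z - c) <= r -> enorm (z - x0) < r'.
  move=> zc; have h := enormD3 c z x0; move: h zc cx0; rewrite /r; clear - rad0 V_lower V_bounded C00 Lam0; lra.
have taff z z' : refl_aff c n (z + z') = refl_aff c n z + z' *m refl_mx n.
  rewrite refl_mxE /refl_aff /refl_hyp !dotDl; apply/rowP => j; rewrite !mxE; ring.
have tc z : enorm (refl_aff c n z - c) = enorm (z - c).
  have -> : refl_aff c n z - c = refl_hyp n (z - c).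
    by rewrite /refl_aff /refl_hyp addrAC.
  exact: enorm_refl.
have ct : continuous (refl_aff c n).
  apply: (@cts_lipschitz _ _ _ 1) => // u v; rewrite mul1r.
  have -> : refl_aff c n u - refl_aff c n v = refl_hyp n (u - v).
    by rewrite /refl_aff /refl_hyp !dotE; apply/rowP => j; rewrite !mxE; ring.
  by rewrite enorm_refl.
pose B : set 'rV[R]_N := [set z | enorm (z - c) <= r] `&` [set z | 0 <= dot (z - c) n].
have cB : compact B.
  apply: compact_closedI; first exact: compact_eball.
  apply: (@closed_comp _ _ (fun z => dot (z - c) n) [set q | 0 <= q]); last exact: closed_ge.
  move=> z _; rewrite (_ : (fun z => dot (z - c) n) = (fun z => dot z n - dot c n)).
    by apply: ctsB; [exact: continuous_dotl|exact: cts_cst].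
  by apply/funext => q; rewrite dotDl dotNl.
pose T := t - 1; have T0 : 0 < T by rewrite subr_gt0.
have Bhd z : B z -> hd e z by move=> [zc _]; apply: hr'; exact: inr.
have Bhd' z : B z -> hd e (refl_aff c n z).
  by move=> [zc _]; apply: hr'; apply: inr; rewrite tc.
pose h z s := w z s - w (refl_aff c n z) s.
have ch : {within B `*` `[T, t], continuous (fun q : 'rV[R]_N * R => h q.1 q.2)}.
  have cw1 : {within B `*` `[T, t], continuous (fun q : 'rV[R]_N * R => w q.1 q.2)}.
    apply: continuous_subspaceW (ls_cont lw) => -[z s] [/= Bz]; rewrite in_itv /= => /andP[Ts _].
    split => /=; first exact: half_domain_closed (Bhd z Bz).
    by rewrite in_itv /= andbT (le_trans (ltW T0)).
  have cw2 : {within B `*` `[T, t], continuous (fun q : 'rV[R]_N * R => w (refl_aff c n q.1) q.2)}.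
    apply: (@within_comp _ _ _ _ _ (fun q : 'rV[R]_N * R => (refl_aff c n q.1, q.2))
       (fun q => w q.1 q.2) _ _ (ls_cont lw)).
      move=> -[z s] P [[P1 P2] /= [h1 h2] hP].
      exists (refl_aff c n @^-1` P1, P2) => /=; first by split => //; exact: ct.
      by move=> -[z' s'] [/= q1 q2]; apply: hP; split.
    move=> -[z s] [/= Bz]; rewrite in_itv /= => /andP[Ts _].
    split => /=; first exact: half_domain_closed (Bhd' z Bz).
    by rewrite in_itv /= andbT (le_trans (ltW T0)).
  exact: within_continuousB.
(* The quadratic term dominates [h] on the curved boundary, [2 * K * (t - s)] at the initial time
   [t - 1]; the parabola in [dot (z - c) n] supplies strictness of the differential inequality, and
   [io] that on the flat side, where [h = 0]. *)
pose F (io : R) z s := - (2 * K / r ^+ 2 * dot (z - c) (z - c) + 2 * K * (t - s)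
   + beta * (2 * r * dot (z - c) n - dot (z - c) n ^+ 2) + io).
have r2 : 0 < r ^+ 2 by rewrite exprn_gt0.
have sgr z : B z -> dot (z - c) n <= r.
  by move=> [zc _]; apply: le_trans (dot_le _ _) _; rewrite nn mulr1.
have sg2 z : B z -> 0 <= beta * (2 * r * dot (z - c) n - dot (z - c) n ^+ 2).
  move=> Bz; apply: mulr_ge0; first exact: ltW.
  have [_ /= s0] := Bz; have sr := sgr z Bz.
  have rs : 0 <= r - dot (z - c) n by rewrite subr_ge0.
  have h1 := mulr_ge0 s0 rs; have h2 := mulr_ge0 (ltW r0) s0.
  move: h1 h2; clear - rad0 V_lower V_bounded C00 Lam0; lra.
have hb z s : B z -> 0 < s -> - (2 * K) <= h z s.
  move=> Bz s0; have h1 := hK z s (Bhd z Bz) s0; have h2 := hK _ s (Bhd' z Bz) s0.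
  move: h1 h2; rewrite /h !ler_norml; clear - rad0 V_lower V_bounded C00 Lam0; lra.
have main io : 0 < io -> forall z s, B z -> T <= s <= t -> F io z s < h z s.
  move=> io0; apply: parabolic_comparison => //.
  - by rewrite /T gerBl.
  - apply: (within_continuousB ch); apply: continuous_subspaceT.
    have c1 : continuous (fun q : 'rV[R]_N * R => dot (q.1 - c) n).
      rewrite (_ : (fun q : 'rV[R]_N * R => dot (q.1 - c) n) = (fun q => dot q.1 n - dot c n)).
        by apply: ctsB; [apply: (@cts_fst _ _ (fun z => dot z n)); exact: continuous_dotl|exact: cts_cst].
      by apply/funext => q; rewrite dotDl dotNl.
    have c2 : continuous (fun q : 'rV[R]_N * R => dot (q.1 - c) (q.1 - c)).
      rewrite (_ : (fun q : 'rV[R]_N * R => dot (q.1 - c) (q.1 - c)) =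
         (fun q => dot q.1 q.1 - 2 * dot q.1 c + dot c c)).
        apply: ctsD; last exact: cts_cst.
        apply: ctsB; first by apply: (@cts_fst _ _ (fun z => dot z z)); exact: continuous_sqr_enorm.
        apply: ctsM; first exact: cts_cst.
        by apply: (@cts_fst _ _ (fun z => dot z c)); exact: continuous_dotl.
      by apply/funext => q; rewrite !dotE (dotC c q.1); ring.
    apply: ctsN; apply: ctsD; last exact: cts_cst.
    apply: ctsD; [apply: ctsD|].
    + by apply: ctsM; [exact: cts_cst|].
    + by apply: ctsM; [exact: cts_cst|apply: ctsB; [exact: cts_cst|exact: cts_snd]].
    + apply: ctsM; first exact: cts_cst.
      apply: ctsB; last exact: (ctsM c1 c1).
      by apply: ctsM; [exact: cts_cst|].
  - move=> z Bz; apply: lt_le_trans (hb z T Bz T0).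
    rewrite /F ltrN2 (_ : t - T = 1); last by rewrite /T; ring.
    have h1 : 0 <= 2 * K / r ^+ 2 * dot (z - c) (z - c).
      by rewrite mulr_ge0 ?dot_ge0 // divr_ge0 ?(ltW r2) // mulr_ge0.
    by have h2 := sg2 z Bz; move: h1 h2 io0; clear - rad0 V_lower V_bounded C00 Lam0; lra.
  - move=> z s Bz /andP[Ts st] hF.
    have s0 : 0 < s by exact: lt_trans Ts.
    have ts : 0 <= 2 * K * (t - s) by rewrite !mulr_ge0 // subr_ge0.
    have dz : 0 <= 2 * K / r ^+ 2 * dot (z - c) (z - c).
      by rewrite mulr_ge0 ?dot_ge0 // divr_ge0 ?(ltW r2) // mulr_ge0.
    have zr : enorm (z - c) < r.
      have [zc _] := Bz; rewrite lt_neqAle zc andbT; apply/eqP => zr.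
      have h1 := hb z s Bz s0; have h2 := sg2 z Bz.
      have h3 : 2 * K / r ^+ 2 * dot (z - c) (z - c) = 2 * K.
        by rewrite -sqr_enorm zr divfK // gt_eqF.
      by rewrite hF /F h3 in h1; move: h1 h2 ts io0; clear - rad0 V_lower V_bounded C00 Lam0; lra.
    have zn : 0 < dot (z - c) n.
      have [_ /= zn] := Bz; rewrite lt_neqAle zn andbT; apply/eqP => zn0.
      have h0 : h z s = 0 by rewrite /h /refl_aff -zn0 mulr0 scale0r subr0 subrr.
      have h2 := sg2 z Bz.
      by rewrite hF /F in h0; move: h0 h2 ts dz io0; clear - rad0 V_lower V_bounded C00 Lam0; lra.
    have [k1 hk1 bk1] := ls_eq lw (Bhd z Bz) s0.
    have [k2 hk2 bk2] := ls_eq lw (Bhd' z Bz) s0.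
    have hh := heat_sub hk1 (heat_comp taff _ hk2).
    rewrite refl_mx_sym refl_mx_orth // in hh.
    exists (k1 - k2), (2 * K), (fun i => 2 * beta * dot (delta_mx 0 i) n ^+ 2 - 4 * K / r ^+ 2).
    split.
    + exists (Num.min (r - enorm (z - c)) (dot (z - c) n)).
        by rewrite lt_min subr_gt0 zr.
      move=> z'; rewrite lt_min => /andP[q1 q2]; split.
        have h1 := enormD (z' - z) (z - c); rewrite addrA subrK in h1.
        by rewrite /=; move: h1 q1; clear - rad0 V_lower V_bounded C00 Lam0; lra.
      have h1 := cauchy_schwarz (z' - z) n; rewrite nn mulr1 ler_norml in h1.
      move/andP: h1 => [h1 _]; rewrite /=.
      have -> : z' - c = (z' - z) + (z - c) by rewrite addrA subrK.
      by rewrite dotDl; move: h1 q2; clear - rad0 V_lower V_bounded C00 Lam0; lra.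
    + exact: hh.
    + move=> eps eps0; exists 1 => // q /andP[q0 _].
      have -> : F io z (s - q) - F io z s + 2 * K * q = 0 by rewrite /F; ring.
      by rewrite normr0 mulr_ge0 // ltW.
    + move=> i; apply: sec_lower_exact; exists 1 => // q _.
      have := dot_delta_delta i : dot _ _ = 1 :> R.
      move: (delta_mx 0 i : 'rV[R]_N) => ei ei1.
      have -> : sdiff (F io ^~ s) z ei q =
          (2 * beta * dot ei n ^+ 2 - 4 * K / r ^+ 2) * q ^+ 2.
        rewrite /sdiff /F !dotE ei1 (dotC ei z) (dotC ei c); field; exact: lt0r_neq0.
      by [].
    + rewrite sumrB -mulr_sumr sum_delta_dot_sqr n1 sumr_const card_ord.
      have VL q : enorm (q - c) <= r -> `|V (enorm q)| + C0 <= L.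
        move=> /inr qx0; apply: hL; rewrite enorm_ge0 /=.
        by have := enormD (q - x0) x0; rewrite subrK; move: qx0; clear - rad0 V_lower V_bounded C00 Lam0; lra.
      have kb (q : 'rV[R]_N) kk : hd e q -> enorm (q - c) <= r ->
          `|kk + V (enorm q) * w q s| <= C0 * `|w q s| -> `|kk| <= L * K.
        move=> hq qc hkk; have wK := hK q s hq s0.
        have -> : kk = (kk + V (enorm q) * w q s) - V (enorm q) * w q s by rewrite addrK.
        apply: le_trans (ler_normB _ _) _; rewrite normrM.
        apply: (@le_trans _ _ ((`|V (enorm q)| + C0) * `|w q s|)).
          by rewrite mulrDl addrC lerD2l.
        by apply: ler_pM; rewrite ?addr_ge0 ?VL.
      have b1 := kb z k1 (Bhd z Bz) (ltW zr) bk1.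
      have b2 : `|k2| <= L * K.
        by apply: (kb _ _ (Bhd' z Bz) _ bk2); rewrite tc ltW.
      rewrite !ler_norml in b1 b2; move/andP: b1 => [b1 _]; move/andP: b2 => [_ b2].
      have -> : 4 * K / r ^+ 2 *+ N = 2 * (2 * K * N%:R / r ^+ 2) by rewrite -mulr_natr; ring.
      by rewrite mulr1 /beta; move: b1 b2; clear - rad0 V_lower V_bounded C00 Lam0; lra.
have Bx : B x.
  split; rewrite /= ?dx ?divr_ge0 ?(ltW D0) //.
  rewrite xc enormZ nn mulr1 ger0_norm ?divr_ge0 ?(ltW D0) //.
  have := enormD3 x0 x y; rewrite (enormB x0 y) -/D.
  by move: xr yr; clear - rad0 V_lower V_bounded C00 Lam0; lra.
have Dr : D / 2 <= r by have := sgr x Bx; rewrite dx.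
apply/ler_addgt0Pr => io io0.
have tt : T <= t <= t by rewrite /T gerBl ler01 lexx.
have := main io io0 x t Bx tt.
rewrite /h tx /F subrr mulr0 addr0 xc !dotE n1 !mulr1 -/D => hm.
have h1 : 2 * K / r ^+ 2 * (D / 2 * (D / 2)) <= K / r * D.
  have -> : 2 * K / r ^+ 2 * (D / 2 * (D / 2)) = (D / 2 / r) * (K / r * D).
    by field; rewrite gt_eqF.
  rewrite ler_piMl ?mulr_ge0 ?invr_ge0 ?(ltW r0) ?(ltW D0) //.
  by rewrite ler_pdivrMr // mul1r.
have h2 : beta * (2 * r * (D / 2) - (D / 2) ^+ 2) <= beta * r * D.
  have : 0 <= beta * (D / 2) ^+ 2 by rewrite mulr_ge0 ?sqr_ge0 // ltW.
  clear - rad0 V_lower V_bounded C00 Lam0; lra.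
rewrite /C; move: hm h1 h2; clear - rad0 V_lower V_bounded C00 Lam0; lra.
Qed.

End Stabilization.

(** * Lipschitz constants from almost everywhere derivatives *)

Section LipschitzDistribution.
Context {R : realType}.
Variables (G : R -> R) (v w L : R).
Hypotheses (vw : v < w) (L0 : 0 < L).
Hypothesis G_incr : forall x y, x <= y -> 0 <= G y - G x <= L * (y - x).
Hypothesis G_left : forall x, x <= v -> G x = 0.
Hypothesis G_right : forall x, w <= x -> G x = 1.

Let G_nd : {homo G : x y / x <= y}.
Proof. by move=> x y /G_incr /andP[]; rewrite subr_ge0. Qed.

Let G_lip x y : `|G x - G y| <= L * `|x - y|.
Proof.
have [xy|yx] := leP x y.
  have /andP[h1 h2] := G_incr xy.
  by rewrite distrC ger0_norm // distrC ger0_norm // subr_ge0.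
have /andP[h1 h2] := G_incr (ltW yx).
by rewrite ger0_norm // ger0_norm // subr_ge0 ltW.
Qed.

Let lip_cont (f : R -> R) (c : R) : 0 < c ->
  (forall x y, `|f x - f y| <= c * `|x - y|) -> continuous f.
Proof.
move=> c0 hf x; apply/cvgrPdist_lt => e e0; apply/nbhs_ballP.
exists (e / c) => /=; first exact: divr_gt0.
move=> y; rewrite /ball /= ltr_pdivlMr // => h; apply: le_lt_trans (hf x y) _.
by rewrite mulrC.
Qed.

Let G_rc : forall x, G @ at_right x --> G x.
Proof. by apply: right_continuousW; exact: lip_cont L0 G_lip. Qed.

Let G_Ny : G @ -oo --> (0 : R).
Proof.
apply/cvgrPdist_lt => e e0; exists v; split; first exact: num_real.
by move=> x xv /=; rewrite G_left ?subrr ?normr0 // ltW.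
Qed.

Let G_y : G @ +oo --> (1 : R).
Proof.
apply/cvgrPdist_lt => e e0; exists w; split; first exact: num_real.
by move=> x xv /=; rewrite G_right ?subrr ?normr0 // ltW.
Qed.

HB.instance Definition _ := isCumulative.Build R _ R G G_nd G_rc.
HB.instance Definition _ := isCumulativeBounded.Build R 0 1 G G_Ny G_y.

Let P := lebesgue_stieltjes_measure G.

(* The Stieltjes measures of [G] and [slack] add up to [L] times the Lebesgue
   measure, hence that of [G] is absolutely continuous. *)
Definition slack (x : R) := L * x - G x.

Let slack_nd : {homo slack : x y / x <= y}.
Proof.
by move=> x y /G_incr /andP[_]; rewrite /slack; lra.
Qed.

Let slack_rc : forall x, slack @ at_right x --> slack x.
Proof.
apply: right_continuousW => x; apply: cvgB; last exact: (lip_cont L0 G_lip).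
by apply: cvgM; [exact: cvg_cst|exact: cvg_id].
Qed.

HB.instance Definition _ := isCumulative.Build R _ R slack slack_nd slack_rc.

Let Q := lebesgue_stieltjes_measure slack.

Let P_itv x y : x <= y -> P `]x, y]%classic = (G y - G x)%:E.
Proof.
move=> xy; rewrite /P /lebesgue_stieltjes_measure /measure_extension.
rewrite measurable_mu_extE /=; last exact: is_ocitv.
by rewrite wlength_itv_bnd.
Qed.

Let Q_itv x y : x <= y -> Q `]x, y]%classic = (slack y - slack x)%:E.
Proof.
move=> xy; rewrite /Q /lebesgue_stieltjes_measure /measure_extension.
rewrite measurable_mu_extE /=; last exact: is_ocitv.
by rewrite wlength_itv_bnd.
Qed.

Let PQ : {measure set (measurableTypeR R) -> \bar R} :=
  mscale (NngNum (ltW (divr_gt0 ltr01 L0))) (measure_add P Q).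

Let PQE A : PQ A = ((1 / L)%:E * (P A + Q A))%E.
Proof. by rewrite -(measure_addE P Q). Qed.

Let lebesgue_split A : measurable A -> (@lebesgue_measure R) A = PQ A.
Proof.
apply: (@lebesgue_stieltjes_measure_unique R idfun PQ) => X [[x y] _ <-] /=.
have [xy|yx] := leP x y; last first.
  by rewrite set_itv_ge ?measure0 // -leNgt bnd_simp ltW.
rewrite PQE P_itv // Q_itv // -EFinD -EFinM.
rewrite /lebesgue_stieltjes_measure /measure_extension measurable_mu_extE /=; last exact: is_ocitv.
rewrite wlength_itv_bnd //= /slack; congr (_%:E).
by field; exact: lt0r_neq0.
Qed.

Let P_dominated : P `<< (@lebesgue_measure R).
Proof.
apply/(null_content_dominatesP P (@lebesgue_measure R)) => A mA.
move=> lA0.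
have h : ((1 / L)%:E * (P A + Q A))%E = 0%E.
  by rewrite -PQE -(lebesgue_split mA).
have P0 : (0 <= P A)%E by exact: measure_ge0.
have Q0 : (0 <= Q A)%E by exact: measure_ge0.
apply/eqP; rewrite eq_le P0 andbT.
apply: (@le_trans _ _ (P A + Q A)%E); first by rewrite leeDl.
move/eqP: h; rewrite mule_eq0 => /orP[|/eqP -> //].
by rewrite eqe gt_eqF // divr_gt0.
Qed.

(** Absolute continuity gives a density by Radon-Nikodym, and Lebesgue differentiation identifies it
    with the derivative of [G] almost everywhere. *)
Lemma lipschitz_distribution_density : exists rho : R -> R,
  [/\ forall x, 0 <= rho x, (@lebesgue_measure R).-integrable setT (EFin \o rho),
      forall x, v <= x ->
        (G x)%:E = (\int[lebesgue_measure]_(t in `]v, x]) (rho t)%:E)%E &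
      {ae (@lebesgue_measure R), forall x, v < x -> is_derive x (1 : R) G (rho x)}].
Proof.
have [f [f0 ffin fint fE]] := @radon_nikodym_sigma_finite _ _ _
  (@lebesgue_measure R) (lebesgue_stieltjes_measure G) P_dominated.
exists (fine \o f).
have ff : EFin \o (fine \o f) = f by apply/funext => x /=; rewrite fineK.
have GE x : v <= x -> (G x)%:E =
    (\int[lebesgue_measure]_(t in `]v, x]) ((fine \o f) t)%:E)%E.
  move=> vx; have := P_itv vx; rewrite (G_left (lexx v)) subr0 => <-.
  rewrite -[LHS]/(lebesgue_stieltjes_measure G _).
  rewrite (fE _ (measurable_itv (Interval (BRight v) (BRight x)))).
  by apply: eq_integral => t _; rewrite /= fineK.
split; rewrite ?ff //; first by move=> x; exact/fine_ge0.
have i1 y : (@lebesgue_measure R).-integrable [set` Interval (BRight v) (BRight y)]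
    (EFin \o (fine \o f)).
  by rewrite ff; apply: integrableS fint.
have loc : locally_integrable setT (fine \o f).
  by apply: open_integrable_locally; [exact: openT|rewrite ff].
have := FTC1 i1 loc; apply: filterS; first exact: (ae_filter_ringOfSetsType (@lebesgue_measure R)).
move=> x hx vx; have [] := hx vx; set F := (X in derivable X _ _) => dF dE.
apply: (@near_eq_is_derive _ _ _ F).
  have : \forall a \near x, v < a by exact: lt_nbhsr.
  apply: filterS => a va; rewrite /F /Rintegral.
  by rewrite -GE // ltW.
by rewrite -dE derive1E; apply/derivableP.
Qed.

(** The total mass [1] is the integral of the density over []v, w]], and the density is almost
    everywhere a derivative of [G], hence at most [c]. *)
Lemma lipschitz_distribution_le (c : R) : 0 <= c ->
  (forall x l, v < x < w -> is_derive x (1 : R) G l -> l <= c) -> 1 <= c * (w - v).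
Proof.
move=> c0 hc; have [r [r0 ri rE rd]] := lipschitz_distribution_density.
have h : ((G w)%:E <= (c * (w - v))%:E)%E.
  rewrite rE; last exact: ltW.
  have -> : (c * (w - v))%:E = (\int[lebesgue_measure]_(t in `]v, w]) (cst c%:E) t)%E.
    by rewrite integral_cst //= lebesgue_measure_itv /= lte_fin vw -EFinB -EFinM.
  apply: ae_ge0_le_integral => //.
  - by move=> x _; rewrite lee_fin.
  - have m1 : (@lebesgue_measure R).-integrable `]v, w]%classic (EFin \o r).
      by apply: integrableS ri.
    by case/integrableP : m1.
  have FF := (ae_filter_ringOfSetsType (@lebesgue_measure R)).
  (* The derivative bound is assumed only on the open interval, so the endpoint [w] is discarded as
     a null set. *)
  have nw : {ae (@lebesgue_measure R), forall x, x != w}.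
    exists [set w]; split; rewrite ?lebesgue_measure_set1 //.
    by move=> x /=; case: eqVneq.
  apply: filterS2 rd nw => x hx xw /=; rewrite in_itv /= => /andP[vx xlew].
  by rewrite lee_fin; apply: (hc x) (hx vx); rewrite vx lt_neqAle xw.
by rewrite G_right // lee_fin in h.
Qed.

End LipschitzDistribution.

(** * From a bounded derivative to a global Lipschitz constant *)

Section GlobalLipschitz.
Context {R : realType}.
Variables (g : R -> R) (C0 : R).
Hypothesis g_lip : forall K, 0 < K -> exists2 C : R, 0 < C &
  forall v w, v \in `[- K, K] -> w \in `[- K, K] -> `|g v - g w| <= C * `|v - w|.
Hypothesis g_der : forall s, derivable g s 1 -> `|'D_1 g s| <= C0.

(** Adding a steep linear function, clamping to [[v, w]] and normalizing turns [g] into a Lipschitz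
    distribution function, to which [lipschitz_distribution_le] applies. *)
Lemma lipschitz_increment v w : v < w -> 0 <= C0 /\ g w - g v <= C0 * (w - v).
Proof.
move=> vw; pose K := `|v| + `|w| + 1.
have K0 : 0 < K by rewrite /K; have := normr_ge0 v; have := normr_ge0 w; lra.
have [C C0' hC] := g_lip K0.
have inK x : v <= x <= w -> x \in `[- K, K].
  move=> /andP[vx xw]; rewrite in_itv /= /K.
  have := ler_norm w; have := ler_norm (- v); rewrite normrN.
  by have := normr_ge0 v; have := normr_ge0 w; lra.
(* One more than the local Lipschitz constant, so that [h] has slope at least [1] and [Dl] is
   positive. *)
pose D := C + 1.
pose h x := g x + D * x.
have hinc x y : v <= x -> x <= y -> y <= w -> y - x <= h y - h x <= (C + D) * (y - x).
  move=> vx xy yw; have := hC y x.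
  rewrite !inK ?vx ?(le_trans xy yw) ?yw ?(le_trans vx xy) // => /(_ isT isT).
  rewrite (ger0_norm (_ : 0 <= y - x)) ?subr_ge0 // ler_norml => /andP[h1 h2].
  rewrite /h; apply/andP; split; rewrite /D; lra.
pose cl x := Num.min w (Num.max v x).
have clv x : v <= cl x by rewrite /cl le_min (ltW vw) /= le_max lexx.
have clw x : cl x <= w by rewrite /cl ge_min lexx.
have cl_mono x y : x <= y -> 0 <= cl y - cl x <= y - x.
  move=> xy; rewrite /cl /Num.min /Num.max.
  by case: (ltP v x) => ?; case: (ltP v y) => ?; case: ltP => ?; case: ltP => ?; lra.
pose Dl := h w - h v.
have Dl0 : w - v <= Dl by have /andP[] := hinc v w (lexx _) (ltW vw) (lexx _).
have Dlp : 0 < Dl by apply: lt_le_trans Dl0; rewrite subr_gt0.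
pose G x := (h (cl x) - h v) / Dl.
have CD0 : 0 < C + D by rewrite /D; lra.
have G_incr x y : x <= y -> 0 <= G y - G x <= (C + D) / Dl * (y - x).
  move=> xy; have /andP[c1 c2] := cl_mono _ _ xy.
  have cxy : cl x <= cl y by rewrite -subr_ge0.
  have /andP[h1 h2] := hinc _ _ (clv x) cxy (clw y).
  rewrite /G -mulrBl opprB addrA subrK; apply/andP; split.
    by apply: divr_ge0 (le_trans c1 h1) (ltW Dlp).
  rewrite mulrAC ler_pM2r ?invr_gt0 //; apply: le_trans h2 _.
  by rewrite ler_pM2l.
have G_left x : x <= v -> G x = 0.
  by move=> xv; rewrite /G /cl max_l // min_r ?subrr ?mul0r // ltW.
have G_right x : w <= x -> G x = 1.
  move=> wx; rewrite /G /cl max_r ?(le_trans (ltW vw)) // min_l //.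
  by rewrite divff ?lt0r_neq0.
have gG x : v < x < w -> \forall a \near x, Dl * G a + h v - D * a = g a.
  move=> /andP[vx xw].
  have h1 : \forall a \near x, v < a by exact: lt_nbhsr.
  have h2 : \forall a \near x, a < w by exact: lt_nbhsl.
  apply: filterS2 h1 h2 => a va aw.
  rewrite /G /cl max_r ?ltW // min_r ?ltW // mulrC divfK ?lt0r_neq0 // /h; ring.
have dg x l : v < x < w -> is_derive x (1 : R) G l -> is_derive x (1 : R) g (Dl * l - D).
  move=> xvw Gl; apply: near_eq_is_derive (gG _ xvw) _.
  have -> : Dl * l - D = (Dl *: l + 0) - D *: (1 : R) by rewrite addr0 [D *: _]mulr1.
  have d1 : is_derive x (1 : R) (fun a => Dl *: G a) (Dl *: l) by apply: is_deriveZ.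
  have d2 : is_derive x (1 : R) (fun a => D *: (a : R)) (D *: (1 : R)) by apply: is_deriveZ.
  exact: (is_deriveB (is_deriveD d1 (is_derive_cst (h v) x 1)) d2).
have dle x l : v < x < w -> is_derive x (1 : R) G l -> `|Dl * l - D| <= C0.
  move=> xvw /(dg _ _ xvw) dgx; have /g_der : derivable g x 1 by case: dgx.
  by rewrite derive_val.
have hle := lipschitz_distribution_le vw (divr_gt0 CD0 Dlp) G_incr G_left G_right.
(* If [C0 < 0], [G] is differentiable nowhere on []v, w[]; the bound with constant [0] then holds
   vacuously and gives [1 <= 0]. *)
have C00 : 0 <= C0.
  rewrite leNgt; apply/negP => C0n.
  have : 1 <= (0 : R) * (w - v).
    apply: hle => // x l xvw /(dle _ _ xvw) h1.
    by have := le_lt_trans h1 C0n; rewrite normr_lt0.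
  by rewrite mul0r ler10.
have q0 : 0 <= (C0 + D) / Dl.
  by apply: divr_ge0 (ltW Dlp); rewrite addr_ge0 // /D addr_ge0 // ltW.
split => //.
suff : 1 <= (C0 + D) / Dl * (w - v).
  by rewrite mulrAC ler_pdivlMr // mul1r /Dl /h; clear; lra.
apply: hle => // x l xvw /(dle _ _ xvw) h1; rewrite ler_pdivlMr //.
by have := le_trans (ler_norm _) h1; rewrite mulrC; clear; lra.
Qed.

End GlobalLipschitz.

Lemma derivative_bound_lipschitz {R : realType} (g : R -> R) (C0 : R) :
  (forall K, 0 < K -> exists2 C : R, 0 < C &
    forall v w, v \in `[- K, K] -> w \in `[- K, K] -> `|g v - g w| <= C * `|v - w|) ->
  (forall s, derivable g s 1 -> `|'D_1 g s| <= C0) ->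
  0 <= C0 /\ forall v w, `|g v - g w| <= C0 * `|v - w|.
Proof.
move=> gl gd; split; first by have [] := lipschitz_increment gl gd ltr01.
have key v w : v < w -> `|g w - g v| <= C0 * (w - v).
  move=> vw; have [_ h1] := lipschitz_increment gl gd vw.
  have [||_ h2] := @lipschitz_increment _ (fun x => - g x) C0 _ _ _ _ vw.
  - move=> K /gl [C CC hC]; exists C => // a b ha hb.
    by rewrite -opprD normrN; exact: hC.
  - move=> s ds; have dg : derivable g s 1.
      by rewrite (_ : g = - (fun x => - g x)); [exact: derivableN|apply/funext => x /=; rewrite opprK].
    by rewrite deriveN // normrN; exact: gd.
  by rewrite ler_norml; apply/andP; split => //; move: h2; clear; lra.
move=> v w; have [vw|wv|->] := ltgtP v w.
- by rewrite distrC (distrC v) (gtr0_norm (_ : 0 < w - v)) ?subr_gt0 //; exact: key.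
- by rewrite (gtr0_norm (_ : 0 < v - w)) ?subr_gt0 //; exact: key.
by rewrite !subrr normr0 mulr0.
Qed.

(** * Families of functions monotone under reflections *)

(** Without a common point of [A] and [B] in [I], the trace of [A] on the connected set [I] would be
    both open and closed. *)
Lemma interval_closed_cover {R : realType} (I A B : set R) :
  is_interval I -> closed A -> closed B -> I `<=` A `|` B -> I `&` A !=set0 ->
  (I `&` (A `&` B)) !=set0 \/ I `<=` A.
Proof.
move=> /connected_intervalP cI cA cB IAB IA.
have [|no] := pselect ((I `&` (A `&` B)) !=set0); first by left.
right; have <- : I `&` A = I; last by move=> x [].
apply: cI => //.
  exists (~` B); first exact: closed_openC.
  apply/seteqP; split => x [Ix h]; split => //.
    by move=> Bx; apply: no; exists x.
  by case: (IAB x Ix).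
by exists A.
Qed.

Lemma local_mono {R : realType} (g : R -> R) (l r d : R) : 0 < d ->
  (forall s t, l <= s -> s <= t -> t <= r -> t - s <= d -> g s <= g t) ->
  forall s t, l <= s -> s <= t -> t <= r -> g s <= g t.
Proof.
move=> d0 loc s t ls st tr.
have key n : forall a, l <= a -> a <= t -> t - a <= n%:R * d -> g a <= g t.
  elim: n => [|n IH] a la at_ tad.
    have -> : a = t by apply: le_anti; rewrite at_ /=; move: tad; rewrite mul0r; lra.
    by [].
  have [tad'|tad'] := leP (t - a) d; first exact: loc.
  apply: le_trans (loc a (a + d) _ _ _ _) (IH (a + d) _ _ _) => //; try lra.
have [n hn] : exists n : nat, (t - s) / d < n%:R.
  exists (Num.bound `|(t - s) / d|); apply: le_lt_trans (ler_norm _) _.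
  exact: archi_boundP (normr_ge0 _).
by apply: (key n) => //; rewrite -ler_pdivrMr // ltW.
Qed.

(* While positive, [s] is concave, with second difference [- k * s]. *)
Lemma rotation_visits {R : realType} (s : nat -> R) (k : R) : 0 < k ->
  (forall n, s n.+2 + s n = (2 - k) * s n.+1) -> exists n, s n <= 0.
Proof.
move=> k0 hs; apply: contrapT => no.
have pos n : 0 < s n by rewrite ltNge; apply/negP => h; apply: no; exists n.
pose d n := s n.+1 - s n.
have dS n : d n.+1 = d n - k * s n.+1 by rewrite /d; have := hs n; lra.
have arch (a b : R) : 0 < b -> exists n : nat, a < n%:R * b.
  move=> b0; exists (Num.bound `|a / b|); rewrite -ltr_pdivrMr //.
  exact: le_lt_trans (ler_norm _) (archi_boundP (normr_ge0 _)).
have d0 n : 0 <= d n.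
  rewrite leNgt; apply/negP => dn.
  have dj j : d (n + j)%N <= d n.
    elim: j => [|j IH]; first by rewrite addn0.
    rewrite addnS dS; apply: le_trans IH; rewrite gerBl mulr_ge0 ?ltW //.
  have sj j : s (n + j)%N <= s n + j%:R * d n.
    elim: j => [|j IH]; first by rewrite addn0 mul0r addr0.
    have := dj j; rewrite /d -!addnS -(natr1 j) mulrDl mul1r => h.
    by rewrite addnS; move: IH h; rewrite addnS /d; lra.
  have dn' : 0 < - d n by rewrite oppr_gt0.
  have [j hj] := arch (s n) _ dn'.
  by have := sj j; have := pos (n + j)%N; move: hj; lra.
have s0 n : s 0%N <= s n.
  by elim: n => // n IH; apply: le_trans IH _; rewrite -subr_ge0; exact: d0.
have dn n : d n <= d 0%N - n%:R * (k * s 0%N).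
  elim: n => [|n IH]; first by rewrite mul0r subr0.
  have h : k * s 0%N <= k * s n.+1 by rewrite ler_pM2l.
  by rewrite dS -natr1 mulrDl mul1r; lra.
have [n hn] := arch (d 0%N) (k * s 0%N) (mulr_gt0 k0 (pos 0%N)).
by have := dn n; have := d0 n; lra.
Qed.

(** * Reflections in coordinates of a plane *)

Section Plane.
Context {R : realType} {N : nat}.
Implicit Types (x y e a b : 'rV[R]_N).

Lemma enorm1 e : enorm e = 1 <-> dot e e = 1.
Proof.
split => h; first by rewrite -sqr_enorm h expr1n.
by rewrite /enorm h sqrtr1.
Qed.

Lemma unit_normalize x : x <> 0 -> dot ((enorm x)^-1 *: x) ((enorm x)^-1 *: x) = 1.
Proof.
move=> x0; rewrite !dotE -sqr_enorm mulrA -expr2 -exprMn mulVf ?expr1n //.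
by apply/eqP => /enorm_eq0.
Qed.

Definition planar x a b (A B : R) := x + A *: a + B *: b.

Lemma planarE x a b : dot a a = 1 -> dot b b = 1 -> dot a b = 0 ->
  exists x', [/\ dot x' a = 0, dot x' b = 0 & x = planar x' a b (dot x a) (dot x b)].
Proof.
move=> a1 b1 ab; exists (x - dot x a *: a - dot x b *: b); split.
- by rewrite !dotE a1 (dotC b) ab; ring.
- by rewrite !dotE b1 ab; ring.
by apply/rowP => j; rewrite !mxE; ring.
Qed.

Lemma dot_planar x a b A B : dot a a = 1 -> dot b b = 1 -> dot a b = 0 ->
  dot x a = 0 -> dot x b = 0 ->
  [/\ dot (planar x a b A B) (planar x a b A B) = dot x x + (A ^+ 2 + B ^+ 2),
      dot (planar x a b A B) a = A & dot (planar x a b A B) b = B].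
Proof.
move=> a1 b1 ab xa xb; split; rewrite /planar !dotE ?(dotC a x) ?(dotC b x) ?(dotC b a) ?a1 ?b1 ?ab ?xa ?xb; ring.
Qed.

(** For [l = cos t], [m = sin t] the coefficients are the cosine and sine of the double angle
    [2 t]. *)
Lemma refl_planar x a b A B l m : dot a a = 1 -> dot b b = 1 -> dot a b = 0 ->
  dot x a = 0 -> dot x b = 0 -> l ^+ 2 + m ^+ 2 = 1 ->
  refl_hyp (l *: a + m *: b) (planar x a b A B) =
  planar x a b (- ((l ^+ 2 - m ^+ 2) * A) - 2 * l * m * B)
               ((l ^+ 2 - m ^+ 2) * B - 2 * l * m * A).
Proof.
move=> a1 b1 ab xa xb lm; rewrite /refl_hyp.
have -> : dot (planar x a b A B) (l *: a + m *: b) = A * l + B * m.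
  by have [_ h1 h2] := dot_planar A B a1 b1 ab xa xb; rewrite !dotDr !dotZr h1 h2; ring.
apply/rowP => j; rewrite /planar !mxE.
have l2 : l ^+ 2 = 1 - m ^+ 2 by rewrite -lm addrK.
have e1 : A - 2 * (A * l + B * m) * l = - ((l ^+ 2 - m ^+ 2) * A) - 2 * l * m * B.
  have -> : A - 2 * (A * l + B * m) * l = A - 2 * A * l ^+ 2 - 2 * l * m * B by ring.
  by rewrite l2; ring.
have e2 : B - 2 * (A * l + B * m) * m = ((l ^+ 2 - m ^+ 2) * B - 2 * l * m * A).
  by rewrite l2; ring.
by rewrite -e1 -e2; ring.
Qed.

Lemma enorm_planar x a b A B A' B' : dot a a = 1 -> dot b b = 1 -> dot a b = 0 ->
  dot x a = 0 -> dot x b = 0 -> A ^+ 2 + B ^+ 2 = A' ^+ 2 + B' ^+ 2 ->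
  enorm (planar x a b A B) = enorm (planar x a b A' B').
Proof.
move=> a1 b1 ab xa xb h; apply: eq_enorm.
have [-> _ _] := dot_planar A B a1 b1 ab xa xb.
by have [-> _ _] := dot_planar A' B' a1 b1 ab xa xb; rewrite h.
Qed.

Lemma dot_plane_unit a b l m : dot a a = 1 -> dot b b = 1 -> dot a b = 0 ->
  dot (l *: a + m *: b) (l *: a + m *: b) = l ^+ 2 + m ^+ 2.
Proof. by move=> a1 b1 ab; rewrite !dotE (dotC b a) a1 b1 ab; ring. Qed.

(** Equality of the norms is what makes the perpendicular bisector of [x] and [y] pass through the
    origin. *)
Lemma refl_swap x y : enorm x = enorm y -> x <> y -> exists e : 'rV[R]_N,
  [/\ e = (enorm (x - y))^-1 *: (x - y), dot e e = 1,
      dot x e = enorm (x - y) / 2 & refl_hyp e x = y].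
Proof.
move=> xy nxy; have ne : x - y <> 0 by move/eqP; rewrite subr_eq0 => /eqP.
have n0 : enorm (x - y) != 0 by apply/eqP => /enorm_eq0.
have xy2 : dot x x = dot y y by rewrite -!sqr_enorm xy.
have h : dot x (x - y) = enorm (x - y) ^+ 2 / 2.
  by rewrite sqr_enorm !dotE xy2 (dotC y x); field.
exists ((enorm (x - y))^-1 *: (x - y)).
have xe : dot x ((enorm (x - y))^-1 *: (x - y)) = enorm (x - y) / 2.
  by rewrite dotZr h; field.
split => //; first exact: unit_normalize.
rewrite /refl_hyp xe (_ : 2 * (_ / _) = enorm (x - y)); last by field.
by rewrite scalerA mulfV // scale1r opprB addrC subrK.
Qed.

Lemma complete_plane a e : (2 <= N)%N -> dot a a = 1 -> dot e e = 1 ->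
  exists b l m, [/\ dot b b = 1, dot a b = 0, l ^+ 2 + m ^+ 2 = 1, 0 <= m & e = l *: a + m *: b].
Proof.
move=> N2 a1 e1; pose w := e - dot e a *: a.
have wa : dot w a = 0 by rewrite /w !dotE a1; ring.
have [w0|w0] := pselect (w = 0); last first.
  exists ((enorm w)^-1 *: w), (dot e a), (enorm w).
  have ab : dot a ((enorm w)^-1 *: w) = 0 by rewrite dotZr dotC wa mulr0.
  have eE : e = dot e a *: a + enorm w *: ((enorm w)^-1 *: w).
    rewrite scalerA divff ?scale1r; first by rewrite /w addrC subrK.
    by apply/eqP => /enorm_eq0.
  split => //; [exact: unit_normalize| |exact: enorm_ge0].
  by have := dot_plane_unit (dot e a) (enorm w) a1 (unit_normalize w0) ab; rewrite -eE e1.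
have eE : e = dot e a *: a by move/eqP: w0; rewrite subr_eq0 => /eqP.
have [i hi] : exists i : 'I_N, (delta_mx 0 i : 'rV[R]_N) - a 0 i *: a <> 0.
  (* If every basis vector were a multiple of [a], then [a_i a_j] would be the Kronecker symbol,
     impossible for two different indices. *)
  apply: contrapT => no.
  have h i : (delta_mx 0 i : 'rV[R]_N) = a 0 i *: a.
    by apply/eqP; rewrite -subr_eq0; apply/eqP; apply: contrapT => h; apply: no; exists i.
  have Na i j : a 0 i * a 0 j = (i == j)%:R.
    by have /rowP/(_ j) := h i; rewrite !mxE eqxx /= eq_sym.
  have h00 := Na (Ordinal (ltnW N2 : (0 < N)%N)) (Ordinal (ltnW N2 : (0 < N)%N)).
  have h11 := Na (Ordinal N2) (Ordinal N2).
  have := Na (Ordinal (ltnW N2 : (0 < N)%N)) (Ordinal N2).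
  move/eqP; rewrite mulf_eq0 => /orP[] /eqP z; [move: h00|move: h11];
    by rewrite z mul0r eqxx => /esym/eqP; rewrite oner_eq0.
set w' := _ - _ in hi.
have wa' : dot a w' = 0 by rewrite dotC /w' !dotE a1 (dotC _ a) dot_delta; ring.
exists ((enorm w')^-1 *: w'), (dot e a), 0; split => //.
- exact: unit_normalize.
- by rewrite dotZr wa' mulr0.
- by move: e1; rewrite {1 2}eE !dotE a1; rewrite mulr1 -expr2 expr0n addr0.
by rewrite scale0r addr0.
Qed.

End Plane.

(** * The common axis of a reflection-monotone family *)

Section Symmetry.
Context {R : realType} {N : nat} (rad : R).
Variable U : set ('rV[R]_N -> R).
Hypothesis rad0 : 0 <= rad.
Hypothesis N2 : (2 <= N)%N.
Hypothesis U_cont : forall z, U z -> {within Sigma N rad, continuous z}.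
Implicit Types (x y e a b c d p : 'rV[R]_N).

Notation S := (Sigma N rad).

(** Quantified over the whole family at once, which is what makes the axis common to all its
    members. *)
Definition refl_mono e : Prop := dot e e = 1 /\
  forall z x, U z -> S x -> 0 <= dot x e -> z (refl_hyp e x) <= z x.

Definition refl_inv e : Prop := dot e e = 1 /\
  forall z x, U z -> S x -> z (refl_hyp e x) = z x.

Lemma Sigma_eq_enorm x y : enorm x = enorm y -> S x -> S y.
Proof. by move=> xy; rewrite !SigmaP xy. Qed.

Lemma refl_invE e : refl_inv e <-> refl_mono e /\ refl_mono (- e).
Proof.
split=> [[e1 h]|[[e1 h1] [_ h2]]].
  by split; split => [|z x Uz Sx _]; rewrite ?dotNl ?dotNr ?opprK // ?refl_hypN h.
split => // z x Uz Sx; apply: le_anti.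
have Sy : S (refl_hyp e x) by apply/Sigma_refl.
have [xe|xe] := leP 0 (dot x e).
  rewrite h1 //=; have := h2 _ _ Uz Sy.
  by rewrite refl_hypN refl_hypK // dotNr refl_dot // opprK; apply.
have := h2 _ _ Uz Sx; rewrite refl_hypN dotNr oppr_ge0 => -> /=; last exact: ltW.
have := h1 _ _ Uz Sy; rewrite refl_hypK // refl_dot // oppr_ge0 => -> //.
exact: ltW.
Qed.

Lemma refl_invN e : refl_inv e -> refl_inv (- e).
Proof.
by move=> [e1 h]; split => [|z x Uz Sx]; rewrite ?dotNl ?dotNr ?opprK // refl_hypN h.
Qed.

(** A violation at a point with [dot x e > 0] persists for nearby directions, and on the hyperplane
    the reflection fixes [x]. *)
Lemma closed_refl_mono : closed [set e | refl_mono e].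
Proof.
move=> e cle.
have e1 : dot e e = 1.
  have : closed ((fun x => dot x x) @^-1` [set (1 : R)]).
    apply: closed_comp; last exact: closed_eq.
    by move=> y _; exact: continuous_sqr_enorm.
  by apply; apply: closure_subset cle => y [].
split => // z x Uz Sx; rewrite le_eqVlt => /orP[/eqP/esym h|xe]; first by rewrite refl_hyp_id.
rewrite leNgt; apply/negP => zlt.
have Sy : S (refl_hyp e x) by apply/Sigma_refl.
have cz : {for refl_hyp e x, continuous z}.
  have := U_cont Uz; rewrite continuous_open_subspace; last exact: open_Sigma.
  by apply; rewrite inE.
have cd : dot x e' @[e' --> e] --> dot x e.
  rewrite (_ : (fun e0 => dot x e0) = (fun e0 => dot e0 x)); last by apply/funext => ?; rewrite dotC.
  by rewrite dotC; exact: continuous_dotl.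
have cr : {for e, continuous (fun e' => refl_hyp e' x)}.
  have cs : (2 * dot x e') *: e' @[e' --> e] --> (2 * dot x e) *: e.
    exact: (cvgZ (cvgM (cvg_cst (2 : R)) cd) cvg_id).
  exact: (cvgB (cvg_cst x) cs).
have n1 : \forall e' \near e, z x < z (refl_hyp e' x).
  exact: (cvgr_gt _ (continuous_comp cr cz) _ zlt).
have n2 : \forall e' \near e, 0 < dot x e'.
  exact: (cvgr_gt _ cd _ xe).
have FF := nbhs_filter e.
have [e' [[_ he'] [h1 h2]]] := cle _ (filterI n1 n2).
by have := he' z x Uz Sx (ltW h2); rewrite leNgt h1.
Qed.

Definition circ a b (t : R) := cos t *: a + sin t *: b.

Lemma dot_circl a b t : dot a a = 1 -> dot a b = 0 -> dot (circ a b t) a = cos t.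
Proof. by move=> a1 ab; rewrite /circ dotDl !dotZl a1 (dotC b) ab mulr1 mulr0 addr0. Qed.

Lemma circ_unit a b t : dot a a = 1 -> dot b b = 1 -> dot a b = 0 ->
  dot (circ a b t) (circ a b t) = 1.
Proof. by move=> a1 b1 ab; rewrite /circ dot_plane_unit // cos2Dsin2. Qed.

Lemma continuous_circ a b : continuous (circ a b).
Proof.
move=> t; apply: cvgD; apply: cvgZr_tmp; first exact: continuous_cos.
exact: continuous_sin.
Qed.

(* sigma_a o sigma_(circ a b t) is the rotation of the plane by the angle 2 t,
   and z is invariant under sigma_a: z increases along small rotations. *)
Lemma planar_mono a b x (t1 A B A' B' : R) z : U z -> 0 < t1 -> refl_inv a ->
  dot b b = 1 -> dot a b = 0 -> dot x a = 0 -> dot x b = 0 ->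
  (forall t, 0 <= t <= t1 -> refl_mono (circ a b t)) ->
  A ^+ 2 + B ^+ 2 = A' ^+ 2 + B' ^+ 2 -> B' <= B -> S (planar x a b A B) ->
  z (planar x a b A' B') <= z (planar x a b A B).
Proof.
move=> Uz t10 [a1 ha] b1 ab xa xb hM hAB BB SAB.
have flip A0 B0 : S (planar x a b A0 B0) -> z (planar x a b (- A0) B0) = z (planar x a b A0 B0).
  move=> S0; rewrite -(ha _ _ Uz S0).
  have l1 : (1 : R) ^+ 2 + 0 ^+ 2 = 1 by ring.
  have := refl_planar A0 B0 a1 b1 ab xa xb l1; rewrite scale1r scale0r addr0 => ->.
  by congr (z (planar _ _ _ _ _)); ring.
have S' A0 B0 : A0 ^+ 2 + B0 ^+ 2 = A ^+ 2 + B ^+ 2 -> S (planar x a b A0 B0).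
  by move=> h; apply: Sigma_eq_enorm SAB; exact: enorm_planar.
have absE A0 B0 : A0 ^+ 2 + B0 ^+ 2 = A ^+ 2 + B ^+ 2 ->
    z (planar x a b `|A0| B0) = z (planar x a b A0 B0).
  by move=> h; case: (ger0P A0) => // _; rewrite flip //; exact: S'.
(* With nonnegative first coordinates both points have angles in [[- pi / 2, pi / 2]], where the
   order of the second coordinates is that of the angles. *)
rewrite -(absE A B) // -(absE A' B') //.
pose r := Num.sqrt (A ^+ 2 + B ^+ 2).
have r0 : 0 <= r by exact: sqrtr_ge0.
have r2 : r ^+ 2 = A ^+ 2 + B ^+ 2 by rewrite sqr_sqrtr // addr_ge0 ?sqr_ge0.
pose g s := z (planar x a b (r * cos s) (r * sin s)).
have Sg s : S (planar x a b (r * cos s) (r * sin s)).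
  by apply: S'; rewrite !exprMn -mulrDr cos2Dsin2 mulr1.
have param A0 B0 : A0 ^+ 2 + B0 ^+ 2 = A ^+ 2 + B ^+ 2 -> 0 < r ->
    [/\ z (planar x a b `|A0| B0) = g (asin (B0 / r)), -1 <= B0 / r <= 1 &
        - (pi / 2) <= asin (B0 / r) <= pi / 2].
  move=> h rp.
  have hB : B0 ^+ 2 <= r ^+ 2 by rewrite r2 -h lerDr sqr_ge0.
  have hB' : -1 <= B0 / r <= 1.
    have : `|B0| <= r by rewrite -[leRHS]ger0_norm // -ler_sqr ?nnegrE // !real_normK ?num_real.
    by rewrite ler_norml => /andP[h1 h2]; rewrite ler_pdivlMr // mulN1r h1 ler_pdivrMr // mul1r.
  split => //; last by rewrite asin_geNpi2 // asin_lepi2.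
  rewrite /g cos_asin // asinK ?in_itv //= mulrCA divff ?mulr1 ?gt_eqF //.
  congr (z (planar _ _ _ _ _)).
  have E : A0 ^+ 2 = r ^+ 2 * (1 - (B0 / r) ^+ 2).
    rewrite expr_div_n mulrBr mulr1 mulrCA divff ?mulr1 ?expf_neq0 ?gt_eqF //.
    by rewrite r2 -h addrK.
  by rewrite -sqrtr_sqr E sqrtrM ?sqr_ge0 // sqrtr_sqr ger0_norm.
have [rp|rn] := ltP 0 r; last first.
  have {}r0 : r = 0 by apply: le_anti; rewrite rn.
  have : A ^+ 2 + B ^+ 2 = 0 by rewrite -r2 r0 expr0n.
  have zz A0 B0 : A0 ^+ 2 + B0 ^+ 2 = 0 :> R -> A0 = 0 /\ B0 = 0.
    move=> h; split; apply/eqP; rewrite -sqrf_eq0 eq_le sqr_ge0 andbT -h.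
      by rewrite lerDl sqr_ge0.
    by rewrite lerDr sqr_ge0.
  move=> h0; have [-> ->] := zz _ _ h0; rewrite hAB in h0.
  by have [-> ->] := zz _ _ h0.
have [-> b1' i1] := param A B erefl rp; have [-> b2' i2] := param A' B' (esym hAB) rp.
apply: (@local_mono _ g (- (pi / 2)) (pi / 2) (2 * t1)) => //; last 1 first.
- by case/andP: i1.
- by rewrite mulr_gt0.
- move=> s t sl st tr std.
  (* Reflection at the angle [al] followed by [flip] takes the angle [t] to [t - 2 * al = s];
     monotonicity applies because [cos (t - al) >= 0]. *)
  pose al := (t - s) / 2.
  have hal : 0 <= al <= t1 by rewrite /al; lra.
  have [m1 h1] := hM al hal.
  have E2 : s = t - (al + al) by rewrite /al; lra.
  have ca : - (pi / 2) <= t - al <= pi / 2 by rewrite /al; lra.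
  have cc : 0 <= cos (t - al) by exact: cos_ge0_pihalf.
  have := h1 z _ Uz (Sg t); rewrite /circ refl_planar //; last exact: cos2Dsin2.
  have [_ da db] := dot_planar (r * cos t) (r * sin t) a1 b1 ab xa xb.
  rewrite dotDr !dotZr da db.
  have -> : cos al * (r * cos t) + sin al * (r * sin t) = r * cos (t - al) by rewrite cosB; ring.
  move=> /(_ (mulr_ge0 r0 cc)); rewrite /g -(flip _ _ (Sg s)).
  congr (z (planar _ _ _ _ _) <= _); rewrite E2 ?cosB ?sinB cosD sinD; ring.
- by case/andP: i2.
rewrite leNgt; apply/negP; rewrite -ltr_sin ?in_itv //= !asinK ?in_itv //=.
by rewrite ltr_pM2r ?invr_gt0 // ltNge BB.
Qed.

(** The symmetric end [a] of the arc is taken as reference, with [b] orthogonal to it and pointing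
    back along the arc. By [planar_mono] the functions increase with the [b]-coordinate on circles
    of the plane, so a normal in the plane is monotone as soon as its [b]-component is
    nonnegative. *)
Lemma circ_cover e0 : dot e0 e0 = 1 ->
  (forall v, dot v v = 1 -> dot e0 v = 0 -> exists t1 : R, [/\ 0 < t1,
     forall t, 0 <= t <= t1 -> refl_mono (circ e0 v t) & refl_inv (circ e0 v t1)]) ->
  forall e, dot e e = 1 -> refl_mono e \/ refl_mono (- e).
Proof.
move=> e01 hrot e e1.
have [v [l [m [v1 ev lm m0 eE]]]] := complete_plane N2 e01 e1.
have [t1 [t10 hM hH]] := hrot v v1 ev.
pose a := circ e0 v t1; pose b := sin t1 *: e0 - cos t1 *: v.
have a1 : dot a a = 1 by exact: circ_unit.
have b1 : dot b b = 1.
  rewrite /b -scaleNr dot_plane_unit // sqrrN addrC; exact: cos2Dsin2.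
have ab : dot a b = 0.
  by rewrite /a /b /circ !dotE (dotC v e0) e01 v1 ev; ring.
have arcE s : circ a b s = circ e0 v (t1 - s).
  by rewrite /circ /a /b /circ cosB sinB; apply/rowP => j; rewrite !mxE; ring.
have hM' s : 0 <= s <= t1 -> refl_mono (circ a b s).
  by move=> hs; rewrite arcE; apply: hM; lra.
have [x' [xa xb xE]] := planarE e a1 b1 ab.
(* The two coordinates of the unit vector [e] in the plane already exhaust its length. *)
have x'0 : x' = 0.
  apply: dot_eq0; have [h _ _] := dot_planar (dot e a) (dot e b) a1 b1 ab xa xb.
  have ea : dot e a = l * cos t1 + m * sin t1.
    by rewrite eE /a /circ !dotE (dotC v e0) e01 v1 ev; ring.
  have eb : dot e b = l * sin t1 - m * cos t1.
    by rewrite eE /b !dotE (dotC v e0) e01 v1 ev; ring.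
  have := cos2Dsin2 t1; move: h; rewrite -xE e1 ea eb => h h'.
  have -> : dot x' x' = 1 - (l ^+ 2 + m ^+ 2) * (cos t1 ^+ 2 + sin t1 ^+ 2).
    by rewrite h; ring.
  by rewrite lm h'; ring.
have mono f : dot f f = 1 -> f = planar 0 a b (dot f a) (dot f b) -> 0 <= dot f b -> refl_mono f.
  move=> f1 fE fb; split => // z x Uz Sx xf.
  have [y [ya yb yE]] := planarE x a1 b1 ab.
  have fE' : f = dot f a *: a + dot f b *: b by rewrite {1}fE /planar add0r.
  have lmf : dot f a ^+ 2 + dot f b ^+ 2 = 1 by rewrite -(dot_plane_unit _ _ a1 b1 ab) -fE'.
  have xf' : 0 <= dot x a * dot f a + dot x b * dot f b.
    by have := xf; rewrite {1}fE' dotDr !dotZr; rewrite (mulrC (dot f a)) (mulrC (dot f b)).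
  rewrite {1}fE' {1}yE refl_planar // [in leRHS]yE.
  set l' := dot f a in lmf xf' *; set m' := dot f b in fb lmf xf' *.
  have l2 : l' ^+ 2 = 1 - m' ^+ 2 by rewrite -lmf addrK.
  apply: (@planar_mono a b y t1) => //.
  - have l4 : (l' ^+ 2) ^+ 2 = (1 - m' ^+ 2) ^+ 2 by rewrite l2.
    transitivity ((l' ^+ 2 + m' ^+ 2) ^+ 2 * (dot x a ^+ 2 + dot x b ^+ 2)); last by ring.
    by rewrite lmf; ring.
  - by rewrite l2 -subr_ge0; have := mulr_ge0 xf' fb; move: (dot x a) (dot x b) => A B; lra.
  by rewrite -yE.
have [eb|eb] := leP 0 (dot e b).
  by left; apply: mono => //; rewrite {1}xE x'0.
right; apply: mono; rewrite ?dotNl ?dotNr ?opprK //; last by rewrite oppr_ge0 ltW.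
by rewrite {1}xE x'0 /planar !scaleNr !opprD oppr0.
Qed.

Hypothesis cover : forall e, dot e e = 1 -> refl_mono e \/ refl_mono (- e).

Lemma closed_circ_mono a b : closed [set t | refl_mono (circ a b t)].
Proof.
apply: (closed_comp (f := circ a b) _ closed_refl_mono).
by move=> t _; exact: continuous_circ.
Qed.

Lemma closed_circ_monoN a b : closed [set t | refl_mono (- circ a b t)].
Proof.
apply: (closed_comp (f := fun t => - circ a b t) _ closed_refl_mono).
by move=> t _; apply: cvgN; exact: continuous_circ.
Qed.

Lemma circ0 a b : circ a b 0 = a.
Proof. by rewrite /circ cos0 sin0 scale1r scale0r addr0. Qed.

Lemma circpi a b : circ a b pi = - a.
Proof. by rewrite /circ cospi sinpi scaleN1r scale0r addr0. Qed.

(** On the half circle from [a] to [- a] two closed conditions cover everything and exchange roles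
    at the ends, so by connectedness they hold simultaneously somewhere. *)
Lemma inv_in_plane a b : dot a a = 1 -> dot b b = 1 -> dot a b = 0 ->
  exists t, refl_inv (circ a b t).
Proof.
move=> a1 b1 ab.
have I : is_interval (`[0, pi]%classic : set R) by exact: interval_is_interval.
have i0 : (`[0, pi]%classic : set R) 0 by rewrite /= in_itv /= lexx pi_ge0.
have ipi : (`[0, pi]%classic : set R) pi by rewrite /= in_itv /= lexx pi_ge0.
have cov t : refl_mono (circ a b t) \/ refl_mono (- circ a b t).
  by apply: cover; exact: circ_unit.
have [ma|ma] := cover a1.
  have [||[t [_ [h1 h2]]]|h] := interval_closed_cover I (@closed_circ_mono a b) (@closed_circ_monoN a b).
  - by move=> t _; exact: cov.
  - by exists 0; split => //=; rewrite circ0.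
  - by exists t; apply/refl_invE.
  by exists 0; apply/refl_invE; rewrite circ0; split => //; have := h _ ipi; rewrite /= circpi.
have [||[t [_ [h1 h2]]]|h] := interval_closed_cover I (@closed_circ_monoN a b) (@closed_circ_mono a b).
- by move=> t _; case: (cov t); [right|left].
- by exists 0; split => //=; rewrite circ0.
- by exists t; apply/refl_invE.
exists 0; apply/refl_invE; rewrite circ0; split => //.
by have := h _ ipi; rewrite /= circpi opprK.
Qed.

(* The rotation sigma_(k a + n b) o sigma_a preserves z, and its iterates move
   every point of the plane to the other side of the hyperplane of symmetry. *)
Lemma circle_mono_inv a b (k n l m : R) : dot b b = 1 -> dot a b = 0 ->
  refl_inv a -> refl_inv (k *: a + n *: b) -> k ^+ 2 + n ^+ 2 = 1 -> n != 0 ->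
  l ^+ 2 + m ^+ 2 = 1 -> refl_mono (l *: a + m *: b) -> refl_inv (l *: a + m *: b).
Proof.
move=> b1 ab [a1 ha] [_ ha'] kn n0 lm [e1 he]; split => // z x Uz Sx.
have [y [ya yb yE]] := planarE x a1 b1 ab.
pose p := k ^+ 2 - n ^+ 2; pose q := 2 * k * n.
have pq : p ^+ 2 + q ^+ 2 = 1.
  by rewrite (_ : _ + _ = (k ^+ 2 + n ^+ 2) ^+ 2); [rewrite kn expr1n|rewrite /p /q; ring].
pose P := l ^+ 2 - m ^+ 2; pose Q := 2 * l * m.
have PQ : P ^+ 2 + Q ^+ 2 = 1.
  by rewrite (_ : _ + _ = (l ^+ 2 + m ^+ 2) ^+ 2); [rewrite lm expr1n|rewrite /P /Q; ring].
pose r2 := dot x a ^+ 2 + dot x b ^+ 2.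
have SZ A B : A ^+ 2 + B ^+ 2 = r2 -> S (planar y a b A B).
  by move=> h; move: Sx; rewrite yE; apply: Sigma_eq_enorm; apply: enorm_planar.
pose Z A B := z (planar y a b A B).
have Za A B : A ^+ 2 + B ^+ 2 = r2 -> Z (- A) B = Z A B.
  move=> h; rewrite /Z -(ha _ _ Uz (SZ _ _ h)).
  have l1 : (1 : R) ^+ 2 + 0 ^+ 2 = 1 by ring.
  have := refl_planar A B a1 b1 ab ya yb l1; rewrite scale1r scale0r addr0 => ->.
  by congr (z (planar _ _ _ _ _)); ring.
have Zrot A B : A ^+ 2 + B ^+ 2 = r2 -> Z (p * A - q * B) (q * A + p * B) = Z A B.
  move=> h; rewrite -(Za A B h) /Z -(ha' _ (planar y a b (- A) B) Uz).
    by rewrite refl_planar //; congr (z (planar _ _ _ _ _)); rewrite /p /q; ring.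
  by apply: SZ; rewrite sqrrN.
have Zref A B : A ^+ 2 + B ^+ 2 = r2 -> 0 <= l * A + m * B ->
    Z (- (P * A) - Q * B) (P * B - Q * A) <= Z A B.
  move=> h pos; have := he z _ Uz (SZ _ _ h).
  have [_ da db] := dot_planar A B a1 b1 ab ya yb.
  by rewrite dotDr !dotZr da db refl_planar // => /(_ pos).
have nrm A B : A ^+ 2 + B ^+ 2 = r2 -> (p * A - q * B) ^+ 2 + (q * A + p * B) ^+ 2 = r2.
  by move=> h; rewrite -h -[RHS]mul1r -pq; ring.
have nrmP A B : A ^+ 2 + B ^+ 2 = r2 -> (- (P * A) - Q * B) ^+ 2 + (P * B - Q * A) ^+ 2 = r2.
  by move=> h; rewrite -h -[RHS]mul1r -PQ; ring.
have refK1 A B : - (P * (- (P * A) - Q * B)) - Q * (P * B - Q * A) = A.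
  by rewrite -[RHS]mul1r -PQ; ring.
have refK2 A B : P * (P * B - Q * A) - Q * (- (P * A) - Q * B) = B.
  by rewrite -[RHS]mul1r -PQ; ring.
have key A B : A ^+ 2 + B ^+ 2 = r2 -> Z A B <= Z (- (P * A) - Q * B) (P * B - Q * A).
  move=> h.
  pose v j := iter j (fun w : R * R => (p * w.1 - q * w.2, q * w.1 + p * w.2)) (A, B).
  have vn j : (v j).1 ^+ 2 + (v j).2 ^+ 2 = r2.
    by elim: j => // j IH; rewrite /v iterS -/(v j) /=; exact: nrm.
  have Zv j : Z (v j).1 (v j).2 = Z A B.
    by elim: j => // j IH; rewrite /v iterS -/(v j) /= Zrot.
  have Zrv j : Z (- (P * (v j).1) - Q * (v j).2) (P * (v j).2 - Q * (v j).1) =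
      Z (- (P * A) - Q * B) (P * B - Q * A).
    elim: j => // j <-; rewrite /v iterS -/(v j) /=.
    move: (vn j); case: (v j) => A0 B0 /= h0.
    rewrite -Zrot; last by apply: nrmP; exact: nrm.
    congr Z; rewrite -[RHS]mul1r -pq; ring.
  have [j hj] : exists j, l * (v j).1 + m * (v j).2 <= 0.
    (* Iterates of a rotation with cosine [p] satisfy [v (j + 2) + v j = 2 p v (j + 1)], and
       [2 - 2 * p = 4 * n ^+ 2] is positive. *)
    apply: (@rotation_visits _ (fun j => l * (v j).1 + m * (v j).2) (2 - 2 * p)).
      have n2 : 0 < n ^+ 2 by rewrite exprn_even_gt0.
      by rewrite /p; move: kn n2; lra.
    move=> j; rewrite /v !iterS -/(v j) /=; move: (v j) => -[A0 B0] /=.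
    rewrite (_ : l * A0 + m * B0 = (p ^+ 2 + q ^+ 2) * (l * A0 + m * B0)).
      by ring.
    by rewrite pq mul1r.
  (* The iterate lies on the nonpositive side, so its mirror image lies on the other one and
     monotonicity there is the reverse inequality. *)
  rewrite -(Zv j) -(Zrv j).
  have := Zref _ _ (nrmP _ _ (vn j)).
  rewrite refK1 refK2; apply.
  have l2 : l ^+ 2 = 1 - m ^+ 2 by rewrite -lm addrK.
  have -> : l * (- (P * (v j).1) - Q * (v j).2) + m * (P * (v j).2 - Q * (v j).1) =
    - ((l ^+ 2 + m ^+ 2) * (l * (v j).1 + m * (v j).2)) by rewrite /P /Q; ring.
  by rewrite lm mul1r oppr_ge0.
rewrite [in RHS]yE {1}yE refl_planar // -/P -/Q.
have h0 : dot x a ^+ 2 + dot x b ^+ 2 = r2 by [].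
apply: le_anti; rewrite [X in _ && X]key // andbT.
have := key _ _ (nrmP _ _ h0).
by rewrite refK1 refK2.
Qed.

(** By [cover], [e] or [- e] is monotone, and [circle_mono_inv] upgrades this. Two nonparallel
    symmetry directions thus make the whole circle of their plane symmetric. *)
Lemma circle_inv a b e (k n : R) : dot b b = 1 -> dot a b = 0 ->
  refl_inv a -> refl_inv (k *: a + n *: b) -> k ^+ 2 + n ^+ 2 = 1 -> n != 0 ->
  dot e e = 1 -> e = dot e a *: a + dot e b *: b -> refl_inv e.
Proof.
move=> b1 ab ha hk kn n0 e1 eE; have [a1 _] := ha.
have lm : dot e a ^+ 2 + dot e b ^+ 2 = 1 by rewrite -(dot_plane_unit _ _ a1 b1 ab) -eE.
have [me|me] := cover e1.
  by rewrite eE; rewrite eE in me; exact: (circle_mono_inv b1 ab ha hk).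
rewrite -[e]opprK; apply: refl_invN.
have eE' : - e = (- dot e a) *: a + (- dot e b) *: b by rewrite {1}eE opprD !scaleNr.
rewrite eE'; rewrite eE' in me.
by apply: (circle_mono_inv b1 ab ha hk) => //; rewrite !sqrrN.
Qed.

Lemma compact_refl_inv : compact [set e | refl_inv e].
Proof.
have -> : [set e | refl_inv e] = [set e | refl_mono e] `&` (-%R @^-1` [set e | refl_mono e]).
  by apply/seteqP; split => e; rewrite /= refl_invE.
apply: (@ebounded_closed_compact _ _ _ 1).
  by move=> e [[e1 _] _]; rewrite (enorm1 e).2.
apply: closedI; first exact: closed_refl_mono.
apply: closed_comp; last exact: closed_refl_mono.
by move=> y _; exact: opp_continuous.
Qed.

(* p is the component of q orthogonal to a symmetry direction h that maximizes
   h.q; by [circle_inv] the symmetry directions form the sphere of a subspace. *)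
Lemma symmetry_axis q : dot q q = 1 -> ~ refl_inv q -> exists p,
  dot p p = 1 /\ forall e, dot e e = 1 -> refl_inv e <-> dot e p = 0.
Proof.
move=> q1 nq.
have ne : [set e | refl_inv e] !=set0.
  have [v [_ [_ [v1 qv _ _ _]]]] := complete_plane N2 q1 q1.
  by have [t ht] := inv_in_plane q1 v1 qv; exists (circ q v t).
have [h] := @EVT_max_rV R N (fun e => dot e q) _ ne compact_refl_inv
  (continuous_subspaceT (@continuous_dotl R N q)).
rewrite inE /= => hh hmax.
have {}hmax e : refl_inv e -> dot e q <= dot h q by move=> he; apply: hmax; rewrite inE.
have h1 := hh.1.
pose w := q - dot h q *: h.
have w0 : w <> 0.
  move=> w0; have qE : q = dot h q *: h by move/eqP: w0; rewrite subr_eq0 => /eqP.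
  have c2 : dot h q ^+ 2 = 1.
    by have := q1; rewrite {1 2}qE !dotE h1 mulr1 -expr2.
  move/eqP: c2; rewrite sqrf_eq1 => /orP[] /eqP c; apply: nq; rewrite qE c.
    by rewrite scale1r.
  by rewrite scaleN1r; exact: refl_invN.
pose p := (enorm w)^-1 *: w.
have p1 : dot p p = 1 by exact: unit_normalize.
have wh : dot h w = 0 by rewrite /w !dotE h1; ring.
have Hp e : refl_inv e -> dot e w = 0.
  move=> he; have e1 := he.1.
  have [b [l [m [b1 hb lm m0 eE]]]] := complete_plane N2 h1 e1.
  have [z0|mn] := eqVneq m 0.
    by rewrite eE z0 scale0r addr0 dotZl wh mulr0.
  have eE' : refl_inv (l *: h + m *: b) by rewrite -eE.
  have circ t : refl_inv (circ h b t).
    apply: (circle_inv b1 hb hh eE') => //; first exact: circ_unit.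
    by rewrite /circ !dotE (dotC b h) h1 b1 hb !mulr0 !mulr1 addr0 add0r.
  have bw : dot b w = 0.
    have bq : dot b w = dot b q by rewrite /w !dotE (dotC b h) hb; ring.
    rewrite bq; pose r := dot h q ^+ 2 + dot b q ^+ 2.
    have hq0 : 0 <= dot h q.
      have := hmax _ (refl_invN hh); rewrite dotNl; lra.
    have [//|bn] := eqVneq (dot b q) 0.
    have r0 : 0 < Num.sqrt r.
      by rewrite sqrtr_gt0 /r ltr_wpDl ?sqr_ge0 // exprn_even_gt0.
    have rr : Num.sqrt r ^+ 2 = r by rewrite sqr_sqrtr // addr_ge0 ?sqr_ge0.
    (* The normalized projection of [q] onto the plane of [h] and [b]: a symmetry direction that
       would beat the maximizer [h] unless [dot b q = 0]. *)
    pose f := (dot h q / Num.sqrt r) *: h + (dot b q / Num.sqrt r) *: b.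
    have f1 : dot f f = 1.
      rewrite /f dot_plane_unit // !expr_div_n -mulrDl -/r rr divff //.
      by rewrite -rr expf_neq0 // gt_eqF.
    have : refl_inv f.
      apply: (circle_inv b1 hb hh eE') => //.
      by rewrite /f !dotE (dotC b h) h1 b1 hb !mulr0 !mulr1 addr0 add0r.
    move=> /hmax; rewrite /f dotDl !dotZl mulrAC -expr2 [X in _ + X]mulrAC -expr2 -mulrDl -/r.
    rewrite -{1}rr expr2 mulfK ?gt_eqF // => h2.
    have : r <= dot h q ^+ 2 by rewrite -rr ler_sqr ?nnegrE // ltW.
    rewrite /r gerDl => h3; apply/eqP; rewrite -sqrf_eq0 eq_le h3 sqr_ge0 //.
  by rewrite eE dotDl !dotZl wh bw !mulr0 addr0.
exists p; split => // e e1; split => [/Hp h2|ep]; first by rewrite dotZr h2 mulr0.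
have pe : dot p e = 0 by rewrite dotC.
(* The plane of [p] and [e] contains a symmetry direction; it is orthogonal to [p], hence [e] or
   [- e]. *)
have [t ht] := inv_in_plane p1 e1 pe.
have := Hp _ ht => hw.
have c0 : cos t = 0.
  by rewrite -(dot_circl t p1 pe) dotZr hw mulr0.
have : sin t ^+ 2 = 1 by have := cos2Dsin2 t; rewrite c0 expr0n add0r.
move: ht; rewrite /circ c0 scale0r add0r => ht /eqP; rewrite sqrf_eq1 => /orP[] /eqP s1.
  by move: ht; rewrite s1 scale1r.
by have := refl_invN ht; rewrite s1 scaleN1r opprK.
Qed.

(** On the open half circle around [p] through [e] the product with [p] is positive, so no direction
    there is symmetric. Hence monotonicity cannot pass to the opposite direction along it. *)
Lemma axis_mono p : dot p p = 1 -> (forall e, dot e e = 1 -> refl_inv e <-> dot e p = 0) ->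
  refl_mono p -> forall e, dot e e = 1 -> 0 <= dot e p -> refl_mono e.
Proof.
move=> p1 Hp mp e e1; rewrite le_eqVlt => /orP[/eqP/esym /(Hp _ e1) /refl_invE[] //|ep].
have [v [l [m [v1 pv lm m0 eE]]]] := complete_plane N2 p1 e1.
have lE : dot e p = l by rewrite eE !dotE p1 (dotC v) pv; ring.
pose I : set R := `](- (pi / 2)), (pi / 2)[%classic.
have II : is_interval I by exact: interval_is_interval.
have pi0 : 0 < pi :> R by exact: pi_gt0.
have i0 : I 0 by rewrite /I /= in_itv /= oppr_lt0 divr_gt0.
have [||[t [It [h1 h2]]]|h] := interval_closed_cover II (@closed_circ_mono p v) (@closed_circ_monoN p v).
- by move=> t _; apply: cover; exact: circ_unit.
- by exists 0; split => //=; rewrite circ0.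
- have /Hp : refl_inv (circ p v t) by apply/refl_invE.
  rewrite circ_unit // => /(_ erefl); rewrite dot_circl // => c0.
  by have := cos_gt0_pihalf It; rewrite c0 ltxx.
have hl1 : -1 <= m <= 1.
  have : m ^+ 2 <= 1 ^+ 2 by rewrite expr1n -lm lerDr sqr_ge0.
  rewrite -[m ^+ 2]real_normK ?num_real // ler_sqr ?nnegrE // ler_norml => //.
have lp : 0 < l by rewrite -lE.
have mlt : -1 < m < 1.
  have m2 : m ^+ 2 != 1 by rewrite -lm -subr_eq0 opprD addrCA subrr addr0 oppr_eq0 sqrf_eq0 gt_eqF.
  move: m2 hl1; rewrite sqrf_eq1 negb_or => /andP[x1 x2] /andP[y1 y2].
  by rewrite !lt_neqAle y1 y2 x1 eq_sym x2.
have -> : e = circ p v (asin m).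
  rewrite eE /circ asinK ?in_itv //= cos_asin //.
  by rewrite -lm addrK sqrtr_sqr gtr0_norm.
apply: h; rewrite /I /= in_itv /=.
by case/andP: mlt => x1 x2; rewrite asin_gtNpi2 ?asin_ltpi2 // ?x1 ?x2 ?ltW.
Qed.

Lemma axis_exists : exists2 p, dot p p = 1 & forall e, dot e e = 1 -> 0 <= dot e p -> refl_mono e.
Proof.
pose q : 'rV[R]_N := delta_mx 0 (Ordinal (ltnW N2)).
have q1 : dot q q = 1 by rewrite dot_delta mxE !eqxx.
have [all|] := pselect (forall e, dot e e = 1 -> refl_inv e).
  by exists q => // e /all /refl_invE[].
move=> /existsNP[e /not_implyP[e1 ne]].
have [p [p1 Hp]] := symmetry_axis e1 ne.
have [mp|mp] := cover p1; first by exists p => // f; exact: axis_mono.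
have Np1 : dot (- p) (- p) = 1 by rewrite dotNl dotNr opprK.
exists (- p) => // f; apply: axis_mono => // g g1; rewrite Hp // dotNr.
by split => [->|/eqP]; rewrite ?oppr0 // oppr_eq0 => /eqP.
Qed.

(** The reflection exchanging two points of equal norm has normal along [y - x], so
    [dot x p <= dot y p] makes it monotone in that direction. Thus [z] depends on the norm and on
    the product with [p], increasingly in the latter. *)
Theorem symmetric_family_fss : exists2 p, enorm p = 1 &
  forall z, U z -> foliated_schwarz_symmetric S p z.
Proof.
have [p p1 hp] := axis_exists; exists p; first exact/enorm1.
move=> z Uz.
have mono x y : S x -> S y -> enorm x = enorm y -> dot x p <= dot y p -> z x <= z y.
  move=> Sx Sy xy xyp.
  have [->//|ne] := pselect (y = x).
  have [e [eE e1 ye <-]] := refl_swap (esym xy) ne.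
  have [|_ he] := hp e e1.
    rewrite eE dotZl; apply: mulr_ge0; first by rewrite invr_ge0 enorm_ge0.
    by rewrite dotDl dotNl subr_ge0.
  by apply: he => //; rewrite ye divr_ge0 // enorm_ge0.
have mono_eq x y : S x -> S y -> enorm x = enorm y -> dot x p = dot y p -> z x = z y.
  by move=> Sx Sy xy xyp; apply: le_anti; rewrite !mono // xyp.
split; first exact: U_cont.
  move=> Q Q1 pQ x Sx.
  have dE a b : dot a b = (a *m b^T) 0 0.
    by rewrite mxE; apply: eq_bigr => i _; rewrite mxE.
  have dQ a b : dot (a *m Q) (b *m Q) = dot a b.
    by rewrite !dE trmx_mul mulmxA -(mulmxA a) Q1 mulmx1.
  have nQ : enorm (x *m Q) = enorm x by apply: eq_enorm.
  apply: mono_eq => //; first by apply: Sigma_eq_enorm Sx.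
  by rewrite -{1}pQ dQ.
move=> x y Sx Sy xy; rewrite /polar_angle -xy !dotZl => hle.
(* At the origin the angle is computed from the inverse of [0], which is [0]; there [y = x]. *)
have [x0|x0] := eqVneq (enorm x) 0.
  have -> : x = 0 by exact: enorm_eq0.
  have -> // : y = 0 by apply: enorm_eq0; rewrite -xy.
have xp : 0 < enorm x by rewrite lt_neqAle eq_sym x0 enorm_ge0.
apply: mono => //; rewrite leNgt; apply/negP => lt.
have bnd w : enorm w = enorm x -> (enorm x)^-1 * dot w p \in `[-1, 1].
  move=> wx; have := cauchy_schwarz w p; rewrite wx (enorm1 p).2 // mulr1 ler_norml => /andP[h1 h2].
  by rewrite in_itv /= mulrC ler_pdivlMr // mulN1r h1 ler_pdivrMr // mul1r.
have := hle; rewrite leNgt => /negP; apply.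
have bx := bnd x erefl; have by_ := bnd y (esym xy).
rewrite -ltr_cos ?in_itv /= ?acosK //; last 2 first.
- by rewrite acos_ge0 ?acos_lepi.
- by rewrite acos_ge0 ?acos_lepi.
by rewrite ltr_pM2l ?invr_gt0.
Qed.

End Symmetry.

(** * Rotating the hyperplane *)

Lemma refl_close {R : realType} {N : nat} (e e' x : 'rV[R]_N) :
  dot e e = 1 -> dot e' e' = 1 ->
  enorm (refl_hyp e' x - refl_hyp e x) <= 4 * enorm (e' - e) * enorm x.
Proof.
move=> e1 e1'.
have -> : refl_hyp e' x - refl_hyp e x =
    - (2 * dot x (e' - e)) *: e' + - (2 * dot x e) *: (e' - e).
  by rewrite /refl_hyp dotDr dotNr; apply/rowP => j; rewrite !mxE; ring.
apply: le_trans (enormD _ _) _; rewrite !enormZ !normrN !normrM.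
rewrite (ger0_norm (ler0n _ 2)).
rewrite (enorm1 e').2 // mulr1.
have h1 := cauchy_schwarz x (e' - e); have := cauchy_schwarz x e.
rewrite (enorm1 e).2 // mulr1 => h2.
have h3 := ler_wpM2r (enorm_ge0 (e' - e)) h2.
have -> : 4 * enorm (e' - e) * enorm x = 2 * (enorm x * enorm (e' - e)) + 2 * (enorm x * enorm (e' - e)) by ring.
by apply: lerD; rewrite -?mulrA ler_pM2l.
Qed.

Section Asymptotics.
Context {R : realType} {N : nat} (rad : R).
Hypothesis rad0 : 0 <= rad.
Variables (V : R -> R) (C0 Lam K : R).
Hypothesis C00 : 0 <= C0.
Hypothesis Lam0 : 0 <= Lam.
Hypothesis V_lower : forall r, rad <= r -> C0 - V r <= Lam.
Hypothesis V_bounded : forall M, exists2 L : R, 0 <= L &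
  forall r, 0 <= r <= M -> `|V r| + C0 <= L.
Variable u : 'rV[R]_N -> R -> R.
Implicit Types (x y z e : 'rV[R]_N).

Notation S := (Sigma N rad).
Notation hd e := (half_domain (Sigma N rad) e).
Notation lsol := (linsol rad V C0).

Definition wdiff e x t := u x t - u (refl_hyp e x) t.

Hypothesis u_lsol : forall e, dot e e = 1 -> lsol e (wdiff e).
Hypothesis u_cont : {within [set x | rad <= enorm x] `*` `[0, +oo[,
  continuous (fun y : 'rV[R]_N * R => u y.1 y.2)}.
Hypothesis K0 : 0 <= K.
Hypothesis u_bound : forall x t, S x -> 0 < t -> `|u x t| <= K.
Hypothesis u_decay : forall eps : R, 0 < eps -> exists M : R, forall x t,
  S x -> 0 < t -> M < enorm x -> `|u x t| < eps.

Ltac glra :=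
  clear - rad0 C00 Lam0 V_lower V_bounded u_lsol u_cont K0 u_bound u_decay; lra.

Lemma wdiffN e x t : wdiff (- e) x t = wdiff e x t.
Proof. by rewrite /wdiff refl_hypN. Qed.

Lemma wdiff_refl e x t : dot e e = 1 -> wdiff e (refl_hyp e x) t = - wdiff e x t.
Proof. by move=> e1; rewrite /wdiff refl_hypK // opprB. Qed.

Lemma wdiff_bound e x t : dot e e = 1 -> S x -> 0 < t -> `|wdiff e x t| <= 2 * K.
Proof.
move=> e1 Sx t0; apply: le_trans (ler_normB _ _) _.
by rewrite mulr_natl mulr2n; apply: lerD; apply: u_bound => //; apply/Sigma_refl.
Qed.

(** Points of equal norm are exchanged by a reflection, so the difference is a value of [wdiff e] at
    distance [enorm (x - y) / 2] from its hyperplane. The constants of [strip_bound] are the same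
    for all directions. *)
Lemma angular_equicontinuity (eps : R) : 0 < eps -> exists d T : R, [/\ 0 < d, 1 <= T &
  forall x y t, S x -> T <= t -> enorm x = enorm y -> enorm (x - y) < d ->
    `|u x t - u y t| <= eps].
Proof.
move=> eps0.
have [d0 [A [d00 A0 hA]]] := @strip_bound R N rad V C0 Lam Lam0 V_lower (2 * K) (mulr_ge0 (ler0n _ 2) K0).
have [s s0 hs] := exp_decay (ltr01) (ltW A0) (divr_gt0 eps0 (ltr0n _ 2)).
exists (Num.min (2 * d0) (eps / A)), (1 + s); split.
- by rewrite lt_min mulr_gt0 // divr_gt0.
- by rewrite lerDl ltW.
move=> x y t Sx st xy; rewrite lt_min => /andP[xd xA].
have key a b : S a -> enorm a = enorm b -> enorm (a - b) < 2 * d0 -> enorm (a - b) < eps / A ->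
    - eps <= u a t - u b t.
  move=> Sa ab abd abA.
  have [->|nab] := pselect (a = b); first by rewrite subrr oppr_le0 ltW.
  have [e [eE e1 ae <-]] := refl_swap ab nab.
  have p0 : 0 < enorm (a - b).
    rewrite lt_neqAle enorm_ge0 andbT eq_sym; apply/eqP => /enorm_eq0 /eqP.
    by rewrite subr_eq0 => /eqP.
  have ha : hd e a by split => //; rewrite ae divr_gt0.
  have t1 : 1 <= t by apply: le_trans st; rewrite lerDl ltW.
  have aed : dot a e < d0 by rewrite ae ltr_pdivrMr // mulrC.
  have wb x0 t0 : hd e x0 -> 0 < t0 -> `|wdiff e x0 t0| <= 2 * K.
    by move=> [Sx0 _] t00; exact: wdiff_bound.
  have := hA e _ (u_lsol e1) wb a t ha t1 aed.
  rewrite ae /wdiff; apply: le_trans.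
  rewrite lerN2; have := hs (t - 1); rewrite mulN1r lerBrDl => /(_ st) h3.
  have : A * (enorm (a - b) / 2) <= eps / 2.
    by rewrite mulrA ler_pM2r ?invr_gt0 // mulrC -ler_pdivlMr // ltW.
  by move: h3; glra.
have Sy : S y by apply: Sigma_eq_enorm Sx.
have h1 := key x y Sx xy xd xA.
have := key y x Sy (esym xy); rewrite enormB => /(_ xd xA) h2.
by rewrite ler_norml h1 -lerN2 opprB.
Qed.

Definition eventually_ge e : Prop := dot e e = 1 /\
  forall eps : R, 0 < eps -> exists T : R, forall t x, T <= t -> hd e x -> - eps <= wdiff e x t.

(** The distance allowed between the directions does not depend on the late time [t], which
    closedness of [eventually_ge] requires. *)
Lemma wdiff_close (eps : R) : 0 < eps -> exists d T : R, 0 < d /\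
  forall e e' t eta, dot e e = 1 -> dot e' e' = 1 -> enorm (e' - e) < d ->
    T <= t -> 0 <= eta -> (forall x, hd e x -> - eta <= wdiff e x t) ->
    forall x, hd e' x -> - (eta + eps) <= wdiff e' x t.
Proof.
move=> eps0.
have [d0 [T [d00 T1 hd0]]] := angular_equicontinuity eps0.
have [M0 hM0] := u_decay (divr_gt0 eps0 (ltr0n _ 2)).
pose M := `|M0| + 1.
have Mp : 0 < M by rewrite /M ltr_wpDl.
exists (d0 / (4 * M)), T; split; first by rewrite divr_gt0 // mulr_gt0.
move=> e e' t eta e1 e1' ee Tt eta0 we x [Sx xe'].
have t0 : 0 < t by apply: lt_le_trans Tt; apply: lt_le_trans T1.
have Sr f : dot f f = 1 -> S (refl_hyp f x) by move=> f1; apply/Sigma_refl.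
have [xM|xM] := ltP M (enorm x).
  have M0x : M0 < enorm x.
    by apply: lt_trans xM; apply: le_lt_trans (ler_norm _) _; rewrite /M ltrDl.
  have h1 := hM0 x t Sx t0 M0x.
  have := hM0 (refl_hyp e' x) t (Sr _ e1') t0; rewrite enorm_refl // => /(_ M0x) h2.
  move: h1 h2; rewrite !ltr_norml /wdiff => /andP[h1 _] /andP[_ h2].
  by move: eta0 h1 h2; glra.
have md : enorm (e' - e) * (4 * M) < d0 by rewrite -ltr_pdivlMr // mulr_gt0.
have rc : 4 * enorm (e' - e) * enorm x <= enorm (e' - e) * (4 * M).
  by rewrite -mulrA mulrCA ler_wpM2l ?enorm_ge0 // ler_pM2l.
(* If [x] is on the positive side for both directions, its two mirror images are close; otherwise it
   is close to its own image under [e']. *)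
have [xe|xe] := ltP 0 (dot x e).
  have := we x (conj Sx xe).
  have := hd0 (refl_hyp e x) (refl_hyp e' x) t (Sr _ e1) Tt.
  rewrite !enorm_refl // enormB => /(_ erefl (le_lt_trans (le_trans (refl_close x e1 e1') rc) md)).
  rewrite ler_norml /wdiff => /andP[h1 h2] h3.
  by move: h1 h2 h3; glra.
have xs : enorm (x - refl_hyp e' x) < d0.
  have -> : x - refl_hyp e' x = (2 * dot x e') *: e' by rewrite /refl_hyp opprB addrC subrK.
  rewrite enormZ (enorm1 e').2 // mulr1 gtr0_norm ?mulr_gt0 //.
  apply: le_lt_trans md; apply: le_trans rc.
  have : dot x e' <= enorm x * enorm (e' - e).
    by apply: le_trans (dot_le _ _); rewrite dotDr dotNr lerDl oppr_ge0.
  have := mulr_ge0 (enorm_ge0 x) (enorm_ge0 (e' - e)).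
  rewrite -mulrA (mulrC (enorm (e' - e))).
  by move: (dot x e') (enorm x * _) => p q; glra.
have := hd0 x (refl_hyp e' x) t Sx Tt; rewrite enorm_refl // => /(_ erefl xs).
rewrite ler_norml /wdiff => /andP[h1 _]; apply: le_trans h1.
by rewrite lerN2 lerDr.
Qed.

Lemma closed_eventually_ge : closed [set e | eventually_ge e].
Proof.
move=> e cle.
have e1 : dot e e = 1.
  have : closed ((fun x => dot x x) @^-1` [set (1 : R)]).
    apply: closed_comp; last exact: closed_eq.
    by move=> y _; exact: continuous_sqr_enorm.
  by apply; apply: closure_subset cle => y [].
split => // eps eps0.
have e20 : 0 < eps / 2 by rewrite divr_gt0.
have [d [T [d0 hc]]] := wdiff_close e20.
have nb : nbhs e [set x | enorm (x - e) < d] by apply/nbhs_enormP; exists d.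
have [e' [[e1' he'] /= ee]] := cle _ nb.
have [T' hT'] := he' _ e20.
exists (Num.max T T') => t x; rewrite ge_max => /andP[Tt T't] hx.
rewrite [eps]splitr; apply: (hc e' e t) => //; first by rewrite enormB.
  exact: ltW.
by move=> y hy; apply: hT'.
Qed.

Lemma wdiff_local e x t (eps : R) : dot e e = 1 -> rad <= enorm x -> 0 <= t -> 0 < eps ->
  exists2 d : R, 0 < d & forall e' x', dot e' e' = 1 -> rad <= enorm x' ->
    enorm (e' - e) < d -> enorm (x' - x) < d -> `|wdiff e' x' t - wdiff e x t| < eps.
Proof.
move=> e1 rx t0 eps0.
have e20 : 0 < eps / 2 by rewrite divr_gt0.
have It : (`[0, +oo[%classic : set R) t by rewrite /= in_itv /= t0.
have cu := (within_prod_continuousP _ _ _).1 u_cont.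
have rsx : rad <= enorm (refl_hyp e x) by rewrite enorm_refl.
have [d1 d10 h1] := cu x t rx It _ e20.
have [d2 d20 h2] := cu (refl_hyp e x) t rsx It _ e20.
pose q := 4 * enorm x + 1.
have q0 : 0 < q by rewrite ltr_wpDl // mulr_ge0 // enorm_ge0.
exists (Num.min d1 (Num.min (d2 / 2) (d2 / 2 / q))).
  by rewrite !lt_min d10 !divr_gt0.
move=> e' x' e1' rx'; rewrite !lt_min => /and3P[_ _ eq] /and3P[x1 x2 _].
have := h1 x' t rx' It x1; rewrite subrr normr0 => /(_ d10).
have rsx' : rad <= enorm (refl_hyp e' x') by rewrite enorm_refl.
have := h2 (refl_hyp e' x') t rsx' It; rewrite subrr normr0.
have -> : refl_hyp e' x' - refl_hyp e x =
    (refl_hyp e' x' - refl_hyp e' x) + (refl_hyp e' x - refl_hyp e x).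
  by rewrite addrA subrK.
have dl : enorm (refl_hyp e' x' - refl_hyp e' x + (refl_hyp e' x - refl_hyp e x)) < d2.
  apply: le_lt_trans (enormD _ _) _; rewrite refl_hyp_dist //.
  have := refl_close x e1 e1' => rc.
  have : enorm (e' - e) * q < d2 / 2 by rewrite -ltr_pdivlMr.
  rewrite (_ : enorm (e' - e) * q = 4 * enorm (e' - e) * enorm x + enorm (e' - e)).
    move: rc x2 (enorm_ge0 (e' - e)).
    by move: (enorm (refl_hyp e' x - _)) (4 * _ * _) => p1 p2; glra.
  by rewrite /q; ring.
move=> /(_ dl d20) k2 k1; rewrite /wdiff.
have -> : u x' t - u (refl_hyp e' x') t - (u x t - u (refl_hyp e x) t) =
    (u x' t - u x t) - (u (refl_hyp e' x') t - u (refl_hyp e x) t) by ring.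
by rewrite [eps]splitr; apply: le_lt_trans (ler_normB _ _) (ltrD k1 k2).
Qed.

Lemma cover_directions (P : 'rV[R]_N -> 'rV[R]_N -> Prop) e (M : R) :
  (forall x, rad <= enorm x <= M -> exists2 d : R, 0 < d & forall e' x',
     dot e' e' = 1 -> rad <= enorm x' -> enorm (e' - e) < d -> enorm (x' - x) < d -> P e' x') ->
  exists2 d : R, 0 < d & forall e' x', dot e' e' = 1 -> rad <= enorm x' <= M ->
    enorm (e' - e) < d -> P e' x'.
Proof.
move=> hP; pose K1 := [set x : 'rV[R]_N | rad <= enorm x <= M].
have cK : compact K1.
  apply: (@ebounded_closed_compact _ _ _ M); first by move=> x /andP[].
  rewrite (_ : K1 = (@enorm R N) @^-1` [set r | rad <= r] `&` (@enorm R N) @^-1` [set r | r <= M]).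
    by apply: closedI; (apply: closed_comp; [move=> y _; exact: continuous_enorm|]);
      [exact: closed_ge|exact: closed_le].
  by apply/seteqP; split => x /=; rewrite /K1 /=; [case/andP|case=> -> ->].
have FF := nbhs_filter e.
have hloc x : K1 x -> \forall x' \near x & e' \near e,
    dot e' e' = 1 -> K1 x' -> P e' x'.
  move=> Kx; have [d d0 hd0] := hP x Kx.
  exists ([set x' | enorm (x' - x) < d], [set e' | enorm (e' - e) < d]).
    by split; apply/nbhs_enormP; exists d.
  by move=> [x' e'] /= [xx ee] e1 /andP[rx _]; exact: hd0.
have /nbhs_enormP [d d0 hd0] := (compact_near_coveringP K1).1 cK _ (nbhs e)
  (fun e' x' => dot e' e' = 1 -> K1 x' -> P e' x') FF hloc.
by exists d => // e' x' e1 Kx ee; exact: (hd0 e' ee x' Kx e1 Kx).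
Qed.

(** At one fixed time joint continuity suffices, also for small [t], where [wdiff_close] says
    nothing; compactness makes it uniform on bounded sets and the decay of [u] covers the rest. *)
Lemma wdiff_ge_nearby e t (eta eps : R) : dot e e = 1 -> 0 < t -> 0 <= eta -> 0 < eps ->
  (forall x, hd e x -> - eta <= wdiff e x t) ->
  exists2 d : R, 0 < d & forall e' x, dot e' e' = 1 -> enorm (e' - e) < d ->
    hd e' x -> - (eta + eps) <= wdiff e' x t.
Proof.
move=> e1 t0 eta0 eps0 we.
have we' x : half_closed rad e x -> - eta <= wdiff e x t.
  move=> hx; have [/we //|nx] := pselect (hd e x).
  by rewrite (ls_bdry (u_lsol e1) hx nx (ltW t0)) oppr_le0.
have [M0 hM0] := u_decay (divr_gt0 eps0 (ltr0n _ 2)).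
have [|d d0 hd0] := @cover_directions
    (fun e' x => 0 <= dot x e' -> - (eta + eps) <= wdiff e' x t) e M0.
  move=> x /andP[rx _]; have [xe|xe] := leP 0 (dot x e).
    have [d d0 hd0] := wdiff_local e1 rx (ltW t0) eps0.
    exists d => // e' x' e1' rx' ee xx _.
    have := hd0 e' x' e1' rx' ee xx; rewrite ltr_norml => /andP[h1 _].
    have := we' x (conj xe rx); move: h1; glra.
  have x0 : 0 < enorm x + 2 by rewrite ltr_wpDl // enorm_ge0.
  (* So small that nearby [x'] and [e'] still satisfy [dot x' e' < 0], which makes the claim vacuous
     there. *)
  exists (- dot x e / (enorm x + 2)).
    by rewrite divr_gt0 // oppr_gt0.
  set dl := _ / _ => e' x' e1' rx' ee xx x'e'; exfalso.
  have dlE : dl * (enorm x + 2) = - dot x e by rewrite divfK // gt_eqF.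
  have : dot x' e' = dot (x' - x) e' + dot x (e' - e) + dot x e.
    by rewrite !dotDl !dotDr !dotNl !dotNr; ring.
  have := dot_le (x' - x) e'; rewrite (enorm1 e').2 // mulr1 => h1.
  have h2 := dot_le x (e' - e).
  have h3 : enorm x * enorm (e' - e) <= enorm x * dl.
    by apply: (ler_wpM2l (enorm_ge0 x)); exact: ltW.
  have dl0 : 0 < dl by apply: le_lt_trans xx; exact: enorm_ge0.
  move: h1 (le_trans h2 h3) dlE xx x'e' dl0; rewrite mulrDr (mulrC dl).
  by move: (enorm x * dl) => p; glra.
exists d => // e' x e1' ee [Sx xe']; have [xM|xM] := leP (enorm x) M0.
  by apply: hd0 => //; [rewrite (Sigma_le Sx)|exact: ltW].
have Sr : S (refl_hyp e' x) by apply/Sigma_refl.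
have h1 := hM0 x t Sx t0 xM.
have := hM0 (refl_hyp e' x) t Sr t0; rewrite enorm_refl // => /(_ xM) h2.
move: h1 h2; rewrite !ltr_norml /wdiff => /andP[h1 _] /andP[_ h2].
by move: eta0 h1 h2; glra.
Qed.

(** The conclusion of [stability]. That [eta] is fixed before the direction, the solution and the
    time is what permits perturbing [e]. *)
Hypothesis u_stable : forall (d0 R0 r1 r2 del : R), 0 < d0 -> rad < R0 -> 0 < r2 -> 0 < del ->
  exists2 eta : R, 0 < eta & forall e w x0 (T : R), lsol e w ->
    [/\ d0 <= dot x0 e, R0 <= enorm x0 & enorm x0 <= r1] -> 0 <= T ->
    (forall x, hd e x -> - eta <= w x T) ->
    (forall z, enorm (z - x0) < r2 -> del <= w z T) ->
    forall eps : R, 0 < eps -> exists T2 : R, forall t x, T2 <= t -> hd e x ->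
      - eps <= w x t.

(* [w_e] is positive near [x0] with a quantitative bound that does not depend
   on the time [T]; then small negative parts are absorbed. *)
Lemma eventually_ge_nearby e x0 (r del : R) : dot e e = 1 -> hd e x0 -> 0 < r -> 0 < del ->
  exists2 eta : R, 0 < eta & forall T, 0 < T ->
    (forall x, hd e x -> - eta <= wdiff e x T) ->
    (forall z, enorm (z - x0) < r -> del <= wdiff e z T) ->
    exists2 d : R, 0 < d & forall e', dot e' e' = 1 -> enorm (e' - e) < d -> eventually_ge e'.
Proof.
move=> e1 [Sx0 xe] r0 del0.
have x00 : 0 < enorm x0.
  rewrite lt_neqAle enorm_ge0 andbT eq_sym; apply/eqP => /enorm_eq0 x0E.
  by move: xe; rewrite x0E dot0l ltxx.
have rx0 : rad < enorm x0 by case/SigmaP : Sx0 => // ->.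
have [dS dS0 hdS] := Sigma_nbhs Sx0.
pose r' := Num.min (Num.min (r / 2) 1) (dS / 2).
have r'0 : 0 < r' by rewrite !lt_min !divr_gt0 // ltr01.
have d20 : 0 < dot x0 e / 2 by rewrite divr_gt0.
have del20 : 0 < del / 2 by rewrite divr_gt0.
have [eta eta0 hst] := u_stable (enorm x0) d20 rx0 r'0 del20.
have eta20 : 0 < eta / 2 by rewrite divr_gt0.
exists (eta / 2) => // T T0 we wz.
have [d1 d10 h1] := wdiff_ge_nearby e1 T0 (ltW eta20) eta20 we.
have [|d2 d20' h2] := @cover_directions
    (fun e' x => enorm (x - x0) < r' -> del / 2 <= wdiff e' x T) e (enorm x0 + 1).
  move=> x /andP[rx _]; have [xx|xx] := ltP (enorm (x - x0)) r.
    have [d d0 hd0] := wdiff_local e1 rx (ltW T0) del20.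
    exists d => // e' x' e1' rx' ee xx' _.
    have := hd0 e' x' e1' rx' ee xx'; rewrite ltr_norml => /andP[k1 _].
    by have := wz x xx; move: k1; glra.
  exists (r / 2); first by rewrite divr_gt0.
  move=> e' x' _ _ _ xx'; rewrite !lt_min => /andP[/andP[k1 _] _]; exfalso.
  have := enormD3 x' x x0; rewrite (enormB x x').
  by move: xx xx' k1; glra.
have x02 : 0 < 2 * enorm x0 by rewrite mulr_gt0.
(* The last bound keeps [dot x0 e'] at least half of [dot x0 e]. *)
exists (Num.min (Num.min d1 d2) (dot x0 e / (2 * enorm x0))).
  by rewrite !lt_min d10 d20' divr_gt0.
move=> e' e1'; rewrite !lt_min => /andP[/andP[ed1 ed2] ed3]; split => // eps eps0.
have ex : enorm x0 * enorm (e' - e) < dot x0 e / 2.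
  by move: ed3; rewrite ltr_pdivlMr // mulrC -mulrA ltr_pdivlMr // mulrC.
apply: (hst e' _ x0 T (u_lsol e1')) => //.
- split => //.
  have : dot x0 e' = dot x0 e - dot x0 (e - e') by rewrite dotDr dotNr; ring.
  have := dot_le x0 (e - e'); rewrite enormB.
  by move: ex; move: (enorm x0 * _) => p; glra.
- exact: ltW.
- by move=> x hx; rewrite [eta]splitr; exact: h1.
move=> z zr; have := zr; rewrite !lt_min => /andP[/andP[_ z1] z2].
apply: h2 => //; apply/andP; split.
  apply: Sigma_le => //; apply: hdS; apply: lt_le_trans z2 _.
  by move: dS0; glra.
have := enormD (z - x0) x0; rewrite subrK.
by move: z1; glra.
Qed.

Definition asymptotically_sym e : Prop := dot e e = 1 /\
  forall x, S x -> wdiff e x t @[t --> +oo] --> (0 : R).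

Lemma asymptotically_sym_half e : dot e e = 1 ->
  (forall x, hd e x -> wdiff e x t @[t --> +oo] --> (0 : R)) -> asymptotically_sym e.
Proof.
move=> e1 key; split => // x Sx.
have [xe|xe|xe] := ltgtP 0 (dot x e).
- exact: key.
- have : hd e (refl_hyp e x).
    by split; [apply/Sigma_refl|rewrite refl_dot // oppr_gt0].
  move=> /key h; rewrite (_ : (fun t => wdiff e x t) = (fun t => - wdiff e (refl_hyp e x) t)).
    by rewrite -[0 in X in _ --> X]oppr0; apply: cvgN.
  by apply/funext => t /=; rewrite wdiff_refl // opprK.
rewrite (_ : (fun t => wdiff e x t) = fun=> 0); first exact: cvg_cst.
by apply/funext => t; rewrite /wdiff refl_hyp_id ?subrr.
Qed.

(** Since the negative part vanishes, failure of convergence means [wdiff e x0 >= del] at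
    arbitrarily late times. [local_lipschitz] spreads this to a ball of time-independent radius, so
    [eta] is fixed before a time is chosen at which the negative part is below it. *)
Lemma eventually_ge_open e : eventually_ge e -> ~ asymptotically_sym e ->
  exists2 d : R, 0 < d & forall e', dot e' e' = 1 -> enorm (e' - e) < d -> eventually_ge e'.
Proof.
move=> [e1 he] ns.
have [x0 [hx0 [del del0 hdel]]] : exists x0, hd e x0 /\ exists2 del : R, 0 < del &
    forall T : R, exists2 t, T <= t & del <= wdiff e x0 t.
  apply: contrapT => no; apply: ns; apply: asymptotically_sym_half => // y hy.
  apply/cvgrPdist_lt => eps eps0.
  have e20 : 0 < eps / 2 by rewrite divr_gt0.
  have [T1 hT1] := he _ e20.
  have [T2 hT2] : exists T, forall t, T <= t -> wdiff e y t < eps.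
    apply: contrapT => no2; apply: no; exists y; split => //; exists eps => // T.
    apply: contrapT => no3; apply: no2; exists T => t Tt; rewrite ltNge; apply/negP => h.
    by apply: no3; exists t.
  exists (Num.max T1 T2); split; first exact: num_real.
  move=> t /=; rewrite gt_max => /andP[t1 t2].
  rewrite distrC subr0 ltr_norml hT2 ?(ltW t2) // andbT.
  have := hT1 t y (ltW t1) hy; move: eps0; glra.
have wb x t : hd e x -> 0 < t -> `|wdiff e x t| <= 2 * K.
  by move=> [Sx _] t0; exact: wdiff_bound.
have [r [C [r0 C0' hlip]]] := local_lipschitz C00 V_bounded (u_lsol e1) hx0 (mulr_ge0 (ler0n _ 2) K0) wb.
pose r' := Num.min r (del / 2 / C).
have r'0 : 0 < r' by rewrite lt_min r0 !divr_gt0.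
have del20 : 0 < del / 2 by rewrite divr_gt0.
have [eta eta0 hn] := eventually_ge_nearby e1 hx0 r'0 del20.
have [T1 hT1] := he _ eta0.
have [T TT hT] := hdel (Num.max 2 T1).
move: TT; rewrite ge_max => /andP[T2 T1T].
have T0 : 0 < T by apply: lt_le_trans T2.
have T11 : 1 < T by apply: lt_le_trans T2; rewrite ltr1n.
apply: (hn T T0); first by move=> x hx; exact: hT1.
move=> z; rewrite lt_min => /andP[zr zC].
have := hlip z x0 T zr _ T11; rewrite subrr enorm0 => /(_ r0) h.
have : C * enorm (z - x0) < del / 2 by rewrite mulrC -ltr_pdivlMr.
by move: h hT; move: (C * _) => p; glra.
Qed.

Lemma eventually_ge_both e : eventually_ge e -> eventually_ge (- e) -> asymptotically_sym e.
Proof.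
move=> [e1 h1] [_ h2]; apply: asymptotically_sym_half => // x hx.
apply/cvgrPdist_lt => eps eps0.
have e20 : 0 < eps / 2 by rewrite divr_gt0.
have [T1 hT1] := h1 _ e20; have [T2 hT2] := h2 _ e20.
exists (Num.max T1 T2); split; first exact: num_real.
move=> t /=; rewrite gt_max => /andP[t1 t2].
have hrx : hd (- e) (refl_hyp e x).
  by case: hx => Sx xe; split; [apply/Sigma_refl|rewrite dotNr refl_dot // opprK].
have := hT2 t _ (ltW t2) hrx; rewrite wdiffN wdiff_refl // => k2.
have k1 := hT1 t x (ltW t1) hx.
by rewrite distrC subr0 ltr_norml; move: k1 k2 eps0; glra.
Qed.

Variable e0 : 'rV[R]_N.
Hypothesis e01 : dot e0 e0 = 1.
Hypothesis e0_ge0 : forall x, hd e0 x -> 0 <= wdiff e0 x 0.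
Hypothesis e0_neq0 : exists2 x, hd e0 x & 0 < wdiff e0 x 0.

Ltac glra1 :=
  clear - rad0 C00 Lam0 V_lower V_bounded u_lsol u_cont K0 u_bound u_decay
          u_stable e01 e0_ge0 e0_neq0; lra.


Lemma wdiff_e0_ge0 x t : hd e0 x -> 0 <= t -> 0 <= wdiff e0 x t.
Proof.
move=> hx t0.
have T01 : 0 <= (0 : R) <= t by rewrite lexx.
have h0 y : hd e0 y -> - 0 <= wdiff e0 y 0 by move=> hy; rewrite oppr0; exact: e0_ge0.
have := growth_bound V_lower (u_lsol e01) T01 (lexx 0) h0 hx (t := t).
by rewrite mul0r oppr0 t0 lexx; apply.
Qed.

(** Continuity at time [0] carries strict positivity at [x0] to a ball at a short positive time,
    while [growth_bound] with [eta = 0] preserves nonnegativity. *)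
Lemma eventually_ge_near_e0 :
  exists2 d : R, 0 < d & forall e', dot e' e' = 1 -> enorm (e' - e0) < d -> eventually_ge e'.
Proof.
have [x0 hx0 w0] := e0_neq0.
have del0 : 0 < wdiff e0 x0 0 / 2 by rewrite divr_gt0.
have I0 : (`[0, +oo[%classic : set R) 0 by rewrite /= in_itv /= lexx.
have [d d0 hd0] := (within_prod_continuousP _ _ _).1 (ls_cont (u_lsol e01)) x0 0
  (half_domain_closed hx0) I0 _ del0.
have [d1 d10 hd1] := half_domain_nbhs e01 hx0.
have r0 : 0 < Num.min d d1 by rewrite lt_min d0.
have [eta eta0 hn] := eventually_ge_nearby e01 hx0 r0 del0.
have T0 : 0 < d / 2 by rewrite divr_gt0.
apply: (hn _ T0) => [x hx|z].
  by apply: le_trans (wdiff_e0_ge0 hx (ltW T0)); rewrite oppr_le0 ltW.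
rewrite lt_min => /andP[zd zd1].
have Id : (`[0, +oo[%classic : set R) (d / 2) by rewrite /= in_itv /= ltW.
have dd : `|d / 2 - 0| < d by rewrite subr0 gtr0_norm //; move: d0; glra1.
have := hd0 z _ (half_domain_closed (hd1 z zd1)) Id zd dd.
by rewrite ltr_norml => /andP[k1 _]; move: k1; glra1.
Qed.

Lemma circ_nbhs (a b : 'rV[R]_N) (t d : R) : 0 < d -> exists2 c : R, 0 < c &
  forall s, `|s - t| < c -> enorm (circ a b s - circ a b t) < d.
Proof.
move=> d0; have nb : nbhs (circ a b t) [set x | enorm (x - circ a b t) < d].
  by apply/nbhs_enormP; exists d.
have /nbhs_ballP [c /= c0 hc] := @continuous_circ R N a b t _ nb.
by exists c => // s hs; apply: hc; rewrite /ball /= distrC.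
Qed.

(** [t1] is the supremum of the angles up to which [eventually_ge] persists: closedness includes
    [t1], and without asymptotic symmetry openness would push beyond it. *)
Lemma rotation_stop v : dot v v = 1 -> dot e0 v = 0 -> exists t1 : R, [/\ 0 < t1,
  forall t, 0 <= t <= t1 -> eventually_ge (circ e0 v t) & asymptotically_sym (circ e0 v t1)].
Proof.
move=> v1 ev.
pose A : set R := [set t | 0 <= t <= pi /\ forall s, 0 <= s <= t -> eventually_ge (circ e0 v s)].
have au s : dot (circ e0 v s) (circ e0 v s) = 1 by exact: circ_unit.
have pi0 : 0 < pi :> R by exact: pi_gt0.
have [d d0 hnear] := eventually_ge_near_e0.
have [c c0 hc] := @circ_nbhs e0 v 0 d d0; rewrite circ0 in hc.
pose c' := Num.min (c / 2) pi.
have c'0 : 0 < c' by rewrite lt_min divr_gt0.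
have Ac : A c'.
  split; first by rewrite ltW //= ge_min lexx orbT.
  move=> s /andP[s0 sc]; apply: hnear => //; apply: hc.
  rewrite subr0 ger0_norm //; apply: le_lt_trans sc _.
  by rewrite gt_min; apply/orP; left; move: c0; glra1.
have sA : has_sup A by split; [exists c'|exists pi => t [/andP[]]].
pose t1 := sup A.
have t1c : c' <= t1 by apply: sup_upper_bound.
have t10 : 0 < t1 by apply: lt_le_trans t1c.
have t1pi : t1 <= pi by apply: sup_le_ub; [exists c'|move=> t [/andP[]]].
have below s : 0 <= s < t1 -> eventually_ge (circ e0 v s).
  move=> /andP[s0 st1].
  have /(sup_adherent)/(_ sA) [t [_ At] tlt] : 0 < t1 - s by rewrite subr_gt0.
  by apply: At; rewrite s0 /=; move: tlt; rewrite -/t1 opprB addrC subrK => /ltW.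
have at1 : eventually_ge (circ e0 v t1).
  have cl : closed [set t | eventually_ge (circ e0 v t)].
    apply: (closed_comp (f := circ e0 v) _ closed_eventually_ge).
    by move=> t _; exact: continuous_circ.
  apply: cl => B /nbhs_ballP [r /= r0 hB].
  exists (Num.max 0 (t1 - r / 2)); split; last first.
    apply: hB; rewrite /ball /=; have [h|h] := leP 0 (t1 - r / 2).
      by rewrite opprB addrC subrK gtr0_norm ?divr_gt0 //; move: r0; glra1.
    by rewrite subr0 gtr0_norm //; move: h r0; glra1.
  apply: below; rewrite le_max lexx /= gt_max t10 /=; move: r0; glra1.
exists t1; split => //.
  move=> t /andP[t0]; rewrite le_eqVlt => /orP[/eqP -> //|tt1].
  by apply: below; rewrite t0.
apply: contrapT => ns.
(* At [pi] the direction is [- e0], and [eventually_ge] for both [e0] and [- e0] is asymptotic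
   symmetry. *)
have [t1p|] := eqVneq t1 pi.
  apply: ns; rewrite t1p; apply: eventually_ge_both; first by rewrite -t1p.
  have := below 0; rewrite lexx t10 circ0 => /(_ isT).
  by rewrite circpi opprK.
rewrite neq_lt [pi < t1]ltNge t1pi orbF => t1lt.
have [d2 d20 h2] := eventually_ge_open at1 ns.
have [c2 c20 hc2] := @circ_nbhs e0 v t1 d2 d20.
pose q := t1 + Num.min (c2 / 2) (pi - t1).
have q0 : 0 < Num.min (c2 / 2) (pi - t1) by rewrite lt_min divr_gt0 // subr_gt0.
have : A q.
  split.
    rewrite /q -lerBrDl ge_min lexx orbT andbT addr_ge0 // ltW //.
  move=> s /andP[s0 sq]; have [st|st] := ltP s t1; first by apply: below; rewrite s0.
  apply: h2 => //; apply: hc2; rewrite ger0_norm ?subr_ge0 //.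
  have : Num.min (c2 / 2) (pi - t1) <= c2 / 2 by rewrite ge_min lexx.
  by move: sq c20; rewrite /q; move: (Num.min _ _) => m; glra1.
move=> /(sup_upper_bound sA); rewrite -/t1 /q gerDl leNgt q0 //.
Qed.

Lemma omega_refl_mono e : eventually_ge e -> refl_mono rad (omega_limit S u) e.
Proof.
move=> [e1 he]; split => // z x [zC [s sy hz]] Sx.
rewrite le_eqVlt => /orP[/eqP/esym h|xe]; first by rewrite refl_hyp_id.
have hx : hd e x by [].
have Srx : S (refl_hyp e x) by apply/Sigma_refl.
apply/ler_addgt0Pr => eps eps0; have [T hT] := he eps eps0.
have h1 : u x (s n) + eps @[n --> \oo] --> z x + eps.
  by apply: cvgD; [exact: hz|exact: cvg_cst].
have h2 := hz _ Srx.
apply: (ler_cvg_to h2 h1).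
have : \forall t \near +oo, T < t by apply: nbhs_pinfty_gt; exact: num_real.
move=> /sy [n0 _ hn]; exists n0 => // n /hn /= Tn.
by have := hT _ x (ltW Tn) hx; rewrite /wdiff; glra1.
Qed.

Lemma omega_refl_inv e : asymptotically_sym e -> refl_inv rad (omega_limit S u) e.
Proof.
move=> [e1 he]; split => // z x [zC [s sy hz]] Sx.
have Srx : S (refl_hyp e x) by apply/Sigma_refl.
have h1 : wdiff e x (s n) @[n --> \oo] --> z x - z (refl_hyp e x).
  by apply: cvgB; apply: hz.
have h2 : wdiff e x (s n) @[n --> \oo] --> (0 : R) by apply: cvg_comp sy (he x Sx).
have E : z x - z (refl_hyp e x) = 0 by apply: (cvg_unique _ h1 h2); exact: Rhausdorff.
by move/eqP: E; rewrite subr_eq0 => /eqP ->.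
Qed.

Theorem omega_limit_fss : (2 <= N)%N -> exists2 p : 'rV[R]_N, enorm p = 1 &
  forall z : 'rV[R]_N -> R, omega_limit S u z -> foliated_schwarz_symmetric S p z.
Proof.
move=> N2.
have cz (z : 'rV[R]_N -> R) : omega_limit S u z -> {within S, continuous z}.
  move=> [[zc _ _] _]; apply: continuous_subspaceW zc; exact: subset_closure.
have cov := @circ_cover R N rad (omega_limit S u) N2 e0 e01.
apply: (symmetric_family_fss N2 cz) => //.
apply: cov => v v1 ev; have [t1 [t10 h1 h2]] := rotation_stop v1 ev.
exists t1; split => // [t ht|]; first by apply: omega_refl_mono; exact: h1.
exact: omega_refl_inv.
Qed.

End Asymptotics.

(** * The nonlinear problem *)

Lemma continuous_bounded_segment {R : realType} (V : R -> R) (M : R) :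
  {within `[0, +oo[, continuous V} -> exists2 L : R, 0 <= L &
  forall r, 0 <= r <= M -> `|V r| <= L.
Proof.
move=> hV; have [M0|M0] := leP 0 M; last first.
  by exists 0 => // r /andP[r0 rM]; have := le_lt_trans (le_trans r0 rM) M0; rewrite ltxx.
have cV : {within `[0, M], continuous V}.
  by apply: continuous_subspaceW hV => x /=; rewrite !in_itv /= andbT => /andP[].
have [c1 _ h1] := EVT_max M0 cV; have [c2 _ h2] := EVT_min M0 cV.
exists (`|V c1| + `|V c2|); first exact: addr_ge0.
move=> r hr; have ir : r \in `[0, M]%R by rewrite in_itv.
have := h1 r ir; have := h2 r ir.
have := ler_norm (V c1); have := ler_norm (- V c2); rewrite normrN => k1 k2 k3 k4.
rewrite ler_norml; have := normr_ge0 (V c1); have := normr_ge0 (V c2); lra.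
Qed.

Lemma closed_exterior_closure {R : realType} {N : nat} (rad : R) (x : 'rV[R]_N) :
  0 <= rad -> rad <= enorm x -> closure (Sigma N rad) x.
Proof.
move=> rad0 rx; have [Sx|nSx] := pselect (Sigma N rad x); first exact: subset_closure.
have [r0 xr] : 0 < rad /\ enorm x = rad.
  have nr : rad != 0 by apply/eqP => r; apply: nSx; apply/SigmaP; left.
  split; first by rewrite lt_neqAle eq_sym nr.
  apply: le_anti; rewrite rx andbT leNgt; apply/negP => h; apply: nSx.
  by apply/SigmaP; right.
move=> B /nbhs_enormP [d d0 hB].
have d20 : 0 < d / 2 / rad by rewrite !divr_gt0.
exists ((1 + d / 2 / rad) *: x); split.
  apply/SigmaP; right; rewrite enormZ xr gtr0_norm ?addr_gt0 // mulrDl mul1r ltrDl.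
  by rewrite divfK ?gt_eqF // divr_gt0.
apply: hB; rewrite scalerDl scale1r addrAC subrr add0r enormZ xr gtr0_norm //.
by rewrite divfK ?gt_eqF // ltr_pdivrMr // ltr_pMr // ltr1n.
Qed.

Lemma linear_part {R : realType} (k1 k2 q a b g1 g2 c : R) :
  k1 + q * a = g1 -> k2 + q * b = g2 -> `|g1 - g2| <= c ->
  `|k1 - k2 + q * (a - b)| <= c.
Proof.
move=> <- <-; rewrite (_ : k1 - k2 + q * (a - b) = k1 + q * a - (k2 + q * b)) //.
by ring.
Qed.

Section Hypotheses.
Context {R : realType} {N : nat} (rad : R).
Hypothesis rad0 : 0 <= rad.

Lemma nonlinearity_lipschitz (f : R -> R -> R -> R) (C0 : R) :
  loc_unif_lipschitz rad f -> sup_abs_fu rad f = C0%:E ->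
  0 <= C0 /\ forall t r, 0 < t -> rad <= r -> forall v w, `|f t r v - f t r w| <= C0 * `|v - w|.
Proof.
move=> hl hs.
have key t r : 0 < t -> rad <= r ->
    0 <= C0 /\ forall v w, `|f t r v - f t r w| <= C0 * `|v - w|.
  move=> t0 rr; apply: derivative_bound_lipschitz => [K K0|s ds].
    have I1 : is_interval [set r].
      move=> x y -> -> z /andP[h1 h2] /=; apply: le_anti; by rewrite h1 h2.
    have [||C C0' hC] := hl [set r] K I1 _ _ K0.
    - by exists `|r|; split; [exact: num_real|move=> M rM x -> /=; exact: ltW].
    - by move=> x -> /=; rewrite in_itv /= rr.
    by exists C => // v w hv hw; exact: hC.
  rewrite -lee_fin -hs; apply: ereal_sup_ubound; exists t, r, s; split => //.
by split => [|t r t0 rr]; [have [] := key 1 rad ltr01 (lexx _)|have [] := key t r t0 rr].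
Qed.

Lemma sup_bound (u : 'rV[R]_N -> R -> R) :
  (ereal_sup [set (`|u y.1 y.2|%R)%:E
     | y in Sigma N rad `*` `]0%R, +oo[%classic] < +oo)%E ->
  exists2 K : R, 0 <= K & forall x t, Sigma N rad x -> 0 < t -> `|u x t| <= K.
Proof.
set s := ereal_sup _ => hs; exists `|fine s|; first exact: normr_ge0.
move=> x t Sx t0.
have h : (`|u x t|%:E <= s)%E.
  by apply: ereal_sup_ubound; exists (x, t) => //; split => //=; rewrite in_itv /= t0.
have sfin : s \is a fin_num.
  rewrite fin_numE; apply/andP; split; last by rewrite lt_eqF.
  by apply/eqP => sE; move: h; rewrite sE leeNy_eq.
by apply: le_trans (ler_norm _); rewrite -lee_fin fineK.
Qed.

Lemma decay_of_limit (u : 'rV[R]_N -> R -> R) :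
  ereal_sup [set `|u x t|%:E | t in `]0, +oo[]
    @[x --> at_infinity (Sigma N rad)] --> (0 : \bar R) ->
  forall eps : R, 0 < eps -> exists M : R, forall x t,
    Sigma N rad x -> 0 < t -> M < enorm x -> `|u x t| < eps.
Proof.
move=> hu eps eps0.
have nb : nbhs (0 : \bar R) [set y : \bar R | (y < eps%:E)%E].
  by apply: open_nbhs_nbhs; split; [exact: open_ereal_lt_ereal|rewrite /= lte_fin].
have [M _ hM] := hu _ nb; exists M => x t Sx t0 Mx.
rewrite -lte_fin; apply: le_lt_trans (hM x (conj Sx Mx)).
by apply: ereal_sup_ubound; exists t => //=; rewrite in_itv /= t0.
Qed.

(* The strict inequality between V outside and inside leaves room for a
   growth rate gam and for a slightly shorter interval [a, b]. *)
Lemma potential_gap (V : R -> R) (C0 lam rho : R) (J : set R) :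
  0 <= C0 -> 0 <= lam -> is_interval J -> J `<=` `[rad, rho[ -> 0 < itv_length J ->
  (ereal_sup [set (`|V r|%R)%:E | r in J]
     + (4 * (lam / itv_length J ^+ 2) + 2 * C0)%R%:E
     < ereal_inf [set (V r)%:E | r in `]rho, +oo[%classic])%E ->
  exists gam a b : R, [/\ [/\ 0 < gam, rad < a, a < b & b <= rho],
    forall r, rho < r -> gam + C0 < V r &
    forall r, a <= r <= b -> `|V r| + C0 + 4 * (lam / (b - a) ^+ 2) < gam].
Proof.
move=> C00 lam0 Ji JJ L0; set L := itv_length J in L0 *.
set s := ereal_sup _; set m := ereal_inf _ => hsm.
have [r0 Jr0] : J !=set0.
  apply/set0P/eqP => J0; move: L0; rewrite /L /itv_length J0 sup0 inf0 subrr ltxx //.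
have s_ge r : J r -> (`|V r|%:E <= s)%E.
  by move=> Jr; apply: ereal_sup_ubound; exists r.
have m_le r : rho < r -> (m <= (V r)%:E)%E.
  by move=> rr; apply: ereal_inf_lbound; exists r => //=; rewrite in_itv /= rr.
have mV := m_le (rho + 1) (_ : rho < rho + 1); rewrite ltrDl in mV; have {}mV := mV ltr01.
have sfin : s \is a fin_num.
  rewrite fin_numE; apply/andP; split.
    by apply/eqP => sE; have := s_ge _ Jr0; rewrite sE leeNy_eq.
  apply/eqP => sE; move: hsm; rewrite sE addye // => /lt_le_trans/(_ mV).
  by [].
have [A sA] : exists A, s = A%:E by exists (fine s); rewrite fineK.
have mfin : m \is a fin_num.
  rewrite fin_numE; apply/andP; split.
    by apply/eqP => mE; move: hsm; rewrite mE ltNge leNye.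
  by apply/eqP => mE; move: mV; rewrite mE leye_eq.
have [B mB] : exists B, m = B%:E by exists (fine m); rewrite fineK.
move: hsm; rewrite sA mB -EFinD lte_fin => hsm.
have A0 : 0 <= A by have := s_ge _ Jr0; rewrite sA lee_fin; apply: le_trans; exact: normr_ge0.
(* The midpoint between the inner requirement and the outer bound [B - C0]; the two copies of [C0]
   in the hypothesis are split between them. *)
pose gam := (A + 4 * (lam / L ^+ 2) + C0 + (B - C0)) / 2.
pose del := gam - (A + 4 * (lam / L ^+ 2) + C0).
have del0 : 0 < del by rewrite /del /gam; move: hsm; lra.
have [c c0 hc] : exists2 c : R, 0 < c & forall l, `|l - L| < c -> 4 * (lam / l ^+ 2) < 4 * (lam / L ^+ 2) + del.
  have cf : 4 * (lam * (l ^+ 2)^-1) @[l --> L] --> (4 * (lam * (L ^+ 2)^-1) : R).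
    apply: cvgM; first exact: cvg_cst.
    apply: cvgM; first exact: cvg_cst.
    by apply: cvgV; [rewrite sqrf_eq0 gt_eqF|exact: exprn_continuous].
  have /cvgrPdist_lt/(_ _ del0)/nbhs_ballP [c /= c0 hc] := cf.
  exists c => // l lL; have := hc l; rewrite /ball /= distrC => /(_ lL).
  by rewrite ltr_norml => /andP[h _]; move: h; clear - rad0; lra.
have q2 (r : R) : r <= c / 4 -> 2 * r < c by move: c0; clear - rad0; lra.
(* Shortening [J] by [q] at each end changes its length by [2 * q < c] and leaves it positive. *)
pose q := Num.min c L / 4.
have q0 : 0 < q by rewrite divr_gt0 // lt_min c0.
have qc : q <= c / 4 by rewrite ler_pM2r ?invr_gt0 // ge_min lexx.
have qL : q <= L / 4 by rewrite ler_pM2r ?invr_gt0 // ge_min lexx orbT.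
have LE : L = sup J - inf J by [].
have hI : has_inf J.
  by split; [exists r0|exists rad => x /JJ /=; rewrite in_itv /= => /andP[]].
have hS : has_sup J.
  by split; [exists r0|exists rho => x /JJ /=; rewrite in_itv /= => /andP[_ /ltW]].
have inJ r : inf J < r -> r < sup J -> J r.
  move=> h1 h2.
  have h1' : 0 < r - inf J by rewrite subr_gt0.
  have h2' : 0 < sup J - r by rewrite subr_gt0.
  have [x Jx xr] := inf_adherent h1' hI; have [y Jy yr] := sup_adherent h2' hS.
  apply: (Ji x y Jx Jy); apply/andP; split; apply: ltW.
    by move: xr; rewrite addrC subrK.
  by move: yr; rewrite opprB addrC subrK.
have irad : rad <= inf J.
  by apply: lb_le_inf; [exists r0|move=> x /JJ /=; rewrite in_itv /= => /andP[]].
have srho : sup J <= rho.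
  by apply: sup_le_ub; [exists r0|move=> x /JJ /=; rewrite in_itv /= => /andP[_ /ltW]].
exists gam, (inf J + q), (sup J - q); split.
- have : 0 <= 4 * (lam / L ^+ 2) by rewrite mulr_ge0 // divr_ge0 // sqr_ge0.
  move: A0 C00 del0 q0 qL irad srho LE; rewrite /del; clear; move=> *; split; lra.
- move=> r /m_le; rewrite mB lee_fin; move: del0; rewrite /del /gam; lra.
move=> r /andP[ra rb].
have Jr : J r by apply: inJ; move: ra rb q0; lra.
have := s_ge _ Jr; rewrite sA lee_fin => VA.
have h : `|sup J - q - (inf J + q) - L| < c.
  rewrite (_ : sup J - q - (inf J + q) - L = - (2 * q)); last by rewrite LE; ring.
  have qp : 0 < 2 * q by rewrite mulr_gt0.
  rewrite normrN (gtr0_norm qp); exact: q2.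
have := hc _ h; move: VA; rewrite /del.
by move: (4 * (lam / (_ - _) ^+ 2)) (4 * (lam / _ ^+ 2)) => p1 p2; clear - rad0; lra.
Qed.

End Hypotheses.

Theorem corollary1p4 (R : realType) (N : nat) (hN : (2 <= N)%N)
    (rad : R) (hrad : 0 <= rad)
    (f : R -> R -> R -> R)
    (hf_cont : continuous_in_tr rad f)
    (hf_lip : loc_unif_lipschitz rad f)
    (C0 : R) (hC0 : sup_abs_fu rad f = C0%:E)
    (lambda1 : R) (hlambda1 : principal_eigenvalue_ball N lambda1)
    (V : R -> R) (hV : {within `[0, +oo[, continuous V})
    (rho : R) (hrho : rad < rho)
    (J : set R) (hJ : is_interval J) (hJrho : J `<=` `[rad, rho[)
    (hJlen : 0 < itv_length J)
    (hVJ : (ereal_sup [set (`|V r|%R)%:E | r in J]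
            + (4 * (lambda1 / itv_length J ^+ 2) + 2 * C0)%R%:E
            < ereal_inf [set (V r)%:E | r in `]rho, +oo[%classic])%E)
    (u0 : 'rV[R]_N -> R) (u : 'rV[R]_N -> R -> R)
    (hu_reg : C21_on (Sigma N rad) u)
    (hu_cont : {within (closure (Sigma N rad) `*` `[0, +oo[ :
                          set ('rV[R]_N * R)),
                  continuous (fun y : 'rV[R]_N * R => u y.1 y.2)})
    (hu_eq : forall (x : 'rV[R]_N) (t : R), Sigma N rad x -> 0 < t ->
       'D_1 (u x) t - laplacian (u^~ t) x + V (enorm x) * u x t
       = f t (enorm x) (u x t))
    (hu_bdry : forall (x : 'rV[R]_N) (t : R), bdry (Sigma N rad) x -> 0 < t -> u x t = 0)
    (hu_init : forall x, Sigma N rad x -> u x 0 = u0 x)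
    (hu0 : C0_space (Sigma N rad) u0)
    (hu0_refl : exists2 e : 'rV[R]_N, usphere R N e &
       (forall x, half_domain (Sigma N rad) e x -> u0 (refl_hyp e x) <= u0 x) /\
       (exists2 x, Sigma N rad x & u0 x <> u0 (refl_hyp e x)))
    (hu_decay : ereal_sup [set `|u x t|%:E | t in `]0, +oo[]
                  @[x --> at_infinity (Sigma N rad)] --> (0 : \bar R))
    (hu_bound : (ereal_sup [set (`|u y.1 y.2|%R)%:E
                   | y in Sigma N rad `*` `]0%R, +oo[%classic] < +oo)%E) :
  exists2 p : 'rV[R]_N, usphere R N p &
    forall z, omega_limit (Sigma N rad) u z ->
      foliated_schwarz_symmetric (Sigma N rad) p z.
Proof.
have [C00 flip] := nonlinearity_lipschitz hf_lip hC0.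
have lam0 := principal_eigenvalue_ge0 hlambda1.
have [gam [a [b [[gam0 ra ab brho] V_out V_in]]]] :=
  potential_gap C00 lam0 hJ hJrho hJlen hVJ.
have V_bounded M : exists2 L : R, 0 <= L & forall r, 0 <= r <= M -> `|V r| + C0 <= L.
  have [L L0 hL] := continuous_bounded_segment M hV.
  by exists (L + C0) => [|r hr]; [exact: addr_ge0|rewrite lerD2r; exact: hL].
(* Up to [rho] by continuity of [V]; beyond it [C0 - V r] is negative by [V_out]. *)
have [Lam Lam0 V_lower] : exists2 Lam : R, 0 <= Lam & forall r, rad <= r -> C0 - V r <= Lam.
  have [L L0 hL] := V_bounded rho; exists L => // r rr.
  have [rrho|rrho] := leP r rho.
    have := hL r; rewrite rrho (le_trans hrad rr) => /(_ isT).
    by have := ler_norm (- V r); rewrite normrN; lra.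
  by have := V_out r rrho; move: gam0 L0; lra.
have [K K0 u_bound] := sup_bound hu_bound.
have u_decay := decay_of_limit hu_decay.
have u_cont : {within [set x : 'rV[R]_N | rad <= enorm x] `*` `[0, +oo[,
    continuous (fun y : 'rV[R]_N * R => u y.1 y.2)}.
  apply: continuous_subspaceW hu_cont => -[x t] [/= rx t0]; split => //=.
  exact: closed_exterior_closure.
have u_sphere x t : rad <= enorm x -> ~ Sigma N rad x -> 0 <= t -> u x t = 0.
  move=> rx nSx; have bx : bdry (Sigma N rad) x by split => //; exact: closed_exterior_closure.
  (* The boundary condition is given for positive times; time [0] follows by continuity. *)
  rewrite le_eqVlt => /orP[/eqP <-|]; last exact: hu_bdry.
  apply: contrapT => /eqP u00.
  have I0 : (`[0, +oo[%classic : set R) 0 by rewrite /= in_itv /= lexx.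
  have un0 : 0 < `|u x 0| by rewrite normr_gt0.
  have [d d0 hd] := (within_prod_continuousP _ _ _).1 u_cont x 0 rx I0 _ un0.
  have Id : (`[0, +oo[%classic : set R) (d / 2) by rewrite /= in_itv /= andbT divr_ge0 // ltW.
  have := hd x (d / 2) rx Id; rewrite subrr enorm0 subr0 gtr0_norm ?divr_gt0 // => /(_ d0).
  have dd : d / 2 < d by move: d0; lra.
  by move=> /(_ dd); rewrite hu_bdry ?divr_gt0 // sub0r normrN ltxx.
have u_lsol e : dot e e = 1 -> linsol rad V C0 e (wdiff u e).
  move=> e1; split => //.
  - apply/within_prod_continuousP => x t [xe rx] t0 eps eps0.
    have t0' : 0 <= t by move: t0; rewrite /= in_itv /= andbT.
    have e20 : 0 < eps / 2 by rewrite divr_gt0.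
    have cu := (within_prod_continuousP _ _ _).1 u_cont.
    have rsx : rad <= enorm (refl_hyp e x) by rewrite enorm_refl.
    have [d1 d10 h1] := cu x t rx t0 _ e20.
    have [d2 d20 h2] := cu (refl_hyp e x) t rsx t0 _ e20.
    exists (Num.min d1 d2); first by rewrite lt_min d10.
    move=> y s [ye ry] s0; rewrite !lt_min => /andP[y1 y2] /andP[s1 s2].
    have rsy : rad <= enorm (refl_hyp e y) by rewrite enorm_refl.
    have k1 := h1 y s ry s0 y1 s1.
    have := h2 (refl_hyp e y) s rsy s0; rewrite refl_hyp_dist // => /(_ y2 s2) k2.
    rewrite /wdiff (_ : _ - _ - _ = (u y s - u x t) - (u (refl_hyp e y) s - u (refl_hyp e x) t)).
      by rewrite [eps]splitr; apply: le_lt_trans (ler_normB _ _) (ltrD k1 k2).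
    by ring.
  - move=> x t [xe rx] nhx t0; rewrite /wdiff.
    have [Sx|nSx] := pselect (Sigma N rad x).
      rewrite refl_hyp_id ?subrr //; apply: le_anti; rewrite xe andbT leNgt.
      by apply/negP => xe'; apply: nhx.
    rewrite !u_sphere ?subrr ?enorm_refl //.
    by move/Sigma_refl => /(_ e1).
  - move=> x t [Sx xe] t0.
    have Srx : Sigma N rad (refl_hyp e x) by apply/Sigma_refl.
    have oS := @open_Sigma R N rad.
    have h1 := C21_heat oS hu_reg Sx t0.
    have h2 : heat (fun z s => u (refl_hyp e z) s) x t
        ('D_1 (u (refl_hyp e x)) t - laplacian (u^~ t) (refl_hyp e x)).
      apply: (heat_comp (Q := refl_mx e)) (C21_heat oS hu_reg Srx t0).
        by move=> z y; rewrite refl_mxE refl_hypD.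
      by rewrite refl_mx_sym refl_mx_orth.
    exists (('D_1 (u x) t - laplacian (u^~ t) x) -
      ('D_1 (u (refl_hyp e x)) t - laplacian (u^~ t) (refl_hyp e x))).
      exact: heat_sub h1 h2.
    have e1' := hu_eq x t Sx t0; have := hu_eq _ t Srx t0; rewrite enorm_refl // => e2'.
    (* A point and its mirror image have the same norm, so the two equations share [V] and the
       arguments [t], [r] of [f]. *)
    exact: (linear_part e1' e2' (flip t (enorm x) t0 (Sigma_le Sx) _ _)).
  move=> eps eps0; have e20 : 0 < eps / 2 by rewrite divr_gt0.
  have [M hM] := u_decay _ e20; exists M => x t [Sx xe] t0 Mx.
  rewrite [eps]splitr; apply: le_lt_trans (ler_normB _ _) _; apply: ltrD; apply: hM => //.
    by apply/Sigma_refl.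
  by rewrite enorm_refl.
have [e /enorm1 e1 [he [x1 Sx1 ux1]]] := hu0_refl.
have e_ge0 x : half_domain (Sigma N rad) e x -> 0 <= wdiff u e x 0.
  move=> hx; have := he x hx; case: hx => Sx _.
  by rewrite /wdiff !hu_init ?subr_ge0 //; apply/Sigma_refl.
have Srx1 : Sigma N rad (refl_hyp e x1) by apply/Sigma_refl.
have e_neq0 : exists2 x, half_domain (Sigma N rad) e x & 0 < wdiff u e x 0.
  have pos x : half_domain (Sigma N rad) e x -> u0 x <> u0 (refl_hyp e x) ->
      0 < wdiff u e x 0.
    move=> hx ne; rewrite lt_neqAle e_ge0 // andbT eq_sym; apply/eqP.
    case: hx => Sx _; rewrite /wdiff !hu_init //; last by apply/Sigma_refl.
    by move/eqP; rewrite subr_eq0 => /eqP.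
  (* The point of asymmetry may lie on the negative side; then its mirror image serves. *)
  have [xe|xe|xe] := ltgtP 0 (dot x1 e).
  - by exists x1; [|apply: pos].
  - have hx : half_domain (Sigma N rad) e (refl_hyp e x1).
      by split => //; rewrite refl_dot // oppr_gt0.
    exists (refl_hyp e x1) => //; apply: pos => //.
    by rewrite refl_hypK // => /esym.
  by case: ux1; rewrite refl_hyp_id.
have st d0 R0 r1 r2 del :=
  stability hrad Lam0 V_lower V_bounded hlambda1 gam0 ra ab brho V_out V_in
    (d0 := d0) (R0 := R0) r1 (r2 := r2) (del := del).
have [p p1 hp] := omega_limit_fss C00 Lam0 V_lower V_bounded u_lsol u_cont K0
  u_bound u_decay st e1 e_ge0 e_neq0 hN.
by exists p.
Qed.
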